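(* Let $\mathcal D=(G,\chi,a)$ be data with $\ell=|\chi(a)|\geq 2$, $M=|\chi|$, $N=|a|$, and suppose $\ell=M=N$ is odd. Let $g\beta,g'\beta'\in G\times\Gamma=G(D(H_{\mathcal D}))$, and let $c,c'\in\mathbb Z$ be such that $(a^{-1}\chi)^c$ and $(a^{-1}\chi)^{c'}$ are representatives of the classes of $g\beta$ and $g'\beta'$ in $(G\times\Gamma)/K$, respectively. Then the $D(H_{\mathcal D})$-module $H_{\mathcal D}\bullet_\beta g\otimes H_{\mathcal D}\bullet_{\beta'}g'$ is completely reducible if and only if $r_c+r_{c'}<\ell$. Moreover, let $$g_j=gg'a^j\quad\text{and}\quad\beta_j=\chi^{-j}\beta\beta'.$$ If $r_c+r_{c'}<\ell$, then $$H_{\mathcal D}\bullet_\beta g\otimes H_{\mathcal D}\bullet_{\beta'}g'\simeq\bigoplus_{j=0}^{\min(r_c,r_{c'})}H_{\mathcal D}\bullet_{\beta_j}g_j.$$ If $r_c+r_{c'}\ge\ell$, then $$\mathrm{Soc}\left(H_{\mathcal D}\bullet_\beta g\otimes H_{\mathcal D}\bullet_{\beta'}g'\right)\simeq\bigoplus_{j=\left[\frac{t+1}{2}\right]}^{\min(r_c,r_{c'})}H_{\mathcal D}\bullet_{\beta_j}g_j,$$ where $t=r_c+r_{c'}-\ell+1$.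
   Context: $\mathbb K$ is an algebraically closed field of characteristic $0$; $|\cdot|$ of a group element denotes its order. Data $\mathcal D=(G,\chi,a)$ consists of a finite abelian group $G$, a character $\chi:G\to\mathbb K^\times$ and $a\in G$. With $\ell=|\chi(a)|$, $H_{\mathcal D}$ is the Hopf algebra generated as an algebra by $G$ and $x$ with the relations of $G$, $x^\ell=0$, and $xg=\chi(g)gx$ for all $g\in G$, with $\Delta(x)=x\otimes a+1\otimes x$ and $\Delta(g)=g\otimes g$ for $g\in G$. $\Gamma=\mathrm{Hom}(G,\mathbb K^\times)$; each $\beta\in\Gamma$ is extended to an algebra map $H_{\mathcal D}\to\mathbb K$ by $\beta(x)=0$, so $\Gamma=G(H_{\mathcal D}^* )$. For a finite-dimensional Hopf algebra $H$, the Drinfel'd double is $D(H)=(H^* )^{\mathrm{coop}}\otimes H$ as a coalgebra, with product $(g\otimes h)(f\otimes k)=\sum g\,(h_{(1)}\rightharpoonup f\leftharpoonup S^{-1}(h_{(3)}))\otimes h_{(2)}k$, where $\langle b\rightharpoonup f,c\rangle=\langle f,cb\rangle$ and $\langle f\leftharpoonup b,c\rangle=\langle f,bc\rangle$. With $\xi\in H_{\mathcal D}^*$ the functional $\xi(gx^j)=\delta_{j,1}$, $D(H_{\mathcal D})$ is generated by $G,x,\Gamma,\xi$ with relations $x^\ell=0$, $xg=\chi(g)gx$, $\xi^\ell=0$, $\xi\gamma=\gamma(a)\gamma\xi$, $g\gamma=\gamma g$, $\xi g=\chi^{-1}(g)g\xi$, $[x,\xi]=a-\chi$, $\gamma(a)x\gamma=\gamma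 x$ (with the relations of $G$ and $\Gamma$). Its group of group-like elements is $G\times\Gamma$, with elements written $g\gamma$. For $\beta\in G(H^* )$ and $g\in G(H)$ with $H=H_{\mathcal D}$, $H\bullet_\beta g=\{h\bullet_\beta g:h\in H\}\subset H$ where $h\bullet_\beta b=\sum\beta(h_{(2)})h_{(3)}\,b\,S^{-1}(h_{(1)})$; it is a $D(H)$-module with $H$ acting by $\bullet_\beta$ and $f\in H^*$ acting by $f\cdot m=\sum\langle f,m_{(2)}\rangle m_{(1)}$, where $\Delta(m)=\sum m_{(1)}\otimes m_{(2)}$. $K=\ker(\mathrm{ev}_{\chi^{-1}a})\subset G\times\Gamma$, where $\mathrm{ev}_{\chi^{-1}a}(g\gamma)=\chi^{-1}(g)\gamma(a)$. (If $\ell=M=N$ is odd, every class in $(G\times\Gamma)/K$ has a representative $(a^{-1}\chi)^c$, $c\in\mathbb Z$.) For $c\in\mathbb Z$, $r_c$ is the integer with $0\le r_c<\ell$ and $r_c\equiv2c\pmod\ell$. $[\,\cdot\,]$ denotes integer part, and $\mathrm{Soc}$ the socle (sum of all simple submodules). *)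

(* Defs.v *)
From HB Require Import structures.
From mathcomp Require Import all_boot all_order all_algebra all_fingroup all_field.

Set Implicit Arguments.
Unset Strict Implicit.
Unset Printing Implicit Defensive.

Import GRing.Theory.
Local Open Scope ring_scope.

Section Tensor.
Variable K : fieldType.
Implicit Types U V : vectType K.

Definition lin (U W : lmodType K) (f : U -> W) : Prop :=
  forall a u v, f (a *: u + v) = a *: f u + f v.

Definition bilin (U V W : lmodType K) (f : U -> V -> W) : Prop :=
  (forall v, lin (f^~ v)) /\ (forall u, lin (f u)).

Definition bvec U (i : 'I_(\dim {:U})) : U := (vbasis {:U})`_i.
Definition bcoord U (i : 'I_(\dim {:U})) (u : U) : K := coord (vbasis {:U}) i u.

(* U (x) V, in the coordinates given by the bases [bvec] of U and V;
   its universal property is [tliftE] with [tensor_ext] below. *)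
Definition tensor U V : vectType K := 'M[K]_(\dim {:U}, \dim {:V}).

Definition tens U V (u : U) (v : V) : tensor U V :=
  \matrix_(i, j) (bcoord i u * bcoord j v).

(* the linear map U (x) V -> W with u (x) v |-> f u v, for f bilinear *)
Definition tlift U V (W : lmodType K) (f : U -> V -> W) (t : tensor U V) : W :=
  \sum_i \sum_j (t : 'M_(_, _)) i j *: f (bvec i) (bvec j).

Lemma lin_id (U : lmodType K) : lin (fun u : U => u).
Proof. by []. Qed.

Lemma lin0 (U W : lmodType K) (f : U -> W) : lin f -> f 0 = 0.
Proof.
by move=> L; have := L (-1) 0 0; rewrite scaler0 addr0 scaleN1r addNr.
Qed.

Lemma linZ (U W : lmodType K) (f : U -> W) : lin f ->
  forall a u, f (a *: u) = a *: f u.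
Proof. by move=> L a u; have := L a u 0; rewrite (lin0 L) !addr0. Qed.

Lemma linD (U W : lmodType K) (f : U -> W) : lin f ->
  forall u v, f (u + v) = f u + f v.
Proof. by move=> L u v; have := L 1 u v; rewrite !scale1r. Qed.

Lemma lin_sum (U W : lmodType K) (f : U -> W) (I : finType) (F : I -> U) :
  lin f -> f (\sum_i F i) = \sum_i f (F i).
Proof. by move=> L; apply: big_morph; [exact: linD | exact: lin0]. Qed.

Lemma lin_app (U0 : lmodType K) (U W : lmodType K)
  (L : {linear U -> W}) (f : U0 -> U) : lin f -> lin (fun u => L (f u)).
Proof. by move=> Lf a u v; rewrite Lf linearP. Qed.

Lemma lin_comp (U0 U W : lmodType K) (L : U -> W) (f : U0 -> U) :
  lin L -> lin f -> lin (fun u => L (f u)).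
Proof. by move=> LL Lf a u v; rewrite Lf LL. Qed.

Lemma bvec_expand U (u : U) : u = \sum_i bcoord i u *: bvec i.
Proof. exact/coord_vbasis/memvf. Qed.

Lemma bcoord_lin U (i : 'I_(\dim {:U})) : lin (bcoord i : U -> K^o).
Proof. by move=> a u v; rewrite /bcoord linearP. Qed.

Lemma bcoord_bvec U (i j : 'I_(\dim {:U})) : bcoord i (bvec j) = (i == j)%:R.
Proof.
by rewrite /bcoord /bvec coord_free ?(basis_free (vbasisP _)) // eq_sym.
Qed.

Lemma tens_bilin U V : bilin (@tens U V).
Proof.
split=> w a u v; apply/matrixP => i j; rewrite !mxE bcoord_lin.
  by rewrite mulrDl -mulrA.
by rewrite mulrDr mulrCA.
Qed.

Lemma tensE U V (u : U) (v : V) i j :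
  (tens u v : 'M_(_, _)) i j = bcoord i u * bcoord j v.
Proof. by rewrite mxE. Qed.

Lemma tens_bvec U V (i : 'I_(\dim {:U})) (j : 'I_(\dim {:V})) :
  tens (bvec i) (bvec j) = delta_mx i j.
Proof.
apply/matrixP => k l; rewrite tensE !bcoord_bvec !mxE.
by rewrite -natrM mulnb.
Qed.

Lemma tensor_expand U V (t : tensor U V) :
  t = \sum_i \sum_j (t : 'M_(_, _)) i j *: tens (bvec i) (bvec j).
Proof.
rewrite [LHS](matrix_sum_delta (t : 'M_(_, _))).
by apply: eq_bigr => i _; apply: eq_bigr => j _; rewrite tens_bvec.
Qed.

Lemma tliftE U V (W : lmodType K) (f : U -> V -> W) u v :
  bilin f -> tlift f (tens u v) = f u v.
Proof.
move=> [fl fr]; rewrite [in RHS](bvec_expand u) (lin_sum _ (fl v)).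
apply: eq_bigr => i _; rewrite (linZ (fl v)) [in RHS](bvec_expand v).
rewrite (lin_sum _ (fr _)) scaler_sumr; apply: eq_bigr => j _.
by rewrite (linZ (fr _)) tensE scalerA.
Qed.

Lemma tlift_lin U V (W : lmodType K) (f : U -> V -> W) : lin (tlift f).
Proof.
move=> a s t; rewrite /tlift scaler_sumr -big_split; apply: eq_bigr => i _ /=.
rewrite scaler_sumr -big_split; apply: eq_bigr => j _ /=.
by rewrite !mxE scalerDl scalerA.
Qed.

Lemma lin_tlift U V (X W : lmodType K) (F : X -> U -> V -> W) t :
  (forall u v, lin (fun x => F x u v)) -> lin (fun x => tlift (F x) t).
Proof.
move=> L a x y; rewrite /tlift scaler_sumr -big_split; apply: eq_bigr => i _ /=.
rewrite scaler_sumr -big_split; apply: eq_bigr => j _ /=.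
by rewrite L scalerDr !scalerA mulrC.
Qed.

Lemma eq_tlift U V (W : lmodType K) (f f' : U -> V -> W) t :
  (forall u v, f u v = f' u v) -> tlift f t = tlift f' t.
Proof.
by move=> E; apply: eq_bigr => i _; apply: eq_bigr => j _; rewrite E.
Qed.

Lemma tlift_push U V (W X : lmodType K) (L : W -> X) (f : U -> V -> W) t :
  lin L -> L (tlift f t) = tlift (fun u v => L (f u v)) t.
Proof.
move=> LL; rewrite /tlift (lin_sum _ LL); apply: eq_bigr => i _.
by rewrite (lin_sum _ LL); apply: eq_bigr => j _; rewrite (linZ LL).
Qed.

Lemma tensor_ext U V (W : lmodType K) (f f' : tensor U V -> W) :
  lin f -> lin f' -> (forall u v, f (tens u v) = f' (tens u v)) -> f =1 f'.
Proof.
move=> L L' E t; rewrite (tensor_expand t) (lin_sum _ L) (lin_sum _ L').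
apply: eq_bigr => i _; rewrite (lin_sum _ L) (lin_sum _ L').
by apply: eq_bigr => j _; rewrite (linZ L) (linZ L') E.
Qed.

Lemma tlift_tens U V (t : tensor U V) : tlift (@tens U V) t = t.
Proof. by rewrite [RHS]tensor_expand. Qed.

Lemma tlift_exch U V U' V' (W : lmodType K) (f : U -> V -> U' -> V' -> W) t s :
  tlift (fun u v => tlift (f u v) s) t =
  tlift (fun u' v' => tlift (fun u v => f u v u' v') t) s.
Proof.
transitivity (\sum_i \sum_j \sum_k \sum_l ((t : 'M_(_, _)) i j *
   (s : 'M_(_, _)) k l) *: f (bvec i) (bvec j) (bvec k) (bvec l)).
  apply: eq_bigr => i _; apply: eq_bigr => j _; rewrite scaler_sumr.
  apply: eq_bigr => k _; rewrite scaler_sumr; apply: eq_bigr => l _.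
  by rewrite scalerA.
under eq_bigr => i _ do rewrite exchange_big /=.
rewrite exchange_big; apply: eq_bigr => k _ /=.
under eq_bigr => i _ do rewrite exchange_big /=.
rewrite exchange_big; apply: eq_bigr => l _ /=.
rewrite scaler_sumr; apply: eq_bigr => i _; rewrite scaler_sumr.
by apply: eq_bigr => j _; rewrite scalerA mulrC.
Qed.

Lemma lin_mull (A : algType K) (X : lmodType K) (f : X -> A) b :
  lin f -> lin (fun x => f x * b).
Proof. by move=> L a x y; rewrite L mulrDl -scalerAl. Qed.

Lemma lin_mulr (A : algType K) (X : lmodType K) (f : X -> A) b :
  lin f -> lin (fun x => b * f x).
Proof. by move=> L a x y; rewrite L mulrDr -scalerAr. Qed.

Lemma lin_scalel (X W : lmodType K) (f : X -> K^o) (w : W) :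
  lin f -> lin (fun x => f x *: w).
Proof. by move=> L a x y; rewrite L scalerDl scalerA. Qed.

Lemma lin_scaler (X W : lmodType K) (f : X -> W) (b : K) :
  lin f -> lin (fun x => b *: f x).
Proof. by move=> L a x y; rewrite L scalerDr !scalerA mulrC. Qed.

Lemma lin_tensl U V (X : lmodType K) (f : X -> U) (v : V) :
  lin f -> lin (fun x => tens (f x) v).
Proof. exact: (lin_comp ((tens_bilin U V).1 v)). Qed.

Lemma lin_tensr U V (X : lmodType K) (f : X -> V) (u : U) :
  lin f -> lin (fun x => tens u (f x)).
Proof. exact: (lin_comp ((tens_bilin U V).2 u)). Qed.

Lemma lin_tlift_arg U V (X W : lmodType K) (f : U -> V -> W)
  (t : X -> tensor U V) : lin t -> lin (fun x => tlift f (t x)).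
Proof. exact: (lin_comp (tlift_lin f)). Qed.

Lemma linfun_lin (X Y : vectType K) (f : X -> Y) : lin f -> linfun f =1 f.
Proof.
move=> L; pose m := GRing.isLinear.Build K X Y *:%R f L.
pose F : {linear X -> Y} := HB.pack f m.
by move=> x; rewrite (lfunE F).
Qed.

End Tensor.

Ltac lin := first
  [ assumption | exact: lin_id
  | progress (move=> *; cbv beta); lin | split; lin
  | apply: bcoord_lin
  | apply: lin_mull; lin | apply: lin_mulr; lin
  | apply: lin_scalel; lin | apply: lin_scaler; lin
  | apply: lin_tensl; lin | apply: lin_tensr; lin
  | apply: lin_tlift; lin | apply: lin_tlift_arg; lin
  | apply: lin_app; lin ].

Definition tensor_mul (K : fieldType) (A B : falgType K) (s t : tensor A B) :
    tensor A B :=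
  tlift (fun a b => tlift (fun c d => tens (a * c) (b * d)) t) s.

(* The antipode of a finite-dimensional Hopf algebra is bijective by a theorem of
   Larson and Sweedler; [antipode_inj] records this, as the double uses its
   inverse. *)
Record hopfAlg (K : fieldType) := HopfAlg {
  hopf_sort :> falgType K;
  comul : 'Hom(hopf_sort, tensor hopf_sort hopf_sort);
  counit : 'AHom(hopf_sort, K^o);
  antipode : 'End(hopf_sort);
  comulA : forall h : hopf_sort,
    tlift (fun h' h3 => tlift (fun h1 h2 => tens h1 (tens h2 h3)) (comul h'))
      (comul h) =
    tlift (fun h1 h' => tlift (fun h2 h3 => tens h1 (tens h2 h3)) (comul h'))
      (comul h);
  counitl : forall h : hopf_sort,
    tlift (fun h1 h2 => counit h1 *: h2) (comul h) = h;
  counitr : forall h : hopf_sort,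
    tlift (fun h1 h2 => counit h2 *: h1) (comul h) = h;
  comul1 : comul 1 = tens 1 1;
  comulM : forall h k : hopf_sort,
    comul (h * k) = tensor_mul (comul h) (comul k);
  antipodel : forall h : hopf_sort,
    tlift (fun h1 h2 => antipode h1 * h2) (comul h) = (counit h)%:A;
  antipoder : forall h : hopf_sort,
    tlift (fun h1 h2 => h1 * antipode h2) (comul h) = (counit h)%:A;
  antipode_inj : lker antipode == 0%VS }.

Section Sweedler.
Variables (K : fieldType) (H : hopfAlg K).

(* Sweedler's sums  \sum f h_(1) h_(2)  and  \sum f h_(1) h_(2) h_(3) *)
Definition sw2 (W : lmodType K) (f : H -> H -> W) (h : H) : W :=
  tlift f (comul H h).

Definition sw3 (W : lmodType K) (f : H -> H -> H -> W) (h : H) : W :=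
  sw2 (fun h1 h' => sw2 (f h1) h') h.

Lemma sw2_lin (W : lmodType K) (f : H -> H -> W) : lin (sw2 f).
Proof. by move=> a u v; rewrite /sw2 linearP tlift_lin. Qed.

Lemma lin_sw2 (X W : lmodType K) (F : X -> H -> H -> W) h :
  (forall u v, lin (fun x => F x u v)) -> lin (fun x => sw2 (F x) h).
Proof. exact: lin_tlift. Qed.

Lemma lin_sw2_arg (X W : lmodType K) (f : H -> H -> W) (t : X -> H) :
  lin t -> lin (fun x => sw2 f (t x)).
Proof. exact: (lin_comp (sw2_lin f)). Qed.

Lemma eq_sw2 (W : lmodType K) (f f' : H -> H -> W) h :
  (forall u v, f u v = f' u v) -> sw2 f h = sw2 f' h.
Proof. exact: eq_tlift. Qed.

Lemma sw2_push (W X : lmodType K) (L : W -> X) (f : H -> H -> W) h :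
  lin L -> L (sw2 f h) = sw2 (fun u v => L (f u v)) h.
Proof. exact: tlift_push. Qed.

Definition trilin (W : lmodType K) (F : H -> H -> H -> W) :=
  [/\ forall y z, lin (fun x => F x y z), forall x z, lin (fun y => F x y z)
    & forall x y, lin (fun z => F x y z)].

Lemma coassoc (W : lmodType K) (F : H -> H -> H -> W) h : trilin F ->
  sw2 (fun h' h3 => sw2 (fun h1 h2 => F h1 h2 h3) h') h =
  sw2 (fun h1 h' => sw2 (fun h2 h3 => F h1 h2 h3) h') h.
Proof.
case=> F1 F2 F3; pose L (t : tensor H (tensor H H)) : W :=
  tlift (fun h1 t => tlift (fun h2 h3 => F h1 h2 h3) t) t.
have Llin : lin L by exact: tlift_lin.
have LE x y z : L (tens x (tens y z)) = F x y z.
  rewrite /L tliftE; first by rewrite tliftE //; split.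
  by split=> [s|u]; [apply: lin_tlift => *; exact: F1 | exact: tlift_lin].
have := congr1 L (comulA h); rewrite !(tlift_push _ _ Llin) => E.
transitivity (tlift (fun h' h3 : H => L (tlift (fun h1 h2 : H =>
   tens h1 (tens h2 h3)) (comul H h'))) (comul H h)).
  apply: eq_tlift => u v; rewrite (tlift_push _ _ Llin).
  by apply: eq_tlift => *; rewrite LE.
rewrite E; apply: eq_tlift => u v; rewrite (tlift_push _ _ Llin).
by apply: eq_tlift => *; rewrite LE.
Qed.

Lemma sw2_counitl (W : lmodType K) (f : H -> W) h : lin f ->
  sw2 (fun h1 h2 => counit H h1 *: f h2) h = f h.
Proof.
move=> L; rewrite -[in RHS](counitl h) [RHS]tlift_push //.
by apply: eq_tlift => *; rewrite (linZ L).
Qed.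

Lemma sw2_counitr (W : lmodType K) (f : H -> W) h : lin f ->
  sw2 (fun h1 h2 => counit H h2 *: f h1) h = f h.
Proof.
move=> L; rewrite -[in RHS](counitr h) [RHS]tlift_push //.
by apply: eq_tlift => *; rewrite (linZ L).
Qed.

Lemma sw2_1 (W : lmodType K) (f : H -> H -> W) : bilin f -> sw2 f 1 = f 1 1.
Proof. by move=> B; rewrite /sw2 comul1 tliftE. Qed.

Lemma sw2_M (W : lmodType K) (f : H -> H -> W) h k : bilin f ->
  sw2 f (h * k) =
  sw2 (fun h1 h2 => sw2 (fun k1 k2 => f (h1 * k1) (h2 * k2)) k) h.
Proof.
move=> B; rewrite /sw2 comulM /tensor_mul tlift_push; last exact: tlift_lin.
apply: eq_tlift => a b; rewrite tlift_push; last exact: tlift_lin.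
by apply: eq_tlift => c d; rewrite tliftE.
Qed.

Lemma sw2_antipodel (W : lmodType K) (f : H -> W) h : lin f ->
  sw2 (fun h1 h2 => f (antipode H h1 * h2)) h = counit H h *: f 1.
Proof.
move=> L; transitivity (f (sw2 (fun h1 h2 => antipode H h1 * h2) h)).
  by rewrite sw2_push.
by rewrite [sw2 _ _]antipodel (linZ L).
Qed.

Lemma sw2_antipoder (W : lmodType K) (f : H -> W) h : lin f ->
  sw2 (fun h1 h2 => f (h1 * antipode H h2)) h = counit H h *: f 1.
Proof.
move=> L; transitivity (f (sw2 (fun h1 h2 => h1 * antipode H h2) h)).
  by rewrite sw2_push.
by rewrite [sw2 _ _]antipoder (linZ L).
Qed.

End Sweedler.

Ltac lin ::= first
  [ eassumption | exact: lin_id | solve [eauto 2 with nocore]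
  | progress (move=> *; cbv beta); lin | split; lin
  | apply: bcoord_lin
  | apply: lin_mull; lin | apply: lin_mulr; lin
  | apply: lin_scalel; lin | apply: lin_scaler; lin
  | apply: lin_tensl; lin | apply: lin_tensr; lin
  | apply: lin_sw2; lin | apply: lin_sw2_arg; lin
  | apply: lin_tlift; lin | apply: lin_tlift_arg; lin
  | apply: lin_app; lin
  | match goal with
    | B : bilin ?F |- lin (fun x => ?F (@?A x) ?b) =>
        apply: (lin_comp (L := fun z => F z b) (B.1 b)); lin
    | B : bilin ?F |- lin (fun x => ?F ?b (@?A x)) =>
        apply: (lin_comp (L := F b) (B.2 b)); lin
    | B : bilin ?F |- lin (?F ?b) => exact: (B.2 b)
    | B : lin ?F |- lin (fun x => ?F (@?A x)) =>
        apply: (lin_comp (L := F) B); lin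
    end ].

Section Antipode.
Variables (K : fieldType) (H : hopfAlg K).
Local Notation S := (antipode H).
Local Notation eps := (counit H).

Lemma sw2_exch (W : lmodType K) (f : H -> H -> H -> H -> W) h k :
  sw2 (fun h1 h2 => sw2 (fun k1 k2 => f h1 h2 k1 k2) k) h =
  sw2 (fun k1 k2 => sw2 (fun h1 h2 => f h1 h2 k1 k2) h) k.
Proof. exact: tlift_exch. Qed.

Lemma antipode1 : S 1 = 1.
Proof.
have := sw2_antipodel 1 (@lin_id K H); rewrite sw2_1; last by lin.
by rewrite mulr1 rmorph1 scale1r.
Qed.

Lemma counitM h k : eps (h * k) = eps h * eps k.
Proof. exact: rmorphM. Qed.

Lemma antipodeM h k : S (h * k) = S k * S h.
Proof.
pose G h1 h2 h3 k1 k2 k3 : H := S (h1 * k1) * (h2 * k2 * (S k3 * S h3)).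
transitivity (sw2 (fun h1 h' => sw2 (fun h2 h3 => sw2 (fun k1 k' =>
   sw2 (fun k2 k3 => G h1 h2 h3 k1 k2 k3) k') k) h') h).
  symmetry; transitivity (sw2 (fun h1 h' => eps h' *: S (h1 * k)) h); last first.
    by rewrite (sw2_counitr (f := fun h1 => S (h1 * k))) //; lin.
  apply: eq_sw2 => h1 h'.
  transitivity (sw2 (fun h2 h3 => (fun z => S (h1 * k) * z) (h2 * S h3)) h').
    apply: eq_sw2 => h2 h3.
    transitivity (sw2 (fun k1 k' => eps k' *: (S (h1 * k1) * (h2 * S h3))) k).
      apply: eq_sw2 => k1 k'.
      transitivity (sw2 (fun k2 k3 => (fun z => S (h1 * k1) * (h2 * z * S h3))
          (k2 * S k3)) k').
        by apply: eq_sw2 => k2 k3; rewrite /G !mulrA.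
      by rewrite (sw2_antipoder (f := fun z => S (h1 * k1) * (h2 * z * S h3)))
        ?mulr1 //; lin.
    by rewrite (sw2_counitr (f := fun k1 => S (h1 * k1) * (h2 * S h3))) //; lin.
  by rewrite (sw2_antipoder (f := fun z => S (h1 * k) * z)) ?mulr1 //; lin.
transitivity (sw2 (fun h' h3 => sw2 (fun h1 h2 => sw2 (fun k' k3 =>
   sw2 (fun k1 k2 => G h1 h2 h3 k1 k2 k3) k') k) h') h).
  rewrite -coassoc; last by rewrite /G; lin.
  apply: eq_sw2 => h' h3; apply: eq_sw2 => h1 h2.
  by rewrite -coassoc // /G; lin.
transitivity (sw2 (fun h' h3 => eps h' *: (S k * S h3)) h); last first.
  by rewrite (sw2_counitl (f := fun h3 => S k * S h3)) //; lin.
apply: eq_sw2 => h' h3; rewrite sw2_exch.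
transitivity (sw2 (fun k' k3 => eps k' *: (eps h' *: (S k3 * S h3))) k); last first.
  by rewrite (sw2_counitl (f := fun k3 => eps h' *: (S k3 * S h3))) //; lin.
apply: eq_sw2 => k' k3.
transitivity (sw2 (fun p q => (fun z => z * (S k3 * S h3)) (S p * q)) (h' * k')).
  rewrite sw2_M; last by lin.
  by apply: eq_sw2 => h1 h2; apply: eq_sw2 => k1 k2; rewrite /G !mulrA.
by rewrite (sw2_antipodel (f := fun z => z * (S k3 * S h3))) ?mul1r ?scalerA ?counitM 1?mulrC //; lin.
Qed.

End Antipode.

Section AntipodeComul.
Variables (K : fieldType) (H : hopfAlg K).
Local Notation S := (antipode H).
Local Notation T := (antipode H)^-1%VF.
Local Notation eps := (counit H).

Definition quadlin (W : lmodType K) (G : H -> H -> H -> H -> W) :=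
  [/\ forall y z t, lin (fun x => G x y z t), forall x z t, lin (fun y => G x y z t),
      forall x y t, lin (fun z => G x y z t) & forall x y z, lin (G x y z)].

Lemma coassoc4 (W : lmodType K) (G : H -> H -> H -> H -> W) h : quadlin G ->
  sw2 (fun h' h'' => sw2 (fun a b => sw2 (fun c d => G a b c d) h'') h') h =
  sw2 (fun a r => sw2 (fun s d => sw2 (fun b c => G a b c d) s) r) h.
Proof.
case=> G1 G2 G3 G4; rewrite coassoc.
  by apply: eq_sw2 => a r; rewrite coassoc; last by split.
by split=> *; lin.
Qed.

Lemma antipode_comul (W : lmodType K) (F : H -> H -> W) h : bilin F ->
  sw2 F (S h) = sw2 (fun h1 h2 => F (S h2) (S h1)) h.
Proof.
move=> B.
pose G p q a b c d := F (p * a * S d) (q * b * S c).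
pose E h1 h2 h3 := sw2 (fun p q => sw2 (fun a b => sw2 (fun c d =>
  G p q a b c d) h3) h2) (S h1).
transitivity (sw2 (fun h1 h' => sw2 (fun h2 h3 => E h1 h2 h3) h') h).
  symmetry; transitivity (sw2 (fun h1 h' => eps h' *: sw2 F (S h1)) h); last first.
    by rewrite (sw2_counitr (f := fun h1 => sw2 F (S h1))) //; lin.
  apply: eq_sw2 => h1 h'; rewrite /E.
  transitivity (sw2 (fun p q => sw2 (fun h2 h3 => sw2 (fun a b => sw2 (fun c d =>
     G p q a b c d) h3) h2) h') (S h1)); first by rewrite sw2_exch.
  transitivity (sw2 (fun p q => eps h' *: F p q) (S h1)); last first.
    symmetry; apply: (sw2_push (L := fun z : W => eps h' *: z)); lin.
  apply: eq_sw2 => p q; rewrite coassoc4; last by rewrite /G; split; lin.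
  transitivity (sw2 (fun a r => (fun z => F (p * z) q) (a * S r)) h'); last first.
    by rewrite (sw2_antipoder (f := fun z => F (p * z) q)) ?mulr1 //; lin.
  apply: eq_sw2 => a r.
  transitivity (sw2 (fun s d => eps s *: F (p * (a * S d)) q) r); last first.
    by rewrite (sw2_counitl (f := fun d => F (p * (a * S d)) q)) //; lin.
  apply: eq_sw2 => s d.
  rewrite -[in RHS](mulr1 q).
  rewrite -(sw2_antipoder (f := fun z => F (p * (a * S d)) (q * z))); last by lin.
  by apply: eq_sw2 => b c; rewrite /G !mulrA.
rewrite -coassoc; last by rewrite /E /G; lin.
transitivity (sw2 (fun h' h3 => eps h' *: sw2 (fun c d => F (S d) (S c)) h3) h);
  last first.
  by rewrite (sw2_counitl (f := fun h3 => sw2 (fun c d => F (S d) (S c)) h3)) //; lin.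
apply: eq_sw2 => h' h3.
transitivity (sw2 (fun h1 h2 => sw2 (fun c d =>
    sw2 (fun u v => F (u * S d) (v * S c)) (S h1 * h2)) h3) h').
  apply: eq_sw2 => h1 h2; rewrite /E.
  transitivity (sw2 (fun p q => sw2 (fun c d => sw2 (fun a b =>
    G p q a b c d) h2) h3) (S h1)).
    by apply: eq_sw2 => p q; rewrite sw2_exch.
  by rewrite sw2_exch; apply: eq_sw2 => c d; rewrite sw2_M //; lin.
rewrite sw2_exch; transitivity (sw2 (fun c d => eps h' *: F (S d) (S c)) h3);
  last by symmetry; apply: (sw2_push (L := fun z : W => eps h' *: z)); lin.
apply: eq_sw2 => c d.
rewrite (sw2_antipodel (f := sw2 (fun u v => F (u * S d) (v * S c)))); last by lin.
by rewrite sw2_1 ?mul1r //; lin.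
Qed.

Lemma antipodeTK : cancel T S.
Proof.
have /eqP k0 := antipode_inj H.
have im : limg S = fullv.
  apply/eqP; rewrite eqEdim subvf /=; move: (limg_ker_dim S fullv).
  by rewrite k0 capv0 dimv0 add0n => ->.
by move=> h; apply: limg_lfunVK; rewrite im memvf.
Qed.

Lemma antipodeK : cancel S T.
Proof. exact: (lker0_lfunK (antipode_inj H)). Qed.

Lemma Tinv_M h k : T (h * k) = T k * T h.
Proof.
by apply: (can_inj antipodeK); rewrite antipodeM !antipodeTK.
Qed.

Lemma Tinv_1 : T 1 = 1.
Proof. by apply: (can_inj antipodeK); rewrite antipode1 antipodeTK. Qed.

Lemma Tinv_comul (W : lmodType K) (F : H -> H -> W) h : bilin F ->
  sw2 F (T h) = sw2 (fun h1 h2 => F (T h2) (T h1)) h.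
Proof.
move=> B; rewrite -[in RHS](antipodeTK h) antipode_comul; last by lin.
by apply: eq_sw2 => u v; rewrite !antipodeK.
Qed.

Lemma sw2_Tinvl (W : lmodType K) (f : H -> W) h : lin f ->
  sw2 (fun h1 h2 => f (T h2 * h1)) h = eps h *: f 1.
Proof.
move=> L; rewrite -Tinv_1 -(sw2_antipodel (f := fun z => f (T z))); last by lin.
by apply: eq_sw2 => u v; rewrite Tinv_M antipodeK.
Qed.

Lemma sw2_Tinvr (W : lmodType K) (f : H -> W) h : lin f ->
  sw2 (fun h1 h2 => f (h2 * T h1)) h = eps h *: f 1.
Proof.
move=> L; rewrite -Tinv_1 -(sw2_antipoder (f := fun z => f (T z))); last by lin.
by apply: eq_sw2 => u v; rewrite Tinv_M antipodeK.
Qed.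

End AntipodeComul.

Section Double.
Variables (K : fieldType) (H : hopfAlg K).
Local Notation T := (antipode H)^-1%VF.
Local Notation eps := (counit H).

Definition dual : vectType K := 'Hom(H, K^o).

Definition dfun (f : H -> K^o) : dual := linfun f.

Lemma dfunE f : lin f -> dfun f =1 f.
Proof. exact: linfun_lin. Qed.

Lemma dual_lin (f : dual) : lin f.
Proof. by move=> a u v; rewrite linearP. Qed.

Lemma dual_eq (f g : dual) : (forall h, f h = g h) -> f = g.
Proof. by move=> E; apply/lfunP. Qed.

Lemma lin_eval (X : lmodType K) (f : X -> dual) (h : H) :
  lin f -> lin (fun x => f x h).
Proof. by move=> L a x y; rewrite L add_lfunE scale_lfunE. Qed.

Definition dual1 : dual := eps.

Definition dual_mul (f g : dual) : dual :=
  dfun (sw2 (fun h1 h2 => f h1 * g h2)).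

(* b -> f  and  f <- b *)
Definition dual_lact (b : H) (f : dual) : dual := dfun (fun c => f (c * b)).
Definition dual_ract (f : dual) (b : H) : dual := dfun (fun c => f (b * c)).

(* the coproduct of H^*: sum f_(1) (x) f_(2) with
   f (h k) = sum f_(1) h * f_(2) k, see [dual_comulE] *)
Definition dual_comul (f : dual) : tensor dual dual :=
  \sum_i \sum_j f (bvec i * bvec j) *: tens (dfun (bcoord i)) (dfun (bcoord j)).

Lemma dual_mulE f g h : dual_mul f g h = sw2 (fun h1 h2 => f h1 * g h2) h.
Proof. exact/dfunE/sw2_lin. Qed.

Lemma dual_lactE b f h : dual_lact b f h = f (h * b).
Proof. by rewrite dfunE //; apply: lin_app; apply: lin_mull; apply: lin_id. Qed.

Lemma dual_ractE b f h : dual_ract f b h = f (b * h).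
Proof. by rewrite dfunE //; apply: lin_app; apply: lin_mulr; apply: lin_id. Qed.

Lemma dual_lact_bilin : bilin dual_lact.
Proof.
split=> w a u v; apply: dual_eq => h;
  rewrite add_lfunE scale_lfunE !dual_lactE ?add_lfunE ?scale_lfunE //.
by rewrite mulrDr -scalerAr linearP.
Qed.

Lemma dual_ract_bilin : bilin dual_ract.
Proof.
split=> w a u v; apply: dual_eq => h;
  rewrite add_lfunE scale_lfunE !dual_ractE ?add_lfunE ?scale_lfunE //.
by rewrite mulrDl -scalerAl linearP.
Qed.

Lemma dual_mul_bilin : bilin dual_mul.
Proof.
split=> w a u v; apply: dual_eq => h;
  rewrite add_lfunE scale_lfunE !dual_mulE.
  apply: (lin_sw2 (F := fun f h1 h2 => (f : dual) h1 * w h2)) => x y.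
  by apply: lin_mull; apply: lin_eval; apply: lin_id.
apply: (lin_sw2 (F := fun f h1 h2 => w h1 * (f : dual) h2)) => x y.
by apply: lin_mulr; apply: lin_eval; apply: lin_id.
Qed.

Lemma dual_comul_lin : lin dual_comul.
Proof.
move=> a f g; rewrite /dual_comul scaler_sumr -big_split; apply: eq_bigr => i _ /=.
rewrite scaler_sumr -big_split; apply: eq_bigr => j _ /=.
by rewrite add_lfunE scale_lfunE scalerDl scalerA.
Qed.

Definition pairing (h k : H) (t : tensor dual dual) : K^o :=
  tlift (fun f1 f2 : dual => f1 h * f2 k) t.

Lemma pairing_lin h k : lin (pairing h k).
Proof. exact: tlift_lin. Qed.

Lemma pairing_tens h k f g : pairing h k (tens f g) = f h * g k.
Proof.
rewrite /pairing tliftE //; split=> w.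
  by apply: lin_mull; apply: lin_eval; apply: lin_id.
by apply: lin_mulr; apply: lin_eval; apply: lin_id.
Qed.

Lemma dual_comulE f h k : pairing h k (dual_comul f) = f (h * k).
Proof.
rewrite /dual_comul (lin_sum _ (pairing_lin h k)).
rewrite [in RHS](bvec_expand h) mulr_suml linear_sum.
apply: eq_bigr => i _; rewrite (lin_sum _ (pairing_lin h k)).
rewrite [in RHS](bvec_expand k) mulr_sumr linear_sum.
apply: eq_bigr => j _; rewrite (linZ (pairing_lin h k)) pairing_tens.
rewrite (dfunE (bcoord_lin i)) (dfunE (bcoord_lin j)).
rewrite -scalerAl -scalerAr !linearZ /=.
by rewrite /GRing.scale /= [bcoord j k * _]mulrC.
Qed.

Lemma dtens_ext (s t : tensor dual dual) :
  (forall h k, pairing h k s = pairing h k t) -> s = t.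
Proof.
pose L (s : tensor dual dual) : tensor dual dual :=
  \sum_i \sum_j pairing (bvec i) (bvec j) s *:
     tens (dfun (bcoord i)) (dfun (bcoord j)).
have LL : lin L.
  move=> a u v; rewrite /L scaler_sumr -big_split; apply: eq_bigr => i _ /=.
  rewrite scaler_sumr -big_split; apply: eq_bigr => j _ /=.
  by rewrite pairing_lin scalerDl scalerA.
have dual_expand (f : dual) : f = \sum_i f (bvec i) *: dfun (bcoord i).
  apply: dual_eq => h; rewrite [in LHS](bvec_expand h) linear_sum sum_lfunE.
  apply: eq_bigr => i _; rewrite linearZ scale_lfunE dfunE; last exact: bcoord_lin.
  by rewrite /GRing.scale /= mulrC.
have LE : L =1 id.
  apply: tensor_ext => [//|//|f g].
  have [B1 B2] := tens_bilin dual dual.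
  rewrite /L [in RHS](dual_expand f) (lin_sum _ (B1 g)); apply: eq_bigr => i _.
  rewrite (linZ (B1 g)) [in RHS](dual_expand g) (lin_sum _ (B2 _)) scaler_sumr.
  apply: eq_bigr => j _; rewrite (linZ (B2 _)) scalerA.
  by rewrite pairing_tens.
move=> E; rewrite -(LE s) -(LE t) /L.
by apply: eq_bigr => i _; apply: eq_bigr => j _; rewrite E.
Qed.

(* D(H) = (H^* )^coop (x) H *)
Definition double : vectType K := tensor dual H.

Definition double1 : double := tens dual1 1.

(* (g (x) h) (f (x) k) = sum g (h_(1) -> f <- S^-1 h_(3)) (x) h_(2) k *)
Definition double_mul (d e : double) : double :=
  tlift (fun g h => tlift (fun f k =>
    sw3 (fun h1 h2 h3 =>
      tens (dual_mul g (dual_lact h1 (dual_ract f (T h3)))) (h2 * k)) h) e) d.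

Definition double_comul (d : double) : tensor double double :=
  tlift (fun f h => tlift (fun f1 f2 => sw2 (fun h1 h2 =>
    tens (tens f2 h1) (tens f1 h2)) h) (dual_comul f)) d.

Record ddmod := DDmod {
  dd_sort :> vectType K;
  dd_act : double -> dd_sort -> dd_sort;
  dd_bilin : bilin dd_act;
  dd_act1 : forall m, dd_act double1 m = m;
  dd_actM : forall d e m, dd_act (double_mul d e) m = dd_act d (dd_act e m) }.

End Double.

Lemma lin_sw3 (K : fieldType) (H : hopfAlg K) (X W : lmodType K)
  (F : X -> H -> H -> H -> W) h :
  (forall u v w, lin (fun x => F x u v w)) -> lin (fun x => sw3 (F x) h).
Proof. by move=> L; apply: lin_sw2 => u v; apply: lin_sw2 => *; apply: L. Qed.

Lemma lin_sw3_arg (K : fieldType) (H : hopfAlg K) (X W : lmodType K)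
  (F : H -> H -> H -> W) (t : X -> H) : lin t -> lin (fun x => sw3 F (t x)).
Proof. exact: lin_sw2_arg. Qed.

Lemma lin_bil1 (K : fieldType) (X U V W : lmodType K) (F : U -> V -> W)
  (f : X -> U) (v : V) : bilin F -> lin f -> lin (fun x => F (f x) v).
Proof. by move=> [B _]; exact: (lin_comp (B v)). Qed.

Lemma lin_bil2 (K : fieldType) (X U V W : lmodType K) (F : U -> V -> W)
  (f : X -> V) (u : U) : bilin F -> lin f -> lin (fun x => F u (f x)).
Proof. by move=> [_ B]; exact: (lin_comp (B u)). Qed.

Ltac lin_bil B := first
  [ refine (lin_bil1 _ B _); lin | refine (lin_bil2 _ B _); lin ].

Ltac lin ::=
  cbv beta;
  lazymatch goal with
  | |- forall _, _ => intro; lin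
  | |- _ /\ _ => split; lin
  | |- bilin _ => first [eassumption | split; lin]
  | |- trilin _ => split; lin
  | |- lin _ => first [eassumption |
    lazymatch goal with
    | |- lin (fun x => x) => exact: lin_id
    | |- lin (fun x => _ * _) =>
        first [apply: lin_mull; lin | apply: lin_mulr; lin]
    | |- lin (fun x => _ *: _) =>
        first [apply: lin_scalel; lin | apply: lin_scaler; lin]
    | |- lin (fun x => tens _ _) =>
        first [apply: lin_tensl; lin | apply: lin_tensr; lin]
    | |- lin (fun x => sw2 _ _) =>
        first [apply: lin_sw2; lin | apply: lin_sw2_arg; lin]
    | |- lin (fun x => sw3 _ _) =>
        first [apply: lin_sw3; lin | apply: lin_sw3_arg; lin]
    | |- lin (fun x => tlift _ _) =>
        first [apply: lin_tlift; lin | apply: lin_tlift_arg; lin]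
    | |- lin (tlift _) => exact: tlift_lin
    | |- lin (sw2 _) => exact: sw2_lin
    | |- lin (sw3 _) => exact: sw2_lin
    | |- lin (GRing.mul ?b) => exact: (lin_mulr b (@lin_id _ _))
    | |- lin (GRing.scale ?b) => exact: (lin_scaler b (@lin_id _ _))
    | |- lin (tens _) => exact: (proj2 (tens_bilin _ _))
    | |- lin (dual_lact _) => exact: (proj2 (dual_lact_bilin _))
    | |- lin (dual_ract _) => exact: (proj2 (dual_ract_bilin _))
    | |- lin (@dual_comul _ _) => exact: dual_comul_lin
    | |- lin (dual_mul _) => exact: (proj2 (dual_mul_bilin _))
    | |- lin (fun x => @dual_lact ?K ?H _ _) => lin_bil (@dual_lact_bilin K H)
    | |- lin (fun x => @dual_ract ?K ?H _ _) => lin_bil (@dual_ract_bilin K H)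
    | |- lin (fun x => @dual_mul ?K ?H _ _) => lin_bil (@dual_mul_bilin K H)
    | |- lin (fun x => @dual_comul ?K ?H _) =>
        refine (lin_comp (@dual_comul_lin K H) _); lin
    | |- _ => first
      [ match goal with
        | B : bilin ?F |- lin (fun x => ?F _ _) => lin_bil B
        | B : bilin ?F |- lin (?F ?b) => exact: (B.2 b)
        | B : lin ?F |- lin (fun x => ?F _) => refine (lin_comp B _); lin
        | B : forall _ _, lin _ |- _ => refine (lin_comp (B _ _) _); lin
        | B : forall _ _ _ _, lin _ |- _ => refine (lin_comp (B _ _ _ _) _); lin
        end
      | apply: lin_app; lin | apply: lin_eval; lin | solve [eauto 2 with nocore] ]
    end]
  end.

Section DoubleActions.
Variables (K : fieldType) (H : hopfAlg K).
Local Notation T := (antipode H)^-1%VF.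
Local Notation eps := (counit H).

(* A D(H)-module amounts to an action of H^* and an action of H with a
   compatibility. *)
Record dd_pair (M : vectType K) (fa : dual H -> M -> M) (ha : H -> M -> M) :
    Prop := DDPair {
  pair_fbilin : bilin fa;
  pair_hbilin : bilin ha;
  pair_f1 : forall m, fa (dual1 H) m = m;
  pair_h1 : forall m, ha 1 m = m;
  pair_fM : forall f g m, fa (dual_mul f g) m = fa f (fa g m);
  pair_hM : forall h k m, ha (h * k) m = ha h (ha k m);
  pair_comm : forall h f m, ha h (fa f m) =
    sw3 (fun h1 h2 h3 =>
      fa (dual_lact h1 (dual_ract f (T h3))) (ha h2 m)) h }.

Lemma sw3_push (W X : lmodType K) (L : W -> X) (f : H -> H -> H -> W) h :
  lin L -> L (sw3 f h) = sw3 (fun u v w => L (f u v w)) h.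
Proof.
move=> LL; rewrite /sw3 (sw2_push _ _ LL); apply: eq_sw2 => u v.
exact: sw2_push.
Qed.

Lemma eq_sw3 (W : lmodType K) (f f' : H -> H -> H -> W) h :
  (forall u v w, f u v w = f' u v w) -> sw3 f h = sw3 f' h.
Proof. by move=> E; apply: eq_sw2 => u v; apply: eq_sw2 => *; apply: E. Qed.

Lemma double_mulE g h f k : double_mul (tens g h) (tens f k) =
  sw3 (fun h1 h2 h3 =>
    tens (dual_mul g (dual_lact h1 (dual_ract f (T h3)))) (h2 * k)) h.
Proof.
rewrite /double_mul tliftE; last first.
  by split=> *; apply: lin_tlift => *; rewrite /sw3; lin.
by rewrite tliftE // /sw3; lin.
Qed.

Section PairMod.
Variables (M : vectType K) (fa : dual H -> M -> M) (ha : H -> M -> M).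
Hypothesis P : dd_pair fa ha.

Definition pair_act (d : double H) (m : M) : M :=
  tlift (fun f h => fa f (ha h m)) d.

Lemma pair_act_bilin : bilin pair_act.
Proof.
have [F G _ _ _ _ _] := P.
by split=> w; [apply: tlift_lin | apply: lin_tlift => u v; lin].
Qed.

Lemma pair_actE f h m : pair_act (tens f h) m = fa f (ha h m).
Proof. by have [F G _ _ _ _ _] := P; rewrite /pair_act tliftE //; lin. Qed.

Lemma pair_act1 m : pair_act (double1 H) m = m.
Proof. by rewrite pair_actE (pair_h1 P) (pair_f1 P). Qed.

Lemma pair_actM d e m :
  pair_act (double_mul d e) m = pair_act d (pair_act e m).
Proof.
have [F G _ _ fM hM comm] := P.
have [A1 A2] := pair_act_bilin.
move: d; apply: (tensor_ext (f := fun d => pair_act (double_mul d e) m)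
   (f' := fun d => pair_act d (pair_act e m))) => [||g h].
- by apply: (lin_comp (L := fun z => pair_act z m)) => //; apply: tlift_lin.
- exact: A1.
move: e; apply: (tensor_ext (f := fun e => pair_act (double_mul (tens g h) e) m)
   (f' := fun e => pair_act (tens g h) (pair_act e m))) => [||f k].
- apply: (lin_comp (L := fun z => pair_act z m)) => //.
  by apply: lin_tlift => *; apply: tlift_lin.
- by apply: (lin_comp (L := pair_act _)).
have L1 : lin (pair_act^~ m) by exact: A1.
have L2 : lin (fa g) by lin.
rewrite double_mulE (sw3_push _ _ L1) !pair_actE comm (sw3_push _ _ L2).
by apply: eq_sw3 => u v w; rewrite pair_actE fM hM.
Qed.

Definition pair_ddmod : ddmod H :=
  DDmod pair_act_bilin pair_act1 pair_actM.

End PairMod.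
Section ModPair.
Variable M : ddmod H.

Definition mod_fact (f : dual H) (m : M) : M := dd_act (tens f 1) m.
Definition mod_hact (h : H) (m : M) : M := dd_act (tens (dual1 H) h) m.

Lemma counitT h : eps (T h) = eps h.
Proof.
have L : lin (eps : H -> K^o) by exact: dual_lin.
rewrite -[LHS](sw2_counitl (f := fun z => eps (T z) : K^o)); last by lin.
transitivity (sw2 (fun h1 h2 => eps (T h2 * h1) : K^o) h).
  by apply: eq_sw2 => u v; rewrite counitM mulrC.
by rewrite (sw2_Tinvl h L) rmorph1 /GRing.scale /= mulr1.
Qed.

Lemma dual_mul1 (f : dual H) : dual_mul f (dual1 H) = f.
Proof.
apply: dual_eq => h; rewrite dual_mulE.
rewrite -[RHS](sw2_counitr (f := f)); last exact: dual_lin.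
by apply: eq_sw2 => u v; rewrite mulrC.
Qed.

Lemma mul1_dual (f : dual H) : dual_mul (dual1 H) f = f.
Proof.
apply: dual_eq => h; rewrite dual_mulE.
by rewrite -[RHS](sw2_counitl (f := f)); last exact: dual_lin.
Qed.

Lemma dual_lact1 (f : dual H) : dual_lact 1 f = f.
Proof. by apply: dual_eq => h; rewrite dual_lactE mulr1. Qed.

Lemma dual_ract1 (f : dual H) : dual_ract f 1 = f.
Proof. by apply: dual_eq => h; rewrite dual_ractE mul1r. Qed.

Lemma dual_lact_eps h : dual_lact h (dual1 H) = eps h *: dual1 H.
Proof.
by apply: dual_eq => k; rewrite dual_lactE scale_lfunE counitM mulrC.
Qed.

Lemma dual_ract_eps h : dual_ract (dual1 H) h = eps h *: dual1 H.
Proof. by apply: dual_eq => k; rewrite dual_ractE scale_lfunE counitM. Qed.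

Lemma sw3_1 (W : lmodType K) (F : H -> H -> H -> W) : trilin F ->
  sw3 F 1 = F 1 1 1.
Proof.
case=> F1 F2 F3; rewrite /sw3 sw2_1; last by split=> *; lin.
by rewrite sw2_1 //; split.
Qed.

Lemma double_mul_fh (f : dual H) (h : H) : double_mul (tens f 1) (tens (dual1 H) h) = tens f h.
Proof.
rewrite double_mulE sw3_1; last by split=> *; lin.
by rewrite Tinv_1 dual_ract1 dual_lact1 dual_mul1 mul1r.
Qed.

Lemma double_mul_ff (f g : dual H) :
  double_mul (tens f 1) (tens g 1) = tens (dual_mul f g) 1.
Proof.
rewrite double_mulE sw3_1; last by split=> *; lin.
by rewrite Tinv_1 dual_ract1 dual_lact1 mul1r.
Qed.

Lemma double_mul_hh (h k : H) :
  double_mul (tens (dual1 H) h) (tens (dual1 H) k) = tens (dual1 H) (h * k).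
Proof.
have [B1 B2] := tens_bilin (dual H) H.
rewrite double_mulE.
transitivity (sw2 (fun h1 h' => eps h1 *: (tens (dual1 H) (h' * k))) h); last first.
  by rewrite (sw2_counitl (f := fun h' => tens (dual1 H) (h' * k))) //; lin.
apply: eq_sw2 => h1 h'.
rewrite -(sw2_counitr (f := fun h2 => eps h1 *: tens (dual1 H) (h2 * k))); last by lin.
apply: eq_sw2 => h2 h3.
rewrite dual_ract_eps counitT (linZ (proj2 (dual_lact_bilin H) _)) dual_lact_eps.
rewrite mul1_dual (linZ (B1 _)) (linZ (B1 _)).
by [].
Qed.

Lemma double_mul_hf (h : H) (f : dual H) : double_mul (tens (dual1 H) h) (tens f 1) =
  sw3 (fun h1 h2 h3 => tens (dual_lact h1 (dual_ract f (T h3))) h2) h.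
Proof. by rewrite double_mulE; apply: eq_sw3 => *; rewrite mulr1 mul1_dual. Qed.

Lemma dd_actE f h m : dd_act (tens f h) m = mod_fact f (mod_hact h m).
Proof. by rewrite -double_mul_fh dd_actM. Qed.

Lemma mod_pair : dd_pair mod_fact mod_hact.
Proof.
have B := dd_bilin M; rewrite /mod_fact /mod_hact; split.
- by lin.
- by lin.
- exact: dd_act1.
- exact: dd_act1.
- by move=> f g m; rewrite -dd_actM double_mul_ff.
- by move=> f g m; rewrite -dd_actM double_mul_hh.
move=> h f m; rewrite -dd_actM double_mul_hf (sw3_push _ _ (B.1 m)).
by apply: eq_sw3 => u v w; rewrite dd_actE.
Qed.

End ModPair.
End DoubleActions.

Section TensorModule.
Variables (K : fieldType) (H : hopfAlg K) (M N : ddmod H).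
Local Notation T := (antipode H)^-1%VF.
Local Notation eps := (counit H).
Local Notation fM := (@mod_fact K H M).
Local Notation hM := (@mod_hact K H M).
Local Notation fN := (@mod_fact K H N).
Local Notation hN := (@mod_hact K H N).

Definition ddtens_act (d : double H) (t : tensor M N) : tensor M N :=
  tlift (fun d1 d2 => tlift (fun m n => tens (dd_act d1 m) (dd_act d2 n)) t)
    (double_comul d).

Definition ddtens_f (f : dual H) (t : tensor M N) : tensor M N :=
  tlift (fun f1 f2 => tlift (fun m n => tens (fM f2 m) (fN f1 n)) t)
    (dual_comul f).

Definition ddtens_h (h : H) (t : tensor M N) : tensor M N :=
  sw2 (fun h1 h2 => tlift (fun m n => tens (hM h1 m) (hN h2 n)) t) h.

Lemma sw2_tlift_exch (U V : vectType K) (W : lmodType K)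
    (F : H -> H -> U -> V -> W) h t :
  sw2 (fun h1 h2 => tlift (F h1 h2) t) h =
  tlift (fun u v => sw2 (fun h1 h2 => F h1 h2 u v) h) t.
Proof. exact: tlift_exch. Qed.

Lemma dual_comul1 : dual_comul (dual1 H) = tens (dual1 H) (dual1 H).
Proof.
by apply: dtens_ext => h k; rewrite dual_comulE pairing_tens counitM.
Qed.

Lemma pairing_tlift (F : dual H -> dual H -> tensor (dual H) (dual H)) t h k :
  pairing h k (tlift F t) = tlift (fun f g => pairing h k (F f g)) t.
Proof. exact: (tlift_push _ _ (pairing_lin h k)). Qed.

Lemma dual_comulM (f g : dual H) : dual_comul (dual_mul f g) =
  tlift (fun f1 f2 => tlift (fun g1 g2 =>
    tens (dual_mul f1 g1) (dual_mul f2 g2)) (dual_comul g)) (dual_comul f).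
Proof.
apply: dtens_ext => h k; rewrite dual_comulE dual_mulE sw2_M; last by lin.
rewrite pairing_tlift.
transitivity (tlift (fun f1 f2 : dual H => sw2 (fun h1 h2 => sw2 (fun k1 k2 =>
  (f1 h1 * f2 k1) * g (h2 * k2)) k) h) (dual_comul f)).
  rewrite -sw2_tlift_exch; apply: eq_sw2 => h1 h2.
  rewrite -sw2_tlift_exch; apply: eq_sw2 => k1 k2.
  rewrite -dual_comulE /pairing.
  exact: (tlift_push (L := fun z : K^o => z * g (h2 * k2)) _ _ (lin_mull _ (@lin_id _ _))).
apply: eq_tlift => f1 f2; rewrite pairing_tlift.
transitivity (tlift (fun g1 g2 : dual H => sw2 (fun h1 h2 => sw2 (fun k1 k2 =>
  (f1 h1 * f2 k1) * (g1 h2 * g2 k2)) k) h) (dual_comul g)).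
  rewrite -sw2_tlift_exch; apply: eq_sw2 => h1 h2.
  rewrite -sw2_tlift_exch; apply: eq_sw2 => k1 k2.
  rewrite -dual_comulE /pairing.
  exact: (tlift_push (L := fun z : K^o => f1 h1 * f2 k1 * z) _ _ (lin_mulr _ (@lin_id _ _))).
apply: eq_tlift => g1 g2; rewrite pairing_tens !dual_mulE.
have L1 : lin (fun z : K^o => z * sw2 (fun k1 k2 => f2 k1 * g2 k2) k) by lin.
rewrite (sw2_push _ _ L1); apply: eq_sw2 => h1 h2.
have L2 : lin (fun z : K^o => f1 h1 * g1 h2 * z) by lin.
rewrite (sw2_push _ _ L2); apply: eq_sw2 => k1 k2.
by rewrite -!mulrA; congr (_ * _); rewrite mulrCA.
Qed.

Lemma dual_comul_act (W : lmodType K) (F : dual H -> dual H -> W) h k f :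
  bilin F ->
  tlift F (dual_comul (dual_lact h (dual_ract f k))) =
  tlift (fun f1 f2 => F (dual_ract f1 k) (dual_lact h f2)) (dual_comul f).
Proof.
move=> B; transitivity (tlift F (tlift (fun f1 f2 =>
   tens (dual_ract f1 k) (dual_lact h f2)) (dual_comul f))).
  congr (tlift F _); apply: dtens_ext => x y.
  rewrite dual_comulE dual_lactE dual_ractE pairing_tlift.
  transitivity (pairing (k * x) (y * h) (dual_comul f)).
    by rewrite dual_comulE !mulrA.
  by apply: eq_tlift => f1 f2; rewrite pairing_tens dual_ractE dual_lactE.
rewrite (tlift_push _ _ (tlift_lin F)).
by apply: eq_tlift => f1 f2; rewrite tliftE.
Qed.

Lemma dual_comul_cancel (W : lmodType K) (F : dual H -> dual H -> W) h f :
  bilin F ->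
  sw2 (fun h1 h2 => tlift (fun f1 f2 =>
     F (dual_lact h2 f1) (dual_ract f2 (T h1))) (dual_comul f)) h =
  eps h *: tlift F (dual_comul f).
Proof.
move=> B; transitivity (tlift F (sw2 (fun h1 h2 => tlift (fun f1 f2 =>
   tens (dual_lact h2 f1) (dual_ract f2 (T h1))) (dual_comul f)) h)).
  rewrite (sw2_push _ _ (tlift_lin F)); apply: eq_sw2 => h1 h2.
  rewrite (tlift_push _ _ (tlift_lin F)).
  by apply: eq_tlift => f1 f2; rewrite tliftE.
rewrite -(linZ (tlift_lin F)); congr (tlift F _); apply: dtens_ext => x y.
rewrite (sw2_push _ _ (pairing_lin x y)) (linZ (pairing_lin x y)) dual_comulE.
transitivity (sw2 (fun h1 h2 => f (x * (h2 * T h1) * y)) h).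
  apply: eq_sw2 => h1 h2; rewrite pairing_tlift.
  transitivity (pairing (x * h2) (T h1 * y) (dual_comul f)).
    by apply: eq_tlift => f1 f2; rewrite pairing_tens dual_ractE dual_lactE.
  by rewrite dual_comulE !mulrA.
by rewrite (sw2_Tinvr (f := fun z => f (x * z * y))) ?mulr1 //; lin.
Qed.

Let fMb : bilin fM := pair_fbilin (mod_pair M).
Let hMb : bilin hM := pair_hbilin (mod_pair M).
Let fNb : bilin fN := pair_fbilin (mod_pair N).
Let hNb : bilin hN := pair_hbilin (mod_pair N).

Lemma ddtens_f_lin f : lin (ddtens_f f).
Proof.
by move=> a u v; apply: (lin_tlift (F := fun t f1 f2 =>
  tlift (fun m n => tens (fM f2 m) (fN f1 n)) t)) => *; apply: tlift_lin.
Qed.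

Lemma ddtens_h_lin h : lin (ddtens_h h).
Proof.
by move=> a u v; apply: (lin_sw2 (F := fun t h1 h2 =>
  tlift (fun m n => tens (hM h1 m) (hN h2 n)) t)) => *; apply: tlift_lin.
Qed.

Lemma ddtens_f_bilin : bilin ddtens_f.
Proof.
by split=> w; [rewrite /ddtens_f; lin | apply: ddtens_f_lin].
Qed.

Lemma ddtens_h_bilin : bilin ddtens_h.
Proof.
by split=> w; [rewrite /ddtens_h; lin | apply: ddtens_h_lin].
Qed.

Lemma ddtens_fE f m n : ddtens_f f (tens m n) =
  tlift (fun f1 f2 => tens (fM f2 m) (fN f1 n)) (dual_comul f).
Proof. by apply: eq_tlift => f1 f2; rewrite tliftE //; lin. Qed.

Lemma ddtens_hE h m n : ddtens_h h (tens m n) =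
  sw2 (fun h1 h2 => tens (hM h1 m) (hN h2 n)) h.
Proof. by apply: eq_sw2 => h1 h2; rewrite tliftE //; lin. Qed.

Lemma ddtens_actE f h t :
  ddtens_act (tens f h) t = ddtens_f f (ddtens_h h t).
Proof.
have BM := dd_bilin M; have BN := dd_bilin N.
have BF := ddtens_f_bilin; have BH := ddtens_h_bilin.
move: t; apply: (tensor_ext (f := fun t => ddtens_act (tens f h) t)
   (f' := fun t => ddtens_f f (ddtens_h h t))) => [||m n].
- by apply: lin_tlift => *; apply: tlift_lin.
- by lin.
rewrite ddtens_hE (sw2_push _ _ (ddtens_f_lin f)).
rewrite /ddtens_act /double_comul tliftE; last by lin.
rewrite (tlift_push _ _ (tlift_lin _)).
transitivity (tlift (fun f1 f2 => sw2 (fun h1 h2 =>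
   tens (fM f2 (hM h1 m)) (fN f1 (hN h2 n))) h) (dual_comul f)).
  apply: eq_tlift => f1 f2; rewrite (sw2_push _ _ (tlift_lin _)).
  apply: eq_sw2 => h1 h2.
  rewrite tliftE; last first.
    by split=> *; apply: lin_tlift => *; lin.
  by rewrite tliftE ?dd_actE //; lin.
rewrite -sw2_tlift_exch; apply: eq_sw2 => h1 h2.
by rewrite ddtens_fE.
Qed.

Lemma ddtens_comm h f t : ddtens_h h (ddtens_f f t) =
  sw3 (fun h1 h2 h3 => ddtens_f (dual_lact h1 (dual_ract f (T h3)))
     (ddtens_h h2 t)) h.
Proof.
have BF := ddtens_f_bilin; have BH := ddtens_h_bilin.
have TB := tens_bilin M N.
move: t; apply: (tensor_ext (f := fun t => ddtens_h h (ddtens_f f t))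
   (f' := fun t => sw3 (fun h1 h2 h3 =>
      ddtens_f (dual_lact h1 (dual_ract f (T h3))) (ddtens_h h2 t)) h))
   => [||m n]; [by lin | by lin |].
pose V (x y : dual H) (p q : H) := tens (fM x (hM p m)) (fN y (hN q n)).
transitivity (sw3 (fun h1 h2 h3 => sw2 (fun p q => tlift (fun f1 f2 =>
   V (dual_lact h1 f2) (dual_ract f1 (T h3)) p q) (dual_comul f)) h2) h);
  last first.
  apply: eq_sw3 => h1 h2 h3; rewrite ddtens_hE (sw2_push _ _ (ddtens_f_lin _)).
  apply: eq_sw2 => p q; rewrite ddtens_fE.
  rewrite (dual_comul_act (F := fun f1 f2 => tens (fM f2 (hM p m)) (fN f1 (hN q n)))) //.
  by lin.
rewrite ddtens_fE (tlift_push _ _ (ddtens_h_lin h)).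
pose Q h1 h2 h3 h4 h5 h6 := tlift (fun f1 f2 =>
   V (dual_lact h1 (dual_ract f2 (T h3))) (dual_ract (dual_lact h4 f1) (T h6))
     h2 h5) (dual_comul f).
transitivity (sw2 (fun h' h'' => sw3 (fun h1 h2 h3 => sw3 (fun h4 h5 h6 =>
   Q h1 h2 h3 h4 h5 h6) h'') h') h).
  transitivity (tlift (fun f1 f2 => sw2 (fun h' h'' => sw3 (fun h1 h2 h3 =>
     sw3 (fun h4 h5 h6 => V (dual_lact h1 (dual_ract f2 (T h3)))
      (dual_ract (dual_lact h4 f1) (T h6)) h2 h5) h'') h') h) (dual_comul f)).
    apply: eq_tlift => f1 f2; rewrite ddtens_hE; apply: eq_sw2 => h' h''.
    rewrite (pair_comm (mod_pair M)) (pair_comm (mod_pair N)).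
    rewrite (sw3_push _ _ (TB.1 _)); apply: eq_sw3 => h1 h2 h3.
    rewrite (sw3_push _ _ (TB.2 _)); apply: eq_sw3 => h4 h5 h6.
    rewrite /V; congr (tens _ (fN _ _)); apply: dual_eq => z.
    by rewrite dual_lactE !dual_ractE dual_lactE mulrA.
  rewrite -sw2_tlift_exch; apply: eq_sw2 => h' h''.
  rewrite -sw2_tlift_exch; apply: eq_sw2 => h1 x.
  rewrite -sw2_tlift_exch; apply: eq_sw2 => h2 h3.
  rewrite -sw2_tlift_exch; apply: eq_sw2 => h4 y.
  by rewrite -sw2_tlift_exch; apply: eq_sw2 => h5 h6.
rewrite /sw3 coassoc; last by rewrite /Q /V; lin.
apply: eq_sw2 => h1 r.
rewrite (coassoc4 (G := fun h2 h3 h4 y => sw2 (fun h5 h6 => Q h1 h2 h3 h4 h5 h6) y));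
  last by rewrite /Q /V; split; lin.
rewrite [RHS]coassoc; last by rewrite /V; lin.
apply: eq_sw2 => h2 s.
pose G y := sw2 (fun h5 h6 => tlift (fun f1 f2 =>
  V (dual_lact h1 f2) (dual_ract f1 (T h6)) h2 h5) (dual_comul f)) y.
transitivity (sw2 (fun w y => eps w *: G y) s); last first.
  by rewrite (sw2_counitl (f := G)) // /G /V; lin.
apply: eq_sw2 => w y; rewrite sw2_exch.
have LE : lin (fun z : tensor M N => eps w *: z) by lin.
rewrite [RHS](sw2_push _ _ LE); apply: eq_sw2 => h5 h6.
rewrite -(dual_comul_cancel (F := fun f1 f2 =>
  V (dual_lact h1 f2) (dual_ract f1 (T h6)) h2 h5)) //.
by rewrite /V; lin.
Qed.

Lemma ddtens_pair : dd_pair ddtens_f ddtens_h.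
Proof.
have BF := ddtens_f_bilin; have BH := ddtens_h_bilin.
split=> //; last exact: ddtens_comm.
- apply: (tensor_ext (f := ddtens_f (dual1 H)) (f' := id)) => // [|m n];
    first by lin.
  rewrite ddtens_fE dual_comul1 tliftE; last by lin.
  by rewrite !(pair_f1 (mod_pair _)).
- apply: (tensor_ext (f := ddtens_h 1) (f' := id)) => // [|m n];
    first by lin.
  rewrite ddtens_hE sw2_1; last by lin.
  by rewrite !(pair_h1 (mod_pair _)).
- move=> f g; apply: (tensor_ext (f := ddtens_f (dual_mul f g))
    (f' := fun t => ddtens_f f (ddtens_f g t))) => [||m n]; [by lin | by lin |].
  rewrite !ddtens_fE dual_comulM (tlift_push _ _ (tlift_lin _)).
  rewrite (tlift_push _ _ (ddtens_f_lin f)).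
  transitivity (tlift (fun f1 f2 => tlift (fun g1 g2 =>
      tens (fM f2 (fM g2 m)) (fN f1 (fN g1 n))) (dual_comul g)) (dual_comul f));
    last by rewrite tlift_exch; apply: eq_tlift => g1 g2; rewrite ddtens_fE.
  apply: eq_tlift => f1 f2.
  rewrite (tlift_push _ _ (tlift_lin _)); apply: eq_tlift => g1 g2.
  rewrite tliftE; last by lin.
  by rewrite !(pair_fM (mod_pair _)).
- move=> h k; apply: (tensor_ext (f := ddtens_h (h * k))
    (f' := fun t => ddtens_h h (ddtens_h k t))) => [||m n]; [by lin | by lin |].
  rewrite !ddtens_hE sw2_M; last by lin.
  rewrite (sw2_push _ _ (ddtens_h_lin h)) sw2_exch; apply: eq_sw2 => k1 k2.
  rewrite ddtens_hE; apply: eq_sw2 => h1 h2.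
  by rewrite !(pair_hM (mod_pair _)).
Qed.

Lemma ddtens_pairE d t : ddtens_act d t = pair_act ddtens_f ddtens_h d t.
Proof.
move: d; apply: (tensor_ext (f := fun d => ddtens_act d t)
   (f' := fun d => pair_act ddtens_f ddtens_h d t)) => [||f h].
- by apply: lin_tlift_arg; apply: tlift_lin.
- exact: tlift_lin.
by rewrite ddtens_actE (pair_actE ddtens_pair).
Qed.

Lemma ddtens_bilin : bilin ddtens_act.
Proof.
have [B1 B2] := pair_act_bilin ddtens_pair.
by split=> w a u v; rewrite !ddtens_pairE; [apply: B1 | apply: B2].
Qed.

Lemma ddtens_act1 t : ddtens_act (double1 H) t = t.
Proof. by rewrite ddtens_pairE (pair_act1 ddtens_pair). Qed.

Lemma ddtens_actM d e t :
  ddtens_act (double_mul d e) t = ddtens_act d (ddtens_act e t).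
Proof. by rewrite !ddtens_pairE (pair_actM ddtens_pair). Qed.

Definition ddtens : ddmod H := DDmod ddtens_bilin ddtens_act1 ddtens_actM.

End TensorModule.

Section Bullet.
Variables (K : fieldType) (H : hopfAlg K).
Local Notation T := (antipode H)^-1%VF.
Local Notation eps := (counit H).

Definition bullet (beta : 'AHom(H, K^o)) (h b : H) : H :=
  sw3 (fun h1 h2 h3 => beta h2 *: (h3 * b * T h1)) h.

(* the action of H^* on H, from the right coaction Delta of H on itself *)
Definition coact (f : dual H) (m : H) : H :=
  sw2 (fun m1 m2 => f m2 *: m1) m.

Definition bullet_act beta (d : double H) (m : H) : H :=
  tlift (fun f h => coact f (bullet beta h m)) d.

Lemma coact_bilin : bilin coact.
Proof. by split=> w; rewrite /coact; lin. Qed.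

Section Beta.
Variable beta : 'AHom(H, K^o).

Lemma AHomM h k : beta (h * k) = beta h * beta k.
Proof. exact: rmorphM. Qed.

Lemma bullet_bilin : bilin (bullet beta).
Proof. by split=> w; rewrite /bullet; lin. Qed.

Lemma bullet1 b : bullet beta 1 b = b.
Proof.
by rewrite /bullet sw3_1 ?Tinv_1 ?rmorph1 ?scale1r ?mul1r ?mulr1 //; lin.
Qed.

Lemma bulletM h k b : bullet beta (h * k) b = bullet beta h (bullet beta k b).
Proof.
rewrite [LHS]sw2_M; last by lin.
transitivity (sw2 (fun h1 h' => sw2 (fun k1 k' => sw2 (fun h2 h3 =>
   sw2 (fun k2 k3 => beta (h2 * k2) *: (h3 * k3 * b * T (h1 * k1))) k') h') k) h).
  apply: eq_sw2 => h1 h'; apply: eq_sw2 => k1 k'.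
  by rewrite sw2_M //; lin.
apply: eq_sw2 => h1 h'; rewrite sw2_exch; apply: eq_sw2 => h2 h3.
have L : lin (fun z => beta h2 *: (h3 * z * T h1)) by lin.
rewrite (sw3_push _ _ L); apply: eq_sw2 => k1 k'; apply: eq_sw2 => k2 k3.
by rewrite AHomM Tinv_M -scalerAr -scalerAl scalerA !mulrA.
Qed.

Lemma bullet_reassoc (W : lmodType K) (Z : H -> H -> H -> W) h :
  trilin Z ->
  sw2 (fun h1 h' => sw2 (fun a y => sw2 (fun a1 a2 =>
    Z (T a1 * h1) a2 y) a) h') h = sw2 (fun p y => Z 1 p y) h.
Proof.
case=> Z1 Z2 Z3; rewrite -coassoc; last by lin.
apply: eq_sw2 => p y; rewrite -coassoc; last by lin.
rewrite -[RHS](sw2_counitl (f := fun p => Z 1 p y)) //.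
apply: eq_sw2 => s a2.
by rewrite (sw2_Tinvl (f := fun z => Z z a2 y)).
Qed.

Lemma bullet_sandwich (W : lmodType K) (P : H -> H -> H -> H -> H -> W) h :
  (forall a b c v, lin (fun u => P u a b c v)) ->
  (forall u b c v, lin (fun a => P u a b c v)) ->
  (forall u a c v, lin (fun b => P u a b c v)) ->
  (forall u a b v, lin (fun c => P u a b c v)) ->
  (forall u a b c, lin (fun v => P u a b c v)) ->
  sw3 (fun h1 h2 h3 => sw3 (fun a b c => sw2 (fun a1 a2 => sw2 (fun c1 c2 =>
    P (T a1 * h1) a2 b c1 (T h3 * c2)) c) a) h2) h =
  sw3 (fun a b c => P 1 a b c 1) h.
Proof.
move=> P1 P2 P3 P4 P5.
pose Z u a y := sw2 (fun x h3 => sw2 (fun b c => sw2 (fun c1 c2 =>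
  P u a b c1 (T h3 * c2)) c) x) y.
transitivity (sw2 (fun p y => Z 1 p y) h).
  rewrite -(bullet_reassoc (Z := Z)); last by rewrite /Z; lin.
  apply: eq_sw2 => h1 h'; rewrite /sw3.
  rewrite coassoc; last by lin.
  apply: eq_sw2 => a y; rewrite /Z [RHS]sw2_exch; apply: eq_sw2 => x h3.
  by rewrite [RHS]sw2_exch.
apply: eq_sw2 => a y; rewrite /Z coassoc; last by lin.
apply: eq_sw2 => b q; rewrite coassoc; last by lin.
rewrite -[RHS](sw2_counitr (f := fun c => P 1 a b c 1)); last by lin.
apply: eq_sw2 => c1 r.
by rewrite (sw2_Tinvl (f := fun z => P 1 a b c1 z)).
Qed.

Lemma coactE f c m a : coact f (c * m * T a) =
  sw2 (fun a1 a2 => sw2 (fun c1 c2 => sw2 (fun m1 m2 =>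
    f (c2 * m2 * T a1) *: (c1 * m1 * T a2)) m) c) a.
Proof.
rewrite /coact sw2_M; last by lin.
rewrite sw2_M; last by lin.
transitivity (sw2 (fun c1 c2 => sw2 (fun m1 m2 => sw2 (fun a1 a2 =>
    f (c2 * m2 * T a1) *: (c1 * m1 * T a2)) a) m) c).
  apply: eq_sw2 => c1 c2; apply: eq_sw2 => m1 m2.
  by rewrite (Tinv_comul (F := fun u v => f (c2 * m2 * v) *: (c1 * m1 * u))) //;
     lin.
by rewrite [RHS]sw2_exch; apply: eq_sw2 => c1 c2; rewrite [RHS]sw2_exch.
Qed.

Lemma bullet_comm h f m : bullet beta h (coact f m) =
  sw3 (fun h1 h2 h3 =>
    coact (dual_lact h1 (dual_ract f (T h3))) (bullet beta h2 m)) h.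
Proof.
pose P u a b c v := sw2 (fun m1 m2 =>
  (beta b * f (v * m2 * u)) *: (c * m1 * T a)) m.
transitivity (sw3 (fun a b c => P 1 a b c 1) h).
  apply: eq_sw3 => a b c.
  have L : lin (fun z => beta b *: (c * z * T a)) by lin.
  rewrite (sw2_push _ _ L); apply: eq_sw2 => m1 m2.
  by rewrite mulr1 mul1r -scalerAr -scalerAl scalerA.
rewrite -bullet_sandwich /P; try by lin.
apply: eq_sw3 => h1 h2 h3; have [_ L2] := coact_bilin.
rewrite (sw3_push _ _ (L2 _)); apply: eq_sw3 => a b c.
rewrite (linZ (L2 _)) coactE.
have L : lin (fun z : H => beta b *: z) by lin.
rewrite (sw2_push _ _ L); apply: eq_sw2 => a1 a2.
rewrite (sw2_push _ _ L); apply: eq_sw2 => c1 c2.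
rewrite (sw2_push _ _ L); apply: eq_sw2 => m1 m2.
by rewrite dual_lactE dual_ractE scalerA !mulrA.
Qed.

Lemma bullet_pair : dd_pair coact (bullet beta).
Proof.
split.
- exact: coact_bilin.
- exact: bullet_bilin.
- by move=> m; rewrite /coact (sw2_counitr (f := id)).
- exact: bullet1.
- move=> f g m; have [_ L] := coact_bilin.
  rewrite {3}/coact (sw2_push _ _ (L f)).
  transitivity (sw2 (fun m1 m' : H => sw2 (fun m2 m3 : H => (f m2 * g m3) *: m1) m') m).
    apply: eq_sw2 => m1 m'; rewrite dual_mulE.
    have L1 : lin (fun z : K^o => z *: m1) by lin.
    by rewrite (sw2_push _ _ L1).
  rewrite -coassoc; last by lin.
  apply: eq_sw2 => m1 m2; rewrite (linZ (L _)).
  have L1 : lin (fun z : H => g m2 *: z) by lin.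
  by rewrite (sw2_push _ _ L1); apply: eq_sw2 => *; rewrite scalerA mulrC.
- exact: bulletM.
- exact: bullet_comm.
Qed.

Definition bullet_ddmod : ddmod H :=
  @DDmod _ H H (bullet_act beta) (pair_act_bilin bullet_pair)
    (pair_act1 bullet_pair) (pair_actM bullet_pair).

End Beta.
End Bullet.

Record submodule (K : fieldType) (H : hopfAlg K) (M : ddmod H) := Submodule {
  sub_space :> {vspace M};
  sub_stable : forall d m, m \in sub_space -> dd_act d m \in sub_space }.

Section SubModule.
Variables (K : fieldType) (H : hopfAlg K) (M : ddmod H) (U : submodule M).

Definition sub_act (d : double H) (m : subvs_of U) : subvs_of U :=
  vsproj U (dd_act d (vsval m)).

Lemma sub_actE d m : vsval (sub_act d m) = dd_act d (vsval m).
Proof. by rewrite vsprojK // sub_stable // subvsP. Qed.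

Lemma sub_bilin : bilin sub_act.
Proof.
have [B1 B2] := dd_bilin M.
split=> w a u v; apply: val_inj; rewrite [RHS]linearP /= !sub_actE.
  exact: B1.
by rewrite [X in dd_act _ X]linearP; apply: B2.
Qed.

Lemma sub_act1 m : sub_act (double1 H) m = m.
Proof. by apply: val_inj; rewrite /= sub_actE dd_act1. Qed.

Lemma sub_actM d e m : sub_act (double_mul d e) m = sub_act d (sub_act e m).
Proof. by apply: val_inj; rewrite /= !sub_actE dd_actM. Qed.

Definition sub_ddmod : ddmod H := DDmod sub_bilin sub_act1 sub_actM.

End SubModule.

Section BulletModule.
Variables (K : fieldType) (H : hopfAlg K) (beta : 'AHom(H, K^o)).
Local Notation T := (antipode H)^-1%VF.

Definition grouplike (g : H) : Prop := comul H g = tens g g /\ g != 0.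

Definition bullet_space (g : H) : {vspace H} :=
  limg (linfun (fun h => bullet beta h g)).

Lemma bullet_spaceP g m :
  reflect (exists h, m = bullet beta h g) (m \in bullet_space g).
Proof.
have L : lin (fun h => bullet beta h g) by exact: (proj1 (bullet_bilin beta)).
apply: (iffP memv_imgP) => [[h _ ->]|[h ->]].
  by exists h; rewrite (linfun_lin L).
by exists h; rewrite ?memvf ?(linfun_lin L).
Qed.

Lemma coact_bullet g f h : grouplike g ->
  coact f (bullet beta h g) =
  bullet beta (sw3 (fun a h' c => f (c * g * T a) *: h') h) g.
Proof.
case=> gg _; have [L _] := bullet_bilin beta.
have [_ C] := coact_bilin H.
rewrite (sw3_push _ _ (C f)) (sw3_push _ _ (L g)).
pose Q a1 a2 b c1 c2 := f (c2 * g * T a1) *: (beta b *: (c1 * g * T a2)).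
transitivity (sw2 (fun a y => sw2 (fun a1 a2 => sw2 (fun b c =>
  sw2 (fun c1 c2 => Q a1 a2 b c1 c2) c) y) a) h).
  apply: eq_sw2 => a y; rewrite sw2_exch; apply: eq_sw2 => b c.
  rewrite (linZ (C f)) coactE.
  have Lb : lin (fun z : H => beta b *: z) by lin.
  rewrite (sw2_push _ _ Lb); apply: eq_sw2 => a1 a2.
  rewrite (sw2_push _ _ Lb); apply: eq_sw2 => c1 c2.
  rewrite /Q {1}/sw2 gg tliftE; last by lin.
  by rewrite !scalerA mulrC.
rewrite coassoc; last by rewrite /Q; lin.
apply: eq_sw2 => a1 r.
transitivity (sw2 (fun a2 y => sw2 (fun s c2 => sw2 (fun b c1 =>
   Q a1 a2 b c1 c2) s) y) r).
  by apply: eq_sw2 => a2 y; rewrite [RHS]coassoc // /Q; lin.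
rewrite -coassoc; last by rewrite /Q; lin.
apply: eq_sw2 => h' c2.
have Lf : lin (fun z : H => f (c2 * g * T a1) *: z) by lin.
by rewrite (linZ (L g)) (sw3_push _ _ Lf).
Qed.

Lemma bullet_stable g : grouplike g -> forall d m,
  m \in bullet_space g -> @dd_act _ _ (bullet_ddmod beta) d m \in bullet_space g.
Proof.
move=> gg d m /bullet_spaceP [h ->].
apply: rpred_sum => i _; apply: rpred_sum => j _; apply: rpredZ.
by apply/bullet_spaceP; rewrite -bulletM coact_bullet //; eexists.
Qed.

Definition bullet_module (g : H) (gg : grouplike g) : ddmod H :=
  sub_ddmod (@Submodule _ _ (bullet_ddmod beta) _ (bullet_stable gg)).

End BulletModule.

Section ModuleTheory.
Variables (K : fieldType) (H : hopfAlg K).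

Definition ddiso (M N : ddmod H) : Prop :=
  exists f : 'Hom(M, N), bijective f /\
    forall d m, f (dd_act d m) = dd_act d (f m).

Definition ddsimple (M : ddmod H) (U : submodule M) : Prop :=
  (U : {vspace M}) != 0%VS /\
  forall W : submodule M, (W <= U)%VS ->
    (W : {vspace M}) = 0%VS \/ (W : {vspace M}) = U.

Definition completely_reducible (M : ddmod H) : Prop :=
  exists (n : nat) (U : 'I_n -> submodule M),
    [/\ forall i, ddsimple (U i), (\sum_i U i)%VS = fullv
      & directv (\sum_i U i)%VS].

Definition is_socle (M : ddmod H) (S : submodule M) : Prop :=
  forall m, m \in (S : {vspace M}) <->
    exists (n : nat) (U : 'I_n -> submodule M),
      (forall i, ddsimple (U i)) /\ m \in (\sum_i U i)%VS.

Section DirectSum.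
Variables (M N : ddmod H).

Definition ddsum_act (d : double H) (m : M * N) : M * N :=
  (dd_act d m.1, dd_act d m.2).

Lemma ddsum_bilin : bilin ddsum_act.
Proof.
have [M1 M2] := dd_bilin M; have [N1 N2] := dd_bilin N.
by split=> w a u v; congr (_, _);
  [apply: M1 | apply: N1 | apply: M2 | apply: N2].
Qed.

Lemma ddsum_act1 m : ddsum_act (double1 H) m = m.
Proof. by rewrite /ddsum_act !dd_act1 -surjective_pairing. Qed.

Lemma ddsum_actM d e m :
  ddsum_act (double_mul d e) m = ddsum_act d (ddsum_act e m).
Proof. by rewrite /ddsum_act !dd_actM. Qed.

Definition ddsum : ddmod H := DDmod ddsum_bilin ddsum_act1 ddsum_actM.

End DirectSum.

Definition ddzero_act (d : double H) (m : 'rV[K]_0) : 'rV[K]_0 := m.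

Lemma ddzero_bilin : bilin ddzero_act.
Proof. by split=> w a u v; rewrite [LHS]thinmx0 [RHS]thinmx0. Qed.

Definition ddzero : ddmod H :=
  @DDmod _ H _ _ ddzero_bilin (fun=> erefl) (fun _ _ _ => erefl).

End ModuleTheory.

Notation "\ddsum_ ( m <= j < n ) F" :=
  (\big[@ddsum _ _/@ddzero _ _]_(m <= j < n) F)
  (at level 41, F at level 41, j, m, n at level 50).

(* Gamma = Hom(G, K^* ): a character never vanishes, as chi g * chi g^-1 = 1. *)
Section Characters.
Variables (K : fieldType) (gT : finGroupType).

Definition is_character (f : {ffun gT -> K}) : bool :=
  (f 1%g == 1) && [forall g, forall h, f (g * h)%g == f g * f h].

Record character := Character {
  char_fun :> {ffun gT -> K};
  char_funP : is_character char_fun }.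

HB.instance Definition _ := [isSub for char_fun].
HB.instance Definition _ := [Choice of character by <:].

Lemma char1 (chi : character) : chi 1%g = 1.
Proof. by case: chi => f /= /andP[/eqP]. Qed.

Lemma charM (chi : character) g h : chi (g * h)%g = chi g * chi h.
Proof. by case: chi => f /= /andP[_ /forallP/(_ g)/forallP/(_ h)/eqP]. Qed.

Lemma char_neq0 (chi : character) g : chi g != 0.
Proof.
apply/eqP => E; have := charM chi g g^-1%g.
by rewrite mulgV char1 E mul0r => /eqP; rewrite oner_eq0.
Qed.

Lemma is_characterP (f : {ffun gT -> K}) : f 1%g = 1 ->
  (forall g h, f (g * h)%g = f g * f h) -> is_character f.
Proof.
move=> f1 fM; rewrite /is_character f1 eqxx; apply/forallP => g.
by apply/forallP => h; rewrite fM.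
Qed.

Lemma char_one_subproof : is_character [ffun=> 1].
Proof. by apply: is_characterP => [|g h]; rewrite !ffunE ?mulr1. Qed.

Lemma char_mul_subproof (chi psi : character) :
  is_character [ffun g => chi g * psi g].
Proof.
apply: is_characterP => [|g h]; rewrite !ffunE ?char1 ?mulr1 //.
by rewrite !charM mulrACA.
Qed.

Lemma char_inv_subproof (chi : character) : is_character [ffun g => (chi g)^-1].
Proof.
by apply: is_characterP => [|g h]; rewrite !ffunE ?char1 ?invr1 ?charM ?invfM.
Qed.

Definition char_one := Character char_one_subproof.
Definition char_mul chi psi := Character (char_mul_subproof chi psi).
Definition char_inv chi := Character (char_inv_subproof chi).

Lemma character_eq (chi psi : character) :
  (forall g, chi g = psi g) -> chi = psi.
Proof. by move=> E; apply/val_inj/ffunP. Qed.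

Fact char_mulA : associative char_mul.
Proof. by move=> a b c; apply: character_eq => g; rewrite !ffunE mulrA. Qed.
Fact char_mul1 : left_id char_one char_mul.
Proof. by move=> a; apply: character_eq => g; rewrite !ffunE mul1r. Qed.
Fact char_mulr1 : right_id char_one char_mul.
Proof. by move=> a; apply: character_eq => g; rewrite !ffunE mulr1. Qed.
Fact char_mulV : left_inverse char_one char_inv char_mul.
Proof.
by move=> a; apply: character_eq => g; rewrite !ffunE mulVf ?char_neq0.
Qed.
Fact char_mulrV : right_inverse char_one char_inv char_mul.
Proof.
by move=> a; apply: character_eq => g; rewrite !ffunE mulfV ?char_neq0.
Qed.

HB.instance Definition _ := isGroup.Build character
  char_mulA char_mul1 char_mulr1 char_mulV char_mulrV.

Definition ev (chi : character) (a : gT) (p : gT * character) : K :=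
  (chi^-1)%g p.1 * p.2 a.

(* [p] and [q] have the same class modulo the kernel of [ev chi a] *)
Definition same_class (chi : character) (a : gT) (p q : gT * character) : Prop :=
  ev chi a (p^-1 * q)%g = 1.

End Characters.

Definition zpowg (X : groupType) (x : X) (c : int) : X :=
  match c with Posz n => x ^+ n | Negz n => x ^- n.+1 end%g.

Definition has_order (X : groupType) (x : X) (n : nat) : Prop :=
  [/\ (0 < n)%N, (x ^+ n)%g = 1%g &
    forall m, (0 < m < n)%N -> (x ^+ m)%g <> 1%g].

(* the integer r_c with 0 <= r_c < l and r_c = 2 c mod l, as a natural number *)
Definition rc (l : nat) (c : int) : nat := absz ((2 * c) %% l)%Z.

(* [H] is the Hopf algebra H_D of the data D = (G, chi, a), where G is the whole
   of [gT] and l = |chi(a)|; the elements of G are sent to H by [hd_grp], and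
   [hd_x] is x. *)
Record HD_structure (K : fieldType) (gT : finGroupType) (chi : character K gT)
    (a : gT) (l : nat) (H : hopfAlg K) := HDStructure {
  hd_grp : gT -> H;
  hd_x : H;
  hd_grp1 : hd_grp 1%g = 1;
  hd_grpM : forall g h, hd_grp (g * h)%g = hd_grp g * hd_grp h;
  hd_xl : hd_x ^+ l = 0;
  hd_xg : forall g, hd_x * hd_grp g = chi g *: (hd_grp g * hd_x);
  hd_gen : agenv <<hd_x :: codom hd_grp>>%VS = fullv;
  hd_univ : forall (A : algType K) (u : gT -> A) (y : A),
    u 1%g = 1 -> (forall g h, u (g * h)%g = u g * u h) -> y ^+ l = 0 ->
    (forall g, y * u g = chi g *: (u g * y)) ->
    exists f : {lrmorphism H -> A}, (forall g, f (hd_grp g) = u g) /\ f hd_x = y;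
  hd_comul_grp : forall g, comul H (hd_grp g) = tens (hd_grp g) (hd_grp g);
  hd_comul_x : comul H hd_x = tens hd_x (hd_grp a) + tens 1 hd_x }.

Section HD.
Variables (K : fieldType) (gT : finGroupType) (chi : character K gT).
Variables (a : gT) (l : nat) (H : hopfAlg K) (D : HD_structure chi a l H).

Lemma hd_grouplike g : grouplike (hd_grp D g).
Proof.
split; first exact: hd_comul_grp.
apply/eqP => E; have := hd_grpM D g g^-1%g.
by rewrite mulgV hd_grp1 E mul0r => /eqP; rewrite oner_eq0.
Qed.

(* [ext] extends the characters of G to H by x |-> 0 *)
Definition is_extension (ext : character K gT -> 'AHom(H, K^o)) : Prop :=
  forall beta, (forall g, ext beta (hd_grp D g) = beta g) /\
    ext beta (hd_x D) = 0.

End HD.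

(* Main.v *)
Require Import Defs.
From HB Require Import structures.
From mathcomp Require Import all_boot all_order all_algebra all_fingroup all_field.
From mathcomp Require Import ring zify.

Set Implicit Arguments.
Unset Strict Implicit.
Unset Printing Implicit Defensive.

Import GRing.Theory.
Local Open Scope ring_scope.

(** Put q = chi a, and write x for the skew-primitive generator of H and xi for
    the dual functional of x.  The theorem is Clebsch-Gordan theory for the
    quantum sl_2 at a root of unity that sits inside D(H): x raises, xi lowers,
    and [x, xi] = a - chi.

    Each module H . g with action twisted by beta is a string
    v, x v, ..., x^r v, where xi v = 0 and beta(a) = chi(g) q^r with r < l.  Here
    r is r_c, because ev takes the value q^2 on (a^-1, chi).  The relation
    [x, xi] = a - chi gives xi x^k v = b_k x^(k-1) v with
    b_k = chi(g) [k] (1 - q^(r+1-k)) ([sing_opxi]), so b_k is nonzero for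
    0 < k <= r.  Hence a string is simple, and it is determined up to
    isomorphism by its lowest weight (beta, g).

    In a tensor product of two strings, of lengths r + 1 and r' + 1, use the
    coordinates on the vectors x^i v (x) x^j v' and call i + j the degree.  The
    equation xi t = 0 is a two-term recursion between neighbouring coordinates
    of the same degree, with nonzero coefficients inside the rectangle
    [0, r] x [0, r'].  So ker xi has one line in each degree n <= min(r, r'),
    spanned by a vector [low n], and nothing else ([xi_kernel_expand]).  The
    same argument for x shows that x is injective in degrees below max(r, r')
    ([opx_injective]).

    The vector [low n] has the weight (beta_n, g_n), and behaves like the bottom
    of a string of top index s = r + r' - 2n.
    - If s < l then x^(s+1) (low n) lies in ker xi, in a degree above
      min(r, r'), so it vanishes and [low n] generates the simple module that
      belongs to (beta_n, g_n) ([string_low]).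
    - If s >= l then already k = s + 1 - l gives b_k = 0, so x^k (low n) lies in
      ker xi; it is nonzero because x is injective in the degrees involved.  It
      is therefore a multiple of [low (n + k)], whose index is of the first kind
      ([non_simple_low]).
    As xi is nilpotent and the [low n] have distinct chi-eigenvalues, every
    nonzero submodule contains some [low n], hence one of the first kind
    ([submod_low]).  So the simple submodules are exactly the strings generated
    by the [low n] with r + r' < l + 2n.  They are independent, and their sum
    is the socle.  When r + r' < l all n qualify, and counting dimensions
    shows that the sum is everything; otherwise degree 0 is missed.

    What makes this apply to D(H)-modules is that D(H) is generated by x, G, xi
    and the functionals that factor through the projection of H onto the span
    of G with x |-> 0 ([double_ind]): stability and equivariance need only be
    checked on these. *)

(** * Generators of the Hopf algebra and of its dual *)

Section Generators.
Variables (K : fieldType) (gT : finGroupType) (chi : character K gT) (a : gT).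
Variables (l : nat) (H : hopfAlg K) (D : HD_structure chi a l H).
Local Notation u := (hd_grp D).
Local Notation x := (hd_x D).
Local Notation T := (antipode H)^-1%VF.
Local Notation eps := (counit H).

Lemma char_inv_grp (psi : character K gT) (g : gT) :
  psi g^-1%g = (psi g)^-1.
Proof.
apply: (mulIf (char_neq0 psi g)).
by rewrite -Defs.charM mulVg Defs.char1 mulVf // char_neq0.
Qed.

Lemma char_expn (psi : character K gT) (g : gT) n :
  psi (g ^+ n)%g = psi g ^+ n.
Proof.
by elim: n => [|n IH]; rewrite ?expg0 ?Defs.char1 ?expr0 // expgS Defs.charM IH exprS.
Qed.

Lemma xk_grp k g : x ^+ k * u g = chi g ^+ k *: (u g * x ^+ k).
Proof.
elim: k => [|k IH]; first by rewrite !expr0 mul1r mulr1 scale1r.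
rewrite {1}exprS -mulrA IH -scalerAr [x * _]mulrA hd_xg -scalerAl scalerA.
by rewrite -exprSr -mulrA -exprS.
Qed.

Lemma grp_xk k g : u g * x ^+ k = chi g ^- k *: (x ^+ k * u g).
Proof.
by rewrite xk_grp scalerA mulVf ?scale1r // expf_neq0 // char_neq0.
Qed.

(** The products u g * x ^+ k span H: the span contains 1, and the relation
    x g = chi(g) g x makes it stable under left multiplication by the
    generators. *)
Lemma hd_span_ind (P : H -> Prop) :
  (forall b h k, P h -> P k -> P (b *: h + k)) ->
  (forall g k, P (u g * x ^+ k)) -> forall h, P h.
Proof.
move=> Plin PB h.
have P0 : P 0.
  by have := Plin (-1) _ _ (PB 1%g 0%N) (PB 1%g 0%N); rewrite scaleN1r addNr.
pose V := (\sum_(p : gT * 'I_l) <[u p.1 * x ^+ p.2]>)%VS.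
have memV g k : u g * x ^+ k \in V.
  case: (ltnP k l) => [lt|le].
    apply: (subvP (sumv_sup (g, Ordinal lt) isT (subvv _))); exact: memv_line.
  by rewrite -(subnKC le) exprD hd_xl mul0r mulr0 mem0v.
have VT : V = fullv.
  apply/eqP; rewrite eqEsubv subvf /= -(hd_gen D); apply: agenv_sub_modl.
    by rewrite -memvE; have := memV 1%g 0%N; rewrite hd_grp1 expr0 mulr1.
  apply/prodvP => b v bX vV.
  suff SV : (<<x :: codom u>> <= (linfun ( *%R^~ v)) @^-1: V)%VS.
    have := subvP SV _ bX; rewrite -memv_preim linfun_lin //.
    by move=> c y z; rewrite mulrDl -scalerAl.
  apply/span_subvP => y; rewrite -memv_preim.
  rewrite (linfun_lin (f := *%R^~ v)); last first.
    by move=> c e z; rewrite mulrDl -scalerAl.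
  case/memv_sumP: vV => vs Hvs ->.
  rewrite inE => /orP[/eqP ->|/codomP [g ->]]; rewrite mulr_sumr;
    apply: rpred_sum => -[g' k] _; have /vlineP [c ->] := Hvs (g', k) isT;
    rewrite -scalerAr rpredZ //= mulrA.
    by rewrite hd_xg -scalerAl rpredZ // -mulrA -exprS memV.
  by rewrite -hd_grpM memV.
have /memv_sumP [vs Hvs ->] : h \in V by rewrite VT memvf.
elim/big_rec: _ => [//|p y _ Py].
have /vlineP [c ->] := Hvs p isT; exact: Plin.
Qed.

Lemma hd_gen_ind (P : H -> Prop) :
  (forall b h k, P h -> P k -> P (b *: h + k)) -> P 1 ->
  (forall h, P h -> P (x * h)) -> (forall g h, P h -> P (u g * h)) ->
  forall h, P h.
Proof.
move=> Plin P1 Px Pg; apply: hd_span_ind => // g k; apply: (Pg).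
by elim: k => [|k IH]; rewrite ?expr0 // exprS; apply: Px.
Qed.

Lemma sw2_grp (W : lmodType K) (F : H -> H -> W) g : bilin F ->
  sw2 F (u g) = F (u g) (u g).
Proof. by move=> B; rewrite /sw2 hd_comul_grp tliftE. Qed.

Lemma sw2_x (W : lmodType K) (F : H -> H -> W) : bilin F ->
  sw2 F x = F x (u a) + F 1 x.
Proof.
by move=> B; rewrite /sw2 hd_comul_x (linD (tlift_lin F)) !tliftE.
Qed.

Lemma sw3_grp (W : lmodType K) (F : H -> H -> H -> W) g : trilin F ->
  sw3 F (u g) = F (u g) (u g) (u g).
Proof.
case=> F1 F2 F3; rewrite /sw3 sw2_grp; last by split=> *; lin.
by rewrite sw2_grp; last by split=> *; lin.
Qed.

Lemma sw3_x (W : lmodType K) (F : H -> H -> H -> W) : trilin F ->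
  sw3 F x = F x (u a) (u a) + F 1 x (u a) + F 1 1 x.
Proof.
case=> F1 F2 F3; rewrite /sw3 sw2_x; last by split=> *; lin.
rewrite sw2_grp; last by split=> *; lin.
by rewrite sw2_x ?addrA; last by split=> *; lin.
Qed.

Lemma grp_neq0 g : u g != 0.
Proof. by have [] := hd_grouplike D g. Qed.

Lemma counit_grp g : eps (u g) = 1.
Proof.
have := counitl (u g); rewrite -/(sw2 _ _) sw2_grp; last by lin.
move=> E; have /eqP : (eps (u g) - 1) *: u g = 0.
  by rewrite scalerBl scale1r E subrr.
by rewrite scaler_eq0 (negbTE (grp_neq0 g)) orbF subr_eq0 => /eqP.
Qed.

Lemma counit_x : eps x = 0.
Proof.
have := counitl x; rewrite -/(sw2 _ _) sw2_x; last by lin.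
rewrite rmorph1 scale1r => /eqP; rewrite -subr_eq0 addrK scaler_eq0.
by rewrite (negbTE (grp_neq0 a)) orbF => /eqP.
Qed.

Lemma grpV g : u g * u g^-1%g = 1.
Proof. by rewrite -hd_grpM mulgV hd_grp1. Qed.

Lemma grpVl g : u g^-1%g * u g = 1.
Proof. by rewrite -hd_grpM mulVg hd_grp1. Qed.

Lemma Tinv_grp g : T (u g) = u g^-1%g.
Proof.
have := sw2_Tinvr (u g) (@lin_id K H); rewrite sw2_grp; last by lin.
rewrite counit_grp scale1r => E.
by rewrite -[LHS]mul1r -(grpVl g) -mulrA E mulr1.
Qed.

Lemma Tinv_x : T x = - (u a^-1%g * x).
Proof.
have := sw2_Tinvr x (@lin_id K H); rewrite sw2_x; last by lin.
rewrite counit_x scale0r Tinv_1 mulr1 => /eqP; rewrite addr_eq0 => /eqP E.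
by rewrite -[LHS]mul1r -(grpVl a) -mulrA E mulrN.
Qed.

(** The functionals chi and xi and the projection [fr_pi] are given by their
    values on products, so that a basis of H is never needed.  The rule for
    [fr_xi] says that xi has coproduct xi (x) chi + eps (x) xi. *)
Record hd_frame := HdFrame {
  fr_pi : {lrmorphism H -> H};
  fr_chi : dual H;
  fr_xi : dual H;
  fr_pi_grp : forall g, fr_pi (u g) = u g;
  fr_pi_x : fr_pi x = 0;
  fr_chi_grp : forall g, fr_chi (u g) = chi g;
  fr_chi_M : forall h k, fr_chi (h * k) = fr_chi h * fr_chi k;
  fr_chi_x : fr_chi x = 0;
  fr_xi_grp : forall g, fr_xi (u g) = 0;
  fr_xi_x : fr_xi x = 1;
  fr_xi_M : forall h k, fr_xi (h * k) = eps h * fr_xi k + fr_xi h * fr_chi k }.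

(** The projection and xi both come from the universal property of H.  The
    projection is the endomorphism g |-> g, x |-> 0.
    A functional with the coproduct of xi is an off-diagonal entry of an algebra
    map to the 2 x 2 matrices, here g |-> diag(1, chi g) and x |-> E_12, whose
    diagonal entries are eps and chi. *)
Lemma hd_frame_exists : (1 < l)%N -> inhabited hd_frame.
Proof.
move=> l1.
have [||||pi [piG piX]] := @hd_univ _ _ _ _ _ _ D H u 0.
- exact: hd_grp1.
- exact: hd_grpM.
- by rewrite expr0n eqn0Ngt (ltnW l1).
- by move=> g; rewrite mul0r mulr0 scaler0.
pose d (g : gT) : 'M[K]_2 :=
  \matrix_(i, j) if i == j then (if i == 0 then 1 else chi g) else 0.
pose y : 'M[K]_2 := delta_mx 0 1.
have d00 g : d g 0 0 = 1 by rewrite !mxE.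
have d01 g : d g 0 1 = 0 by rewrite !mxE.
have d10 g : d g 1 0 = 0 by rewrite !mxE.
have d11 g : d g 1 1 = chi g by rewrite !mxE.
have y00 : y 0 0 = 0 by rewrite !mxE.
have y01 : y 0 1 = 1 by rewrite !mxE.
have y10 : y 1 0 = 0 by rewrite !mxE.
have y11 : y 1 1 = 0 by rewrite !mxE.
have mE (A B : 'M[K]_2) i j : (A * B) i j = A i 0 * B 0 j + A i 1 * B 1 j.
  rewrite mxE big_ord_recl big_ord1; congr (_ + _ * _); congr (_ _ _);
    exact: val_inj.
have ord2 (i : 'I_2) : i = 0 \/ i = 1.
  by case: i => [[|[|]]] // p; [left | right]; apply: val_inj.
have ext2 (A B : 'M[K]_2) : A 0 0 = B 0 0 -> A 0 1 = B 0 1 -> A 1 0 = B 1 0 ->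
    A 1 1 = B 1 1 -> A = B.
  move=> E1 E2 E3 E4; apply/matrixP => i j.
  by case: (ord2 i) => ->; case: (ord2 j) => ->.
have dE := (d00, d01, d10, d11); have yE := (y00, y01, y10, y11).
have simp := (mul0r, mulr0, mul1r, mulr1, addr0, add0r).
have [|||g|rho [rG rX]] := @hd_univ _ _ _ _ _ _ D _ d y.
- by apply: ext2; rewrite !(dE, mxE) ?Defs.char1.
- by move=> g h; apply: ext2; rewrite mE !dE !simp // Defs.charM.
- have y2 : y ^+ 2 = 0 by apply: ext2; rewrite expr2 mE !yE !mxE !simp.
  by rewrite -(subnKC l1) exprD y2 mul0r.
- by apply: ext2; rewrite [RHS]mxE !mE !(yE, dE) !simp.
have r10 h : rho h 1 0 = 0.
  elim/hd_gen_ind: h => [b h k E1 E2||h E|g h E].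
  - by rewrite linearP !mxE E1 E2 mulr0 addr0.
  - by rewrite rmorph1 mxE.
  - by rewrite rmorphM mE /= rX !yE !simp.
  - by rewrite rmorphM mE /= rG !dE E !simp.
have r00 h : rho h 0 0 = eps h.
  elim/hd_gen_ind: h => [b h k E1 E2||h E|g h E].
  - by rewrite !linearP !mxE E1 E2.
  - by rewrite !rmorph1 mxE.
  - by rewrite !rmorphM mE /= rX !yE r10 counit_x !simp.
  - by rewrite !rmorphM mE /= rG !dE E counit_grp !simp.
have Lij i j : lin (fun h => rho h i j : K^o).
  by move=> b h k; rewrite linearP !mxE.
split; exists pi (dfun (fun h => rho h 1 1 : K^o)) (dfun (fun h => rho h 0 1 : K^o));
  do ?[by []]; intros; rewrite !(dfunE (Lij _ _)) ?rmorphM ?mE /= ?rG ?rX ?dE ?yE //.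
  by rewrite r10 !simp.
by rewrite r00.
Qed.
End Generators.

(** * Generators of the Drinfel'd double *)

Section DualGenerators.
Variables (K : fieldType) (gT : finGroupType) (chi : character K gT) (a : gT).
Variables (l : nat) (H : hopfAlg K) (D : HD_structure chi a l H).
Variable F : hd_frame D.
Local Notation u := (hd_grp D).
Local Notation x := (hd_x D).
Local Notation q := (chi a).
Local Notation xi := (fr_xi F).
Local Notation pi := (fr_pi F).

Definition qint (n : nat) : K := \sum_(i < n) q ^+ i.

Lemma qint0 : qint 0 = 0. Proof. exact: big_ord0. Qed.
Lemma qintS n : qint n.+1 = qint n + q ^+ n.
Proof. exact: big_ord_recr. Qed.

Lemma qintE n : (1 - q) * qint n = 1 - q ^+ n.
Proof.
elim: n => [|n IH]; first by rewrite qint0 mulr0 expr0 subrr.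
by rewrite qintS mulrDr IH mulrBl mul1r -exprS addrA subrK.
Qed.

Lemma qint_eq0 n : l.-primitive_root q -> (1 < l)%N ->
  (qint n == 0) = (l %| n)%N.
Proof.
move=> prq l1; rewrite (prim_order_dvd prq).
have q1 : 1 - q != 0.
  rewrite subr_eq0 eq_sym; apply: contraL l1 => /eqP q1.
  by rewrite -leqNgt dvdn_leq // (prim_order_dvd prq) q1 expr1n.
by rewrite -(mulrI_eq0 _ (mulfI q1)) qintE subr_eq0 eq_sym.
Qed.

(** The functionals [dpi f] see only the G-part of H; together with xi they
    generate the dual algebra, see [dual_taylor].  They take the place of the
    characters of G, which would have to be shown to span the functions on G. *)
Definition dpi (f : dual H) : dual H := dfun (fun h => f (pi h)).

Lemma dpiE f h : dpi f h = f (pi h).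
Proof. by rewrite dfunE // => b y z; rewrite !linearP. Qed.

Lemma dpi_grp f g : dpi f (u g) = f (u g).
Proof. by rewrite dpiE fr_pi_grp. Qed.

Lemma dpi_lin : lin dpi.
Proof.
move=> b f f'; apply: dual_eq => h.
by rewrite add_lfunE scale_lfunE !dpiE add_lfunE scale_lfunE.
Qed.

Lemma dpi_mult (f : dual H) :
  (forall h k, f (h * k) = f h * f k) -> f x = 0 -> dpi f = f.
Proof.
move=> fM fx; apply: dual_eq.
apply: (hd_span_ind (D := D)) => [b h k E1 E2|g k].
  by rewrite !dual_lin E1 E2.
rewrite dpiE (rmorphM pi) (rmorphXn pi) /= fr_pi_grp fr_pi_x !fM.
case: k => [|k]; first by rewrite !expr0.
by rewrite !exprS !fM fx mul0r linear0 mul0r.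
Qed.

Lemma dpi_chi : dpi (fr_chi F) = fr_chi F.
Proof. exact: dpi_mult (@fr_chi_M _ _ _ _ _ _ _ F) (@fr_chi_x _ _ _ _ _ _ _ F). Qed.

Lemma dpi_eps : dpi (dual1 H) = dual1 H.
Proof. exact: dpi_mult (@counitM _ H) (counit_x D). Qed.

Lemma dual_ract_xi g : dual_ract xi (u g) = xi.
Proof.
by apply: dual_eq => h; rewrite dual_ractE fr_xi_M counit_grp fr_xi_grp
  mul1r mul0r addr0.
Qed.

Lemma lact_grp_xi g : dual_lact (u g) xi = chi g *: xi.
Proof.
apply: dual_eq => h; rewrite dual_lactE fr_xi_M fr_xi_grp scale_lfunE.
by rewrite mulr0 add0r fr_chi_grp mulrC.
Qed.

Lemma lact_x_xi : dual_lact x xi = dual1 H.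
Proof.
apply: dual_eq => h.
by rewrite dual_lactE fr_xi_M fr_xi_x fr_chi_x mulr0 mulr1 addr0.
Qed.

Lemma lact_grp_mul g f f' : dual_lact (u g) (dual_mul f f') =
  dual_mul (dual_lact (u g) f) (dual_lact (u g) f').
Proof.
apply: dual_eq => h; rewrite dual_lactE !dual_mulE sw2_M; last by lin.
apply: eq_sw2 => h1 h2; rewrite (sw2_grp D); last by lin.
by rewrite !dual_lactE.
Qed.

Lemma lact_x_mul f f' : dual_lact x (dual_mul f f') =
  dual_mul (dual_lact x f) (dual_lact (u a) f') + dual_mul f (dual_lact x f').
Proof.
apply: dual_eq => h; rewrite add_lfunE dual_lactE !dual_mulE sw2_M; last by lin.
transitivity (sw2 (fun h1 h2 => dual_lact x f h1 * dual_lact (u a) f' h2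
   + f h1 * dual_lact x f' h2) h).
  apply: eq_sw2 => h1 h2; rewrite (sw2_x D); last by lin.
  by rewrite !dual_lactE mulr1.
rewrite /sw2 /tlift -big_split /=; apply: eq_bigr => i _.
by rewrite -big_split; apply: eq_bigr => j _; rewrite scalerDr.
Qed.

Lemma lact_M (h k : H) (f : dual H) : dual_lact (h * k) f = dual_lact h (dual_lact k f).
Proof. by apply: dual_eq => z; rewrite !dual_lactE mulrA. Qed.

Lemma lact_x_dpi (f : dual H) : dual_lact x (dpi f) = 0.
Proof.
apply: dual_eq => h.
by rewrite dual_lactE dpiE rmorphM /= fr_pi_x mulr0 linear0 zero_lfunE.
Qed.

Definition xip k : dual H := iter k (dual_mul xi) (dual1 H).

Lemma lact_grp_xip g k : dual_lact (u g) (xip k) = chi g ^+ k *: xip k.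
Proof.
elim: k => [|k IH]; first by rewrite dual_lact_eps counit_grp.
rewrite /= lact_grp_mul lact_grp_xi IH.
have [B1 B2] := dual_mul_bilin H.
by rewrite (linZ (B1 _)) (linZ (B2 _)) scalerA exprS.
Qed.

(** Acting by x on the dual is a q-derivation, with d(xi) = eps: this is
    d(xi^k) = [k] xi^(k-1). *)
Lemma lact_x_xip k : dual_lact x (xip k) = qint k *: xip k.-1.
Proof.
have [B1 B2] := dual_mul_bilin H.
elim: k => [|k IH]; first by rewrite dual_lact_eps counit_x qint0 !scale0r.
rewrite /= lact_x_mul lact_x_xi lact_grp_xip mul1_dual IH (linZ (B2 _)) qintS.
rewrite addrC scalerDl; congr (_ + _).
by case: k {IH} => [|k] //=; rewrite qint0 !scale0r.
Qed.

Lemma xip_grp g k : xip k (u g) = (k == 0)%:R.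
Proof.
case: k => [|k]; first by rewrite /= counit_grp.
by rewrite /= dual_mulE (sw2_grp D) ?fr_xi_grp ?mul0r //; lin.
Qed.

Definition qfact (n : nat) : K := \prod_(i < n) qint i.+1.

Lemma lact_xk_xip (f : dual H) j k :
  dual_lact (x ^+ j) (dual_mul (dpi f) (xip k)) =
  (\prod_(i < j) qint (k - i)) *: dual_mul (dpi f) (xip (k - j)).
Proof.
have [B1 B2] := dual_mul_bilin H.
elim: j => [|j IH]; first by rewrite expr0 dual_lact1 big_ord0 scale1r subn0.
rewrite exprS lact_M IH (linZ (proj2 (dual_lact_bilin H) _)) lact_x_mul.
rewrite lact_x_dpi (lin0 (B1 _)) add0r lact_x_xip (linZ (B2 _)) scalerA.
by rewrite big_ord_recr /= subnS.
Qed.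

(** Differentiating j times and evaluating on G leaves the term k = j only. *)
Lemma mul_xip_basis (f : dual H) k g j :
  dual_mul (dpi f) (xip k) (u g * x ^+ j) =
  if j == k then f (u g) * qfact k else 0.
Proof.
rewrite -dual_lactE lact_xk_xip scale_lfunE dual_mulE sw2_grp; last by lin.
rewrite dpi_grp xip_grp subn_eq0.
case: ltngtP => [lt|lt|<-].
- rewrite (bigD1 (Ordinal lt)) //= subnn qint0 mul0r.
  by rewrite /GRing.scale /= mul0r.
- by rewrite mulr0 scaler0.
rewrite mulr1 [_ *: _]mulrC /qfact (reindex_inj rev_ord_inj) /=; congr (_ * _).
by apply: eq_bigr => i _; rewrite subnA ?subnn ?add0n // ltnW.
Qed.

Hypotheses (prq : l.-primitive_root q) (l1 : (1 < l)%N).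

Lemma qfact_neq0 k : (k < l)%N -> qfact k != 0.
Proof.
move=> kl; apply/prodf_neq0 => i _; rewrite qint_eq0 //.
by apply/negP => /(dvdn_leq (ltn0Sn _)); rewrite leqNgt (leq_ltn_trans _ kl).
Qed.

(** Taylor expansion in xi, for the q-derivation given by x: the coefficient of
    xi^k / [k]! is the k-th derivative of f, restricted to G. *)
Lemma dual_taylor (f : dual H) :
  f = \sum_(k < l) (qfact k)^-1 *: dual_mul (dpi (dual_lact (x ^+ k) f)) (xip k).
Proof.
apply: dual_eq; apply: (hd_span_ind (D := D)) => [b h k E1 E2|g j].
  by rewrite !dual_lin E1 E2.
rewrite sum_lfunE; case: (ltnP j l) => [jl|lj]; last first.
  rewrite -{1}(subnK lj) exprD hd_xl mulr0 mulr0 linear0 big1 // => k _.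
  rewrite scale_lfunE mul_xip_basis gtn_eqF ?scaler0 //.
  exact: leq_trans (ltn_ord k) lj.
rewrite (bigD1 (Ordinal jl)) //= big1 ?addr0 => [|k nk].
  rewrite scale_lfunE mul_xip_basis eqxx dual_lactE.
  by rewrite [_ *: _]mulrC mulfK // qfact_neq0.
rewrite scale_lfunE mul_xip_basis; case: eqP => E; last by rewrite scaler0.
by case/eqP: nk; apply: val_inj.
Qed.

(** The only product g x^j on which xi^l could be nonzero is the one for j = l,
    and there its value is [l]! = 0. *)
Lemma xip_l : xip l = 0.
Proof.
apply: dual_eq; apply: (hd_span_ind (D := D)) => [b h k E1 E2|g j].
  by rewrite !dual_lin E1 E2.
rewrite -{1}[xip l]mul1_dual -dpi_eps mul_xip_basis zero_lfunE; case: eqP => // _.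
have l0 : (l.-1 < l)%N by rewrite prednK // ltnW.
rewrite /qfact (bigD1 (Ordinal l0)) //= prednK ?(ltnW l1) //.
have /eqP -> : qint l == 0 by rewrite qint_eq0.
by rewrite mul0r mulr0.
Qed.

(** Every element of the double is a combination of words in the generators x,
    G, xi and the [dpi p].  Words are built from the left, which is how they
    act on a module. *)
Lemma double_ind (P : Defs.double H -> Prop) :
  (forall b d e, P d -> P e -> P (b *: d + e)) ->
  P (double1 H) ->
  (forall h, P (tens (dual1 H) h) -> P (tens (dual1 H) (x * h))) ->
  (forall g h, P (tens (dual1 H) h) -> P (tens (dual1 H) (u g * h))) ->
  (forall f h, P (tens f h) -> P (tens (dual_mul xi f) h)) ->
  (forall p f h, P (tens f h) -> P (tens (dual_mul (dpi p) f) h)) ->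
  forall d, P d.
Proof.
move=> Plin P1 Px Pg Pxi Pp.
have P0 : P 0.
  by have := Plin (-1) _ _ P1 P1; rewrite scaleN1r addNr.
have Psum (I : finType) (G : I -> Defs.double H) : (forall i, P (G i)) ->
    P (\sum_i G i).
  move=> PG; elim/big_rec: _ => [//|i y _ Py].
  by rewrite -[G i]scale1r; apply: Plin.
have PZ b d : P d -> P (b *: d).
  by move=> Pd; rewrite -[_ *: _]addr0; apply: Plin.
have [B1 B2] := tens_bilin (dual H) H.
have Ph h : P (tens (dual1 H) h).
  apply: (hd_gen_ind (D := D) (P := fun h => P (tens (dual1 H) h))) => //.
  by move=> b h1 h2 E1 E2; rewrite B2; apply: Plin.
have Pfh (f : dual H) h : P (tens f h).
  rewrite (dual_taylor f) (lin_sum _ (B1 h)); apply: Psum => k.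
  rewrite (linZ (B1 h)); apply: PZ; apply: Pp.
  by elim: (val k) => [|n IH] //=; apply: Pxi.
move=> d; rewrite (tensor_expand d); apply: (Psum) => i; apply: (Psum) => j.
exact: PZ.
Qed.

End DualGenerators.

(** * Singular vectors in modules over the double *)

(** A stable subspace that contains a sum of eigenvectors for distinct
    eigenvalues contains each of them: apply C - lam_n to remove the last term,
    and use induction. *)
Lemma eigen_separation (K : fieldType) (V : vectType K) (W : {vspace V})
    (C : V -> V) (lam : nat -> K) (n : nat) (v : nat -> V) :
  lin C -> (forall m, m \in W -> C m \in W) ->
  (forall i, (i < n)%N -> C (v i) = lam i *: v i) ->
  (forall i j, (i < n)%N -> (j < n)%N -> lam i = lam j -> i = j) ->
  \sum_(i < n) v i \in W -> forall i, (i < n)%N -> v i \in W.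
Proof.
move=> CL CW; elim: n v => [//|n IH] v Cv laminj sumW.
have vW i : (i < n)%N -> v i \in W.
  move=> ilt.
  have : (lam i - lam n) *: v i \in W.
    apply: (IH (fun i => (lam i - lam n) *: v i)) ilt.
    - by move=> j jn; rewrite (linZ CL) Cv ?scalerA 1?mulrC // ltnW.
    - by move=> j k jn kn; apply: laminj; rewrite ltnS ltnW.
    have -> : \sum_(j < n) (lam j - lam n) *: v j =
        C (\sum_(j < n.+1) v j) - lam n *: \sum_(j < n.+1) v j.
      rewrite (lin_sum _ CL) scaler_sumr -sumrB big_ord_recr /=.
      rewrite Cv // subrr addr0; apply: eq_bigr => j _.
      by rewrite Cv ?scalerBl // ltnW // ltnS ltn_ord.
    by rewrite rpredB ?rpredZ ?CW.
  rewrite rpredZeq subr_eq0 => /orP[/eqP E|//].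
  by have := laminj i n (ltnW ilt) (ltnSn n) E; move: ilt => /[swap] ->; rewrite ltnn.
move=> i; rewrite ltnS leq_eqVlt => /orP[/eqP ->|]; last exact: vW.
have -> : v n = \sum_(j < n.+1) v j - \sum_(j < n) v j.
  by rewrite big_ord_recr /= addrAC subrr add0r.
by rewrite rpredB // rpred_sum // => j _; apply: vW.
Qed.

Section Modules.
Variables (K : fieldType) (gT : finGroupType) (chi : character K gT) (a : gT).
Variables (l : nat) (H : hopfAlg K) (D : HD_structure chi a l H).
Variable F : hd_frame D.
Local Notation u := (hd_grp D).
Local Notation x := (hd_x D).
Local Notation q := (chi a).
Local Notation xi := (fr_xi F).
Hypotheses (prq : l.-primitive_root q) (l1 : (1 < l)%N).

Definition opx (M : ddmod H) : M -> M := @mod_hact K H M x.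
Definition opg (M : ddmod H) (g : gT) : M -> M := @mod_hact K H M (u g).
Definition opxi (M : ddmod H) : M -> M := @mod_fact K H M xi.
Definition oppi (M : ddmod H) (f : dual H) : M -> M := @mod_fact K H M (dpi F f).

Lemma hact_lin (M : ddmod H) h : lin (@mod_hact K H M h).
Proof. exact: (proj2 (pair_hbilin (mod_pair M)) h). Qed.
Lemma fact_lin (M : ddmod H) f : lin (@mod_fact K H M f).
Proof. exact: (proj2 (pair_fbilin (mod_pair M)) f). Qed.
Lemma opx_lin M : lin (@opx M). Proof. exact: hact_lin. Qed.
Lemma opg_lin M g : lin (@opg M g). Proof. exact: hact_lin. Qed.
Lemma opxi_lin M : lin (@opxi M). Proof. exact: fact_lin. Qed.
Lemma oppi_lin M f : lin (@oppi M f). Proof. exact: fact_lin. Qed.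

Lemma equivariant_gen (M N : ddmod H) (phi : M -> N) : lin phi ->
  (forall m, phi (opx m) = opx (phi m)) ->
  (forall g m, phi (opg g m) = opg g (phi m)) ->
  (forall m, phi (opxi m) = opxi (phi m)) ->
  (forall f m, phi (oppi f m) = oppi f (phi m)) ->
  forall d m, phi (dd_act d m) = dd_act d (phi m).
Proof.
move=> L Ex Eg Exi Ep d.
have [BM _] := dd_bilin M; have [BN _] := dd_bilin N.
elim/(double_ind (F := F) prq l1): d => [b d e Ed Ee||h IH|g h IH|f h IH|p f h IH] m.
- by rewrite BM L Ed Ee BN.
- by rewrite !dd_act1.
- move: (IH m); rewrite !dd_actE !(pair_f1 (mod_pair _)) !(pair_hM (mod_pair _)).
  by move=> E; rewrite -E; exact: Ex.
- move: (IH m); rewrite !dd_actE !(pair_f1 (mod_pair _)) !(pair_hM (mod_pair _)).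
  by move=> E; rewrite -E; exact: Eg.
- move: (IH m); rewrite !dd_actE !(pair_fM (mod_pair _)).
  by move=> E; rewrite -E; exact: Exi.
- move: (IH m); rewrite !dd_actE !(pair_fM (mod_pair _)).
  by move=> E; rewrite -E; exact: Ep.
Qed.

Lemma stable_gen (M : ddmod H) (W : {vspace M}) :
  (forall m, m \in W -> opx m \in W) ->
  (forall g m, m \in W -> opg g m \in W) ->
  (forall m, m \in W -> opxi m \in W) ->
  (forall f m, m \in W -> oppi f m \in W) ->
  forall d m, m \in W -> dd_act d m \in W.
Proof.
move=> Wx Wg Wxi Wp d; have [B _] := dd_bilin M.
elim/(double_ind (F := F) prq l1): d => [b d e Ed Ee||h IH|g h IH|f h IH|p f h IH] m mW.
- by rewrite B rpredD ?rpredZ ?Ed ?Ee.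
- by rewrite dd_act1.
- by move: (Wx _ (IH m mW)); rewrite !dd_actE !(pair_f1 (mod_pair _)) (pair_hM (mod_pair _)).
- by move: (Wg g _ (IH m mW)); rewrite !dd_actE !(pair_f1 (mod_pair _)) (pair_hM (mod_pair _)).
- by move: (Wxi _ (IH m mW)); rewrite !dd_actE (pair_fM (mod_pair _)).
- by move: (Wp p _ (IH m mW)); rewrite !dd_actE (pair_fM (mod_pair _)).
Qed.

Section OneModule.
Variable M : ddmod H.
Implicit Types m w : M.

Lemma submod_opx (W : submodule M) m : m \in (W : {vspace M}) -> opx m \in (W : {vspace M}).
Proof. exact: sub_stable. Qed.
Lemma submod_opxi (W : submodule M) m : m \in (W : {vspace M}) -> opxi m \in (W : {vspace M}).
Proof. exact: sub_stable. Qed.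

Definition opchi : M -> M := @oppi M (fr_chi F).

Lemma opchiE m : opchi m = mod_fact (fr_chi F) m.
Proof. by rewrite /opchi /oppi dpi_chi. Qed.

Lemma opg_opx g m : opg g (opx m) = (chi g)^-1 *: opx (opg g m).
Proof.
rewrite /opg /opx -!(pair_hM (mod_pair M)) hd_xg.
have [B _] := pair_hbilin (mod_pair M).
by rewrite (linZ (B m)) scalerA mulVf ?scale1r // char_neq0.
Qed.

Lemma dual_ract_M (h k : H) (f : dual H) :
  dual_ract f (h * k) = dual_ract (dual_ract f h) k.
Proof. by apply: dual_eq => z; rewrite !dual_ractE mulrA. Qed.

(** The commutation rule of the double for h = x, whose iterated coproduct is
    x (x) a (x) a + 1 (x) x (x) a + 1 (x) 1 (x) x, with S^-1(x) = - a^-1 x. *)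
Lemma opx_fact f m : opx (mod_fact f m) =
  mod_fact (dual_lact x (dual_ract f (u a^-1%g))) (opg a m)
  + mod_fact (dual_ract f (u a^-1%g)) (opx m)
  - mod_fact (dual_ract f (u a^-1%g * x)) m.
Proof.
have [B1 B2] := pair_fbilin (mod_pair M).
have [C1 C2] := pair_hbilin (mod_pair M).
rewrite {1}/opx (pair_comm (mod_pair M)) (sw3_x D); last first.
  have BF := pair_fbilin (mod_pair M); have BH := pair_hbilin (mod_pair M).
  by lin.
rewrite Tinv_grp Tinv_x !dual_lact1 (pair_h1 (mod_pair M)); congr (_ + _).
have [_ R] := dual_ract_bilin H.
rewrite -scaleN1r (linZ (R f)) (linZ (B1 m)).
by rewrite scaleN1r.
Qed.

(** The relation [x, xi] = a - chi. *)
Lemma opx_opxi m : opx (opxi m) = opxi (opx m) + opg a m - opchi m.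
Proof.
rewrite opchiE /opxi opx_fact dual_ract_M !dual_ract_xi lact_x_xi.
rewrite (pair_f1 (mod_pair M)); congr (_ - _); first by rewrite addrC.
congr mod_fact; apply: dual_eq => h.
by rewrite dual_ractE fr_xi_M counit_x fr_xi_x mul0r mul1r add0r.
Qed.

(** x raises the G-degree by a: on a vector of degree gam, [dpi f] acts by
    f(gam), and on its image under x by f(a gam). *)
Lemma oppi_opx f m : oppi f (opx m) = opx (oppi (dual_ract f (u a)) m).
Proof.
rewrite /oppi opx_fact.
set f1 := dual_ract _ (u a^-1%g).
have -> : f1 = dpi F f.
  apply: dual_eq => h; rewrite dual_ractE !dpiE dual_ractE rmorphM /= fr_pi_grp.
  by rewrite mulrA grpV mul1r.
have -> : dual_ract (dpi F (dual_ract f (u a))) (u a^-1%g * x) = 0.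
  apply: dual_eq => h; rewrite dual_ractE dpiE !rmorphM /= fr_pi_x mulr0 mul0r.
  by rewrite zero_lfunE (lin0 (dual_lin _)).
have [B1 B2] := pair_fbilin (mod_pair M).
by rewrite lact_x_dpi !(lin0 (B1 _)) add0r subr0.
Qed.

Lemma opxi_nilpotent m : iter l (@opxi M) m = 0.
Proof.
have E k : iter k (@opxi M) m = mod_fact (xip F k) m.
  elim: k => [|k IH] /=; first by rewrite (pair_f1 (mod_pair M)).
  by rewrite IH /opxi -(pair_fM (mod_pair M)).
have [B1 B2] := pair_fbilin (mod_pair M).
by rewrite E xip_l // (lin0 (B1 _)).
Qed.

(** xi is nilpotent: take the last nonzero vector among the xi^k m. *)
Lemma submod_xi_kernel (W : submodule M) : (W : {vspace M}) != 0%VS ->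
  exists m, [/\ m \in (W : {vspace M}), m != 0 & opxi m = 0].
Proof.
move=> W0; have := vpick0 (W : {vspace M}); rewrite (negbTE W0).
set m := vpick _ => /negbT m0.
have mW : m \in (W : {vspace M}) by exact: memv_pick.
have itW k : iter k (@opxi M) m \in (W : {vspace M}).
  by elim: k => [//|k IH] /=; apply: submod_opxi.
have ex : exists k, iter k (@opxi M) m == 0 by exists l; rewrite opxi_nilpotent.
case: (ex_minnP ex) => -[|k] /eqP E min; first by move: E m0 => /= ->; rewrite eqxx.
exists (iter k (@opxi M) m); split=> //.
by apply/negP => /min; rewrite ltnn.
Qed.

(** A lowest weight vector.  The exponent s is recorded up to a multiple of l
    only, and it may exceed l: this is what happens in a tensor product that is
    not completely reducible. *)
Record singular (beta : character K gT) (gam : gT) (s : nat) (w : M) : Prop :=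
  Singular {
  sing_g : forall g, opg g w = beta g *: w;
  sing_xi : opxi w = 0;
  sing_pi : forall f, oppi f w = f (u gam) *: w;
  sing_s : beta a = chi gam * q ^+ s }.

Definition xiter (k : nat) (w : M) : M := iter k (@opx M) w.

(** The scalar b_k of xi x^k w = b_k x^(k-1) w; the factor qint k is the
    q-number [k]. *)
Definition xi_coef (gam : gT) (s k : nat) : K :=
  chi gam * (qint chi a k * (1 - q ^+ s.+1 / q ^+ k)).

Lemma xi_coef0 gam s : xi_coef gam s 0 = 0.
Proof. by rewrite /xi_coef qint0 mul0r mulr0. Qed.

Lemma xi_coefS gam s k : xi_coef gam s k.+1 =
  xi_coef gam s k + chi gam * (q ^+ k - q ^+ s / q ^+ k).
Proof.
rewrite /xi_coef -mulrDr; congr (_ * _).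
have -> : q ^+ s.+1 / q ^+ k.+1 = q ^+ s / q ^+ k.
  by rewrite !exprS invfM mulrACA mulfV ?mul1r // char_neq0.
rewrite qintS exprS -mulrA; set Z := q ^+ s / q ^+ k; set A := qint _ _ k.
apply/eqP; rewrite -subr_eq0; apply/eqP.
transitivity (Z * (1 - q ^+ k - (1 - q) * A)); first by ring.
by rewrite qintE subrr mulr0.
Qed.

Lemma xi_coef_eq0 gam s k : (xi_coef gam s k == 0) = (l %| k)%N || (k == s.+1 %[mod l]).
Proof.
rewrite /xi_coef !mulf_eq0 (negbTE (char_neq0 chi gam)) /= (qint_eq0 _ prq l1).
congr (_ || _); rewrite subr_eq0 -(eq_prim_root_expr prq).
have q0 : q ^+ k != 0 by rewrite expf_neq0 // char_neq0.
by rewrite -[RHS](inj_eq (mulIf (invr_neq0 q0))) mulfV.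
Qed.

Lemma xi_coef_neq0 gam s k : (0 < k <= s)%N -> (s < l)%N -> xi_coef gam s k != 0.
Proof.
case/andP=> k0 ks sl; rewrite xi_coef_eq0 negb_or; apply/andP; split.
  by apply/negP => /(dvdn_leq k0); rewrite leqNgt (leq_ltn_trans ks).
rewrite -ltnS in ks; move: sl; rewrite leq_eqVlt => /orP[/eqP <-|sl].
  rewrite modnn modn_small // -?lt0n //.
by rewrite !modn_small ?(ltn_trans ks) // ltn_eqF.
Qed.

Section Singular.
Variables (beta : character K gT) (gam : gT) (s : nat) (w : M).
Hypothesis S : singular beta gam s w.
Local Notation wk k := (xiter k w).

Lemma sing_opg g k : opg g (wk k) = (beta g * chi g ^- k) *: wk k.
Proof.
elim: k => [|k IH] /=; first by rewrite expr0 invr1 mulr1 (sing_g S).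
rewrite opg_opx IH (linZ (@opx_lin M)) scalerA; congr (_ *: _).
by rewrite exprS invfM mulrCA.
Qed.

Lemma sing_oppi f k : oppi f (wk k) = f (u (a ^+ k * gam)%g) *: wk k.
Proof.
elim: k f => [|k IH] f /=; first by rewrite expg0 mul1g (sing_pi S).
by rewrite oppi_opx IH (linZ (@opx_lin M)) dual_ractE -hd_grpM mulgA -expgS.
Qed.

Lemma sing_opchi k : opchi (wk k) = (chi gam * q ^+ k) *: wk k.
Proof. by rewrite /opchi sing_oppi fr_chi_grp Defs.charM char_expn mulrC. Qed.

(** Each step from x^k w to x^(k+1) w adds to b_k the value of chi - a on
    x^k w, by [x, xi] = a - chi. *)
Lemma sing_opxi k : opxi (wk k) = xi_coef gam s k *: wk k.-1.
Proof.
elim: k => [|k IH]; first by rewrite xi_coef0 scale0r (sing_xi S).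
have := opx_opxi (wk k).
rewrite IH (linZ (@opx_lin M)) sing_opg sing_opchi (sing_s S).
have -> : xi_coef gam s k *: opx (wk k.-1) = xi_coef gam s k *: wk k.
  by case: (k) => [|//]; rewrite xi_coef0 !scale0r.
move=> E; have -> : opxi (wk k.+1) = xi_coef gam s k *: wk k
    - (chi gam * q ^+ s * q ^- k) *: wk k + (chi gam * q ^+ k) *: wk k.
  by rewrite E addrAC subrK addrK.
rewrite -scalerBl -scalerDl xi_coefS; congr (_ *: _).
by rewrite mulrBr mulrA addrAC [RHS]addrA.
Qed.
End Singular.

End OneModule.
End Modules.

Arguments opx {K gT chi a l H} D {M} _.
Arguments opg {K gT chi a l H} D {M} _ _.
Arguments opxi {K gT chi a l H D} F {M} _.
Arguments oppi {K gT chi a l H D} F {M} _ _.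
Arguments opchi {K gT chi a l H D} F {M} _.
Arguments xiter {K gT chi a l H} D {M} _ _.
Arguments singular {K gT chi a l H D} F {M} _ _ _ _.
Arguments opx_lin {K gT chi a l H} D M : rename.
Arguments opg_lin {K gT chi a l H} D M g : rename.
Arguments opxi_lin {K gT chi a l H D} F M : rename.
Arguments oppi_lin {K gT chi a l H D} F M f : rename.

(** * Strings: simple modules generated by a singular vector *)

Section Strings.
Variables (K : fieldType) (gT : finGroupType) (chi : character K gT) (a : gT).
Variables (l : nat) (H : hopfAlg K) (D : HD_structure chi a l H).
Variable F : hd_frame D.
Local Notation u := (hd_grp D).
Local Notation q := (chi a).
Hypotheses (prq : l.-primitive_root q) (l1 : (1 < l)%N).

Section OneString.
Variable M : ddmod H.
Implicit Types m w : M.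
Local Notation opx := (opx D).
Local Notation opg := (opg D).
Local Notation opxi := (opxi F).
Local Notation oppi := (oppi F).
Local Notation xiter := (xiter D).

(** The bottom vector w of a string w, x w, ..., x^s w. *)
Record string (beta : character K gT) (gam : gT) (s : nat) (w : M) : Prop :=
  String {
  str_sing : singular F beta gam s w;
  str_lt : (s < l)%N;
  str_neq0 : w != 0;
  str_end : xiter s.+1 w = 0 }.

Definition string_space (s : nat) (w : M) : {vspace M} :=
  <<mkseq (xiter^~ w) s.+1>>%VS.

Lemma xiter_in s w k : (k <= s)%N -> xiter k w \in string_space s w.
Proof. by move=> ks; apply/memv_span/mapP; exists k; rewrite ?mem_iota. Qed.

Lemma string_spaceP s w m :
  reflect (exists c : nat -> K, m = \sum_(k < s.+1) c k *: xiter k w)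
    (m \in string_space s w).
Proof.
apply: (iffP idP) => [/(coord_span (X := [tuple of mkseq (xiter^~ w) s.+1])) E|[c ->]].
  exists (fun k => coord [tuple of mkseq (xiter^~ w) s.+1] (inord k) m).
  by rewrite {1}E; apply: eq_bigr => i _; rewrite inord_val nth_mkseq.
by rewrite rpred_sum // => k _; rewrite rpredZ // xiter_in // -ltnS.
Qed.

Section Fixed.
Variables (beta : character K gT) (gam : gT) (s : nat) (w : M).
Hypothesis S : string beta gam s w.
Local Notation wk k := (xiter k w).
Local Notation b := (xi_coef chi a gam s).
Let S' : singular F beta gam s w := str_sing S.

Lemma string_coef_neq0 k : (0 < k <= s)%N -> b k != 0.
Proof. by move=> ks; apply: (xi_coef_neq0 prq l1) (str_lt S). Qed.

Lemma xiter_neq0 k : (k <= s)%N -> wk k != 0.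
Proof.
elim: k => [|k IH] ks; first exact: str_neq0 S.
apply/eqP => E; have := sing_opxi S' k.+1; rewrite E (lin0 (opxi_lin F M)) /=.
move=> /esym/eqP; rewrite scaler_eq0 (negbTE (string_coef_neq0 _)) //=.
by rewrite (negbTE (IH (ltnW ks))).
Qed.

Lemma xiter_gt k : (s < k)%N -> wk k = 0.
Proof.
move=> ks; rewrite -(subnK ks) /xiter iterD -[iter s.+1 _ _]/(xiter s.+1 w) (str_end S).
by elim: (k - _)%N => [//|n IH] /=; rewrite IH (lin0 (opx_lin D M)).
Qed.

Lemma chi_exp_inj i j : (i < l)%N -> (j < l)%N -> q ^+ i = q ^+ j -> i = j.
Proof.
by move=> il jl /eqP; rewrite (eq_prim_root_expr prq) !modn_small // => /eqP.
Qed.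

Lemma opchi_lin : lin (@opchi _ _ _ _ _ _ _ F M).
Proof. exact: oppi_lin. Qed.

(** The x^k w have the distinct chi-eigenvalues chi(gam) q^k. *)
Lemma xiter_free (c : nat -> K) : \sum_(k < s.+1) c k *: wk k = 0 ->
  forall k, (k <= s)%N -> c k = 0.
Proof.
move=> E k ks; have : c k *: wk k \in (0%VS : {vspace M}).
  apply: (eigen_separation (C := opchi F)
    (lam := fun k => chi gam * q ^+ k) (v := fun k => c k *: wk k) (n := s.+1)) => //.
  - exact: opchi_lin.
  - by move=> m; rewrite !memv0 => /eqP ->; rewrite (lin0 opchi_lin).
  - by move=> i _; rewrite (linZ opchi_lin) (sing_opchi S') !scalerA mulrC.
  - move=> i j il jl /(mulfI (char_neq0 _ _)); apply: chi_exp_inj;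
      exact: leq_trans (str_lt S).
  - by rewrite memv0 E.
by rewrite memv0 scaler_eq0 (negbTE (xiter_neq0 ks)) orbF => /eqP.
Qed.

Lemma dim_string : \dim (string_space s w) = s.+1.
Proof.
have /eqP -> : free [tuple of mkseq (fun k => wk k) s.+1]; last by rewrite size_mkseq.
apply/freeP => c E i; pose c' k := c (inord k).
have <- : c' i = c i by rewrite /c' inord_val.
apply: xiter_free => //; last by rewrite -ltnS.
by rewrite -[RHS]E; apply: eq_bigr => j _; rewrite nth_mkseq // /c' inord_val.
Qed.

Lemma string_stable d m : m \in string_space s w -> dd_act d m \in string_space s w.
Proof.
have stab (f : M -> M) : lin f -> (forall k, (k <= s)%N -> f (wk k) \in string_space s w) ->
    forall m, m \in string_space s w -> f m \in string_space s w.
  move=> L fW {}m /string_spaceP [c ->]; rewrite (lin_sum _ L) rpred_sum // => k _.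
  by rewrite (linZ L) rpredZ // fW // -ltnS.
apply: (stable_gen (F := F) prq l1) => {d m}.
- apply: stab; first exact: opx_lin.
  move=> k; rewrite leq_eqVlt => /orP[/eqP ->|ks]; last exact: (@xiter_in s w k.+1 ks).
  by rewrite -[opx _]/(xiter s.+1 w) (str_end S) mem0v.
- move=> g; apply: stab; first exact: opg_lin.
  by move=> k ks; rewrite (sing_opg S') rpredZ // xiter_in.
- apply: stab; first exact: opxi_lin.
  by move=> k ks; rewrite (sing_opxi S') rpredZ // xiter_in // (leq_trans (leq_pred _)).
- move=> f; apply: stab; first exact: oppi_lin.
  by move=> k ks; rewrite (sing_oppi S') rpredZ // xiter_in.
Qed.

Definition string_submod : submodule M := Submodule string_stable.

(** xi sends x^(k+1) w to a nonzero multiple of x^k w, and these are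
    independent, so only the multiples of w can be killed. *)
Lemma string_xi_kernel m : m \in string_space s w -> opxi m = 0 ->
  exists c, m = c *: w.
Proof.
case/string_spaceP => c ->; have L := opxi_lin F M.
rewrite (lin_sum _ L) => E; exists (c 0%N); rewrite big_ord_recl /=.
rewrite big1 ?addr0 // => i _; rewrite /bump /= add1n.
suff -> : c i.+1 = 0 by rewrite scale0r.
(* the coordinates of xi m *)
pose c' k := if (k < s)%N then c k.+1 * b k.+1 else 0.
have : c' i = 0.
  apply: xiter_free; last exact: ltnW.
  rewrite -[RHS]E [RHS]big_ord_recl big_ord_recr /= /c' ltnn scale0r addr0.
  rewrite (linZ L) (sing_xi S') scaler0 add0r.
  apply: eq_bigr => k _; rewrite ltn_ord (linZ L).
  rewrite -[opx _]/(xiter (val k).+1 w) (sing_opxi S') scalerA.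
  by rewrite /bump /= add1n.
rewrite /c' ltn_ord => /eqP; rewrite mulf_eq0 (negbTE (string_coef_neq0 _)) ?orbF.
  by move/eqP.
by rewrite /= ltn_ord.
Qed.

Lemma string_sub (W : submodule M) : w \in (W : {vspace M}) ->
  (string_space s w <= W)%VS.
Proof.
move=> wW; apply/subvP => m /string_spaceP [c ->]; apply: rpred_sum => k _.
rewrite rpredZ //; elim: (val k) => [//|n IH] /=; exact: submod_opx.
Qed.

(** A nonzero submodule meets ker xi, which is the line of w, and w
    generates. *)
Lemma string_simple : ddsimple string_submod.
Proof.
split=> [|W WU].
  by rewrite -dimv_eq0 dim_string.
have [->|W0] := eqVneq (W : {vspace M}) 0%VS; [by left | right].
apply/eqP; rewrite eqEsubv WU /=; apply: string_sub.
have [m [mW m0 xim]] := submod_xi_kernel F prq l1 W0.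
have [c E] := string_xi_kernel (subvP WU _ mW) xim.
move: mW m0; rewrite E scaler_eq0 rpredZeq => /orP[/eqP ->|//].
by rewrite eqxx.
Qed.

End Fixed.
End OneString.

Section FullString.
Variables (M : ddmod H) (beta : character K gT) (gam : gT) (s : nat) (w : M).
Hypothesis S : string beta gam s w.
Hypothesis full : string_space s w = fullv.
Local Notation wk k := (xiter D k w).
Local Notation b := (xi_coef chi a gam s).
Let S' : singular F beta gam s w := str_sing S.

(** Coordinates on the basis x^i w; they are 0 for i > s, so that formulas with
    neighbouring indices need no side conditions. *)
Definition scoord (i : nat) (m : M) : K^o :=
  if (i <= s)%N then coord [tuple of mkseq (fun k => wk k) s.+1] (inord i) m else 0.

Lemma scoord_lin i : lin (scoord i).
Proof.
by move=> c m m'; rewrite /scoord; case: ifP => _; rewrite ?linearP ?scaler0 ?addr0.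
Qed.

Lemma scoord_expand m : m = \sum_(i < s.+1) scoord i m *: wk i.
Proof.
have : m \in string_space s w by rewrite full memvf.
move/(coord_span (X := [tuple of mkseq (fun k => wk k) s.+1])) => {1}->.
apply: eq_bigr => i _; rewrite nth_mkseq // /scoord inord_val.
by rewrite -ltnS ltn_ord.
Qed.

Lemma scoord_gt i m : (s < i)%N -> scoord i m = 0.
Proof. by rewrite ltnNge /scoord => /negbTE ->. Qed.

Lemma scoord_xiter i k : (k <= s)%N -> scoord i (wk k) = (i == k)%:R.
Proof.
move=> ks; case: (leqP i s) => [is_|si]; last first.
  by rewrite scoord_gt // gtn_eqF // (leq_ltn_trans ks).
pose c j := scoord j (wk k) - (j == k)%:R.
apply/eqP; rewrite -subr_eq0; apply/eqP; rewrite -[LHS]/(c i).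
apply: (xiter_free S) is_; under eq_bigr do rewrite scalerBl.
rewrite sumrB -scoord_expand (bigD1 (Ordinal (ks : (k < s.+1)%N))) //=.
rewrite eqxx scale1r big1 ?addr0 ?subrr // => j nj.
by case: eqP => [E|_]; rewrite ?scale0r //; case/eqP: nj; apply: val_inj.
Qed.

Lemma full_string_ext (W : lmodType K) (f f' : M -> W) : lin f -> lin f' ->
  (forall k, (k <= s)%N -> f (wk k) = f' (wk k)) -> f =1 f'.
Proof.
move=> L L' E m; rewrite (scoord_expand m) (lin_sum _ L) (lin_sum _ L').
by apply: eq_bigr => i _; rewrite (linZ L) (linZ L') E // -ltnS.
Qed.

Lemma scoord_opg i g m :
  scoord i (opg D g m) = beta g * chi g ^- i * scoord i m.
Proof.
move: m; apply: full_string_ext.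
- by apply: lin_comp; [apply: scoord_lin | apply: opg_lin].
- by move=> c m m'; rewrite scoord_lin mulrDr scalerAr.
move=> k ks; rewrite (sing_opg S') (linZ (scoord_lin i)) !scoord_xiter //.
by case: eqP => [->|_] //; rewrite !mulr0 scaler0.
Qed.
Lemma scoord_oppi i f m :
  scoord i (oppi F f m) = f (u (a ^+ i * gam)%g) * scoord i m.
Proof.
move: m; apply: full_string_ext.
- by apply: lin_comp; [apply: scoord_lin | apply: oppi_lin].
- by move=> c m m'; rewrite scoord_lin mulrDr scalerAr.
move=> k ks; rewrite (sing_oppi S') (linZ (scoord_lin i)) !scoord_xiter //.
by case: eqP => [->|_] //; rewrite !mulr0 scaler0.
Qed.

Lemma scoord_opxi i m : scoord i (opxi F m) = b i.+1 * scoord i.+1 m.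
Proof.
move: m; apply: full_string_ext.
- by apply: lin_comp; [apply: scoord_lin | apply: opxi_lin].
- by move=> c m m'; rewrite scoord_lin mulrDr scalerAr.
move=> k ks; rewrite (sing_opxi S') (linZ (scoord_lin i)) !scoord_xiter //; last first.
  exact: leq_trans (leq_pred k) ks.
case: k ks => [|k] ks; first by rewrite xi_coef0 mulr0 scale0r.
by rewrite eqSS; case: eqP => [->|_] //; rewrite !mulr0 scaler0.
Qed.

Lemma scoord_opx i m : (i <= s)%N ->
  scoord i (opx D m) = if i is j.+1 then scoord j m else 0.
Proof.
move=> is_; move: m; apply: full_string_ext.
- by apply: lin_comp; [apply: scoord_lin | apply: opx_lin].
- by case: i is_ => [|i] is_ c m m'; rewrite ?scaler0 ?addr0 ?scoord_lin.
move=> k; rewrite leq_eqVlt => /orP[/eqP ->|ks].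
  rewrite -[opx D _]/(xiter D s.+1 w) (str_end S) (lin0 (scoord_lin i)).
  by case: i is_ => [|i] is_ //; rewrite scoord_xiter // ltn_eqF.
rewrite -[opx D _]/(xiter D k.+1 w) scoord_xiter //.
by case: i is_ => [|i] is_ //; rewrite scoord_xiter // ltnW.
Qed.

Section Hom.
Variables (N : ddmod H) (w' : N).
Hypothesis SN : string beta gam s w'.

(** The action of the generators on x^k w depends only on (beta, gam, s), so
    x^k w |-> x^k w' is a morphism. *)
Definition string_hom (m : M) : N := \sum_(k < s.+1) scoord k m *: xiter D k w'.

Lemma string_hom_lin : lin string_hom.
Proof.
move=> c m m'; rewrite /string_hom scaler_sumr -big_split; apply: eq_bigr => k _ /=.
by rewrite scoord_lin scalerDl scalerA.
Qed.

Lemma string_hom_xiter k : (k <= s)%N -> string_hom (wk k) = xiter D k w'.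
Proof.
move=> ks; rewrite /string_hom (bigD1 (Ordinal (ks : (k < s.+1)%N))) //=.
rewrite scoord_xiter // eqxx scale1r big1 ?addr0 // => j nj.
rewrite scoord_xiter //; case: eqP => [E|_]; last by rewrite scale0r.
by case/eqP: nj; apply: val_inj.
Qed.

Lemma string_hom_act d m : string_hom (dd_act d m) = dd_act d (string_hom m).
Proof.
have L := string_hom_lin.
have gen (f : M -> M) (f' : N -> N) : lin f -> lin f' ->
    (forall k, (k <= s)%N -> string_hom (f (wk k)) = f' (xiter D k w')) ->
    forall m, string_hom (f m) = f' (string_hom m).
  move=> Lf Lf' E {}m.
  move: m; apply: full_string_ext; [exact: lin_comp | exact: lin_comp |].
  by move=> k ks; rewrite E // string_hom_xiter.
have SN' := str_sing SN.
move: m; apply: (equivariant_gen (F := F) prq l1) => //.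
- apply: gen; [exact: opx_lin | exact: opx_lin |].
  move=> k; rewrite leq_eqVlt => /orP[/eqP ->|ks].
    rewrite -[opx D _]/(xiter D s.+1 w) -[RHS]/(xiter D s.+1 w') (str_end S) (str_end SN).
    exact: lin0.
  by rewrite -[opx D _]/(xiter D k.+1 w) string_hom_xiter.
- move=> g; apply: gen; [exact: opg_lin | exact: opg_lin |].
  move=> k ks; rewrite (sing_opg S') (sing_opg SN') (linZ L).
  by rewrite string_hom_xiter.
- apply: gen; [exact: opxi_lin | exact: opxi_lin |].
  move=> k ks; rewrite (sing_opxi S') (sing_opxi SN') (linZ L).
  by rewrite string_hom_xiter // (leq_trans (leq_pred k)).
- move=> f; apply: gen; [exact: oppi_lin | exact: oppi_lin |].
  move=> k ks; rewrite (sing_oppi S') (sing_oppi SN') (linZ L).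
  by rewrite string_hom_xiter.
Qed.

Lemma string_hom_in m : string_hom m \in string_space s w'.
Proof. by apply/string_spaceP; exists (scoord^~ m). Qed.

Lemma string_hom_inj m : string_hom m = 0 -> m = 0.
Proof.
move=> E; rewrite (scoord_expand m) big1 // => k _.
by rewrite (xiter_free SN (c := scoord^~ m) E) ?scale0r // -ltnS.
Qed.

Lemma string_hom_surj n : n \in string_space s w' -> exists m, string_hom m = n.
Proof.
case/string_spaceP => c ->; exists (\sum_(k < s.+1) c k *: wk k).
rewrite (lin_sum _ string_hom_lin); apply: eq_bigr => k _.
by rewrite (linZ string_hom_lin) string_hom_xiter // -ltnS.
Qed.

End Hom.
End FullString.
End Strings.

(** * The modules obtained from group-like elements are strings *)

Section BulletStrings.
Variables (K : fieldType) (gT : finGroupType) (chi : character K gT) (a : gT).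
Variables (l : nat) (H : hopfAlg K) (D : HD_structure chi a l H).
Variable F : hd_frame D.
Local Notation u := (hd_grp D).
Local Notation x := (hd_x D).
Local Notation q := (chi a).
Hypothesis abelG : abelian [set: gT].
Variables (ext : character K gT -> 'AHom(H, K^o)) (extP : is_extension D ext).
Variables (beta : character K gT) (gam : gT) (s : nat).
Hypothesis zE : beta a = chi gam * q ^+ s.
Hypothesis sl : (s < l)%N.
Local Notation M := (bullet_module (ext beta) (hd_grouplike D gam)).

Lemma abel_comm (g h : gT) : (g * h = h * g)%g.
Proof. by apply: (centsP abelG); rewrite inE. Qed.

Lemma val_hact h (m : M) : vsval (mod_hact h m) = bullet (ext beta) h (vsval m).
Proof.
rewrite [LHS]sub_actE [LHS](pair_actE (bullet_pair _)).
exact: (pair_f1 (bullet_pair (ext beta))).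
Qed.

Lemma val_fact f (m : M) : vsval (mod_fact f m) = coact f (vsval m).
Proof.
rewrite [LHS]sub_actE [LHS](pair_actE (bullet_pair _)).
by rewrite (pair_h1 (bullet_pair (ext beta))).
Qed.

Lemma bullet_grp g h : bullet (ext beta) (u g) h = beta g *: (u g * h * u g^-1%g).
Proof.
rewrite /bullet (sw3_grp D); last by lin.
by rewrite Tinv_grp (proj1 (extP beta)).
Qed.

(** The middle term of the iterated coproduct of x drops out, as beta(x) = 0. *)
Lemma bullet_x h : bullet (ext beta) x h =
  x * h - beta a *: (u a * h * (u a^-1%g * x)).
Proof.
rewrite /bullet (sw3_x D); last by lin.
rewrite Tinv_x Tinv_1 (proj2 (extP beta)) scale0r addr0 rmorph1 scale1r mulr1.
by rewrite (proj1 (extP beta)) mulrN scalerN addrC.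
Qed.

Lemma grp_in_bullet : u gam \in bullet_space (ext beta) (u gam).
Proof. by apply/bullet_spaceP; exists 1; rewrite bullet1. Qed.

Definition bullet_gen : M := Subvs grp_in_bullet.

(** The factor for i = s is 0, which is why the module stops at x^s. *)
Lemma val_xiter k : vsval (xiter D k bullet_gen) =
  (\prod_(i < k) (1 - q ^+ s / q ^+ i)) *: (x ^+ k * u gam).
Proof.
elim: k => [|k IH]; first by rewrite big_ord0 scale1r expr0 mul1r.
rewrite /= val_hact IH (linZ (proj2 (bullet_bilin _) _)) big_ord_recr /=.
rewrite -scalerA; congr (_ *: _); rewrite bullet_x scalerBl scale1r.
rewrite mulrA -exprS; congr (_ - _).
have -> : u a * (x ^+ k * u gam) * (u a^-1%g * x) =
    (q ^+ k * chi gam)^-1 *: (x ^+ k.+1 * u gam).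
  have E : u a * u gam * u a^-1%g = u gam.
    by rewrite -!hd_grpM [(a * gam)%g]abel_comm -mulgA mulgV mulg1.
  rewrite !mulrA grp_xk -!scalerAl -(mulrA _ (u a)) -(mulrA _ (u a * u gam)) E.
  rewrite -mulrA -[u gam * x]scale1r -(mulVf (char_neq0 chi gam)) -scalerA.
  by rewrite -hd_xg -scalerAr scalerA invfM mulrA -exprSr.
rewrite scalerA; congr (_ *: _); rewrite zE invfM.
by rewrite [_^-1 * _^-1]mulrC mulrACA divff ?mul1r // char_neq0.
Qed.

Lemma bullet_string : string F beta gam s bullet_gen.
Proof.
split=> //.
- split=> //.
  + move=> g; apply: val_inj; rewrite /= val_hact bullet_grp /= -!hd_grpM.
    by rewrite abel_comm mulgA mulVg mul1g.
  + apply: val_inj; rewrite /= val_fact /= /coact (sw2_grp D); last by lin.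
    by rewrite fr_xi_grp scale0r.
  + move=> f; apply: val_inj; rewrite /= val_fact /= /coact (sw2_grp D); last by lin.
    by rewrite dpi_grp.
- by apply/eqP => /(congr1 vsval) /=; apply/eqP; apply: grp_neq0.
- apply: val_inj; rewrite /= -[RHS]/(0 : H) -[LHS]/(vsval (xiter D s.+1 bullet_gen)).
  rewrite val_xiter big_ord_recr /= divff ?subrr ?mulr0 ?scale0r //.
  by rewrite expf_neq0 // char_neq0.
Qed.

Lemma bullet_full : string_space D s bullet_gen = fullv.
Proof.
apply/eqP; rewrite eqEsubv subvf /=; apply/subvP => m _.
have /bullet_spaceP [h E] := subvsP m.
have -> : m = mod_hact h bullet_gen by apply: val_inj; rewrite [LHS]E [RHS]val_hact.
have L : lin (fun h => mod_hact h bullet_gen).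
  exact: (proj1 (pair_hbilin (mod_pair M)) bullet_gen).
elim/(hd_span_ind (D := D)): h {E} => [b h k E1 E2|g k].
  by rewrite L rpredD // rpredZ.
rewrite (pair_hM (mod_pair M)) -[mod_hact (u g) _]/(opg D g _).
have -> : mod_hact (x ^+ k) bullet_gen = xiter D k bullet_gen.
  elim: k => [|k IH]; first by rewrite expr0 (pair_h1 (mod_pair M)).
  by rewrite exprS (pair_hM (mod_pair M)) IH.
rewrite (sing_opg (str_sing bullet_string)) rpredZ //.
case: (leqP k s) => ks; first exact: (xiter_in D bullet_gen ks).
by rewrite (xiter_gt bullet_string ks) mem0v.
Qed.

End BulletStrings.

(** * The tensor product of two strings *)

Section CharacterGroup.
Variables (K : fieldType) (gT : finGroupType).
Implicit Types psi phi : character K gT.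

Lemma char_mulE psi phi g : (psi * phi)%g g = psi g * phi g.
Proof. by rewrite ffunE. Qed.

Lemma char_invE psi g : (psi^-1)%g g = (psi g)^-1.
Proof. by rewrite ffunE. Qed.

Lemma char_powE psi g n : (psi ^+ n)%g g = psi g ^+ n.
Proof.
elim: n => [|n IH]; first by rewrite expg0 ffunE.
by rewrite expgS char_mulE IH exprS.
Qed.

End CharacterGroup.

Section TensorStrings.
Variables (K : fieldType) (gT : finGroupType) (chi : character K gT) (a : gT).
Variables (l : nat) (H : hopfAlg K) (D : HD_structure chi a l H).
Variable F : hd_frame D.
Local Notation u := (hd_grp D).
Local Notation q := (chi a).
Local Notation xi := (fr_xi F).
Hypotheses (prq : l.-primitive_root q) (l1 : (1 < l)%N).

Lemma dual_comul_xi :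
  dual_comul xi = tens xi (fr_chi F) + tens (dual1 H) xi.
Proof.
apply: dtens_ext => h k.
by rewrite dual_comulE (linD (pairing_lin h k)) !pairing_tens fr_xi_M addrC.
Qed.

(** The projection is an algebra map, so composing with it respects the
    coproduct of the dual. *)
Lemma dual_comul_dpi (W : lmodType K) (G : dual H -> dual H -> W) f : bilin G ->
  tlift G (dual_comul (dpi F f)) =
  tlift (fun f1 f2 => G (dpi F f1) (dpi F f2)) (dual_comul f).
Proof.
move=> B; have Lp := dpi_lin F.
transitivity (tlift G (tlift (fun f1 f2 =>
   tens (dpi F f1) (dpi F f2)) (dual_comul f))).
  congr (tlift G _); apply: dtens_ext => h k.
  rewrite dual_comulE dpiE rmorphM /= pairing_tlift -dual_comulE.
  by apply: eq_tlift => f1 f2; rewrite pairing_tens !dpiE.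
rewrite (tlift_push _ _ (tlift_lin G)).
by apply: eq_tlift => f1 f2; rewrite tliftE.
Qed.

Variables M N : ddmod H.
Local Notation T := (ddtens M N).

Lemma tens_hact h (t : T) : mod_hact h t = ddtens_h h t.
Proof. by rewrite /mod_hact /= ddtens_actE (pair_f1 (ddtens_pair M N)). Qed.

Lemma tens_fact f (t : T) : mod_fact f t = ddtens_f f t.
Proof. by rewrite /mod_fact /= ddtens_actE (pair_h1 (ddtens_pair M N)). Qed.

Lemma bilin_hactM : bilin (@mod_hact K H M). Proof. exact: pair_hbilin (mod_pair M). Qed.
Lemma bilin_hactN : bilin (@mod_hact K H N). Proof. exact: pair_hbilin (mod_pair N). Qed.
Lemma bilin_factM : bilin (@mod_fact K H M). Proof. exact: pair_fbilin (mod_pair M). Qed.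
Lemma bilin_factN : bilin (@mod_fact K H N). Proof. exact: pair_fbilin (mod_pair N). Qed.

Lemma opg_tens g (m : M) (n : N) :
  opg D g (tens m n : T) = tens (opg D g m) (opg D g n).
Proof.
have BM := bilin_hactM; have BN := bilin_hactN.
by rewrite [LHS]tens_hact ddtens_hE (sw2_grp D) //; lin.
Qed.

Lemma opx_tens (m : M) (n : N) :
  opx D (tens m n : T) = tens (opx D m) (opg D a n) + tens m (opx D n).
Proof.
have BM := bilin_hactM; have BN := bilin_hactN.
rewrite [LHS]tens_hact ddtens_hE (sw2_x D); last by lin.
by rewrite (pair_h1 (mod_pair M)).
Qed.

Lemma opxi_tens (m : M) (n : N) :
  opxi F (tens m n : T) = tens (opchi F m) (opxi F n) + tens (opxi F m) n.
Proof.
have BM := bilin_factM; have BN := bilin_factN.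
rewrite [LHS]tens_fact ddtens_fE dual_comul_xi (linD (tlift_lin _)).
rewrite !tliftE; try by lin.
by rewrite (pair_f1 (mod_pair N)) opchiE.
Qed.

Lemma oppi_tens f (m : M) (n : N) : oppi F f (tens m n : T) =
  tlift (fun f1 f2 => tens (oppi F f2 m) (oppi F f1 n)) (dual_comul f).
Proof.
have BM := bilin_factM; have BN := bilin_factN.
rewrite [LHS]tens_fact ddtens_fE dual_comul_dpi //; lin.
Qed.

Variables (beta beta' : character K gT) (gam gam' : gT) (r r' : nat) (v : M) (v' : N).
Hypotheses (SM : string F beta gam r v) (SN : string F beta' gam' r' v').
Hypotheses (fullM : string_space D r v = fullv) (fullN : string_space D r' v' = fullv).
Local Notation b := (xi_coef chi a gam r).
Local Notation b' := (xi_coef chi a gam' r').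
Local Notation vk i := (xiter D i v).
Local Notation vk' j := (xiter D j v').

(** Coordinates of the tensor product on the vectors x^i v (x) x^j v', again 0
    outside the rectangle. *)
Definition tcoord (i j : nat) (t : T) : K^o :=
  tlift (fun m n => scoord D r v i m * scoord D r' v' j n) t.

Lemma tcoord_lin i j : lin (tcoord i j).
Proof. exact: tlift_lin. Qed.

Lemma tcoord_tens i j m n :
  tcoord i j (tens m n) = scoord D r v i m * scoord D r' v' j n.
Proof.
rewrite /tcoord tliftE //; split=> [n'|m'] c y z; rewrite scoord_lin.
  by rewrite mulrDl -scalerAl.
by rewrite mulrDr -scalerAr.
Qed.

Lemma tcoord_gtl i j t : (r < i)%N -> tcoord i j t = 0.
Proof.
move=> ri; rewrite /tcoord /tlift big1 // => k _; rewrite big1 // => k' _.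
by rewrite scoord_gt // mul0r scaler0.
Qed.

Lemma tcoord_gtr i j t : (r' < j)%N -> tcoord i j t = 0.
Proof.
move=> rj; rewrite /tcoord /tlift big1 // => k _; rewrite big1 // => k' _.
by rewrite [X in _ * X]scoord_gt // mulr0 scaler0.
Qed.

Definition tmk (c : nat -> nat -> K) : T :=
  \sum_(i < r.+1) \sum_(j < r'.+1) c i j *: (tens (vk i) (vk' j) : T).

Lemma tcoord_tmk c i j : (i <= r)%N -> (j <= r')%N -> tcoord i j (tmk c) = c i j.
Proof.
move=> ir jr; have L := tcoord_lin i j; rewrite /tmk (lin_sum _ L).
have E k k' : (k <= r)%N -> (k' <= r')%N ->
    tcoord i j (c k k' *: tens (vk k) (vk' k')) =
    c k k' * ((i == k)%:R * (j == k')%:R).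
  move=> kr kr'; rewrite (linZ L) tcoord_tens.
  by rewrite (scoord_xiter prq l1 SM) // (scoord_xiter prq l1 SN).
rewrite (bigD1 (Ordinal (ir : (i < r.+1)%N))) //= [X in _ + X]big1 ?addr0; last first.
  move=> k nk; rewrite (lin_sum _ L) big1 // => k' _.
  rewrite E -1?ltnS //; case: eqP => [ik|_]; last by rewrite mul0r mulr0.
  by case/eqP: nk; apply: val_inj.
rewrite (lin_sum _ L) (bigD1 (Ordinal (jr : (j < r'.+1)%N))) //=.
rewrite big1 ?addr0; last first.
  move=> k nk; rewrite E -1?ltnS //; case: (j =P _) => [ik|_]; last by rewrite !mulr0.
  by case/eqP: nk; apply: val_inj.
by rewrite E // !eqxx !mulr1.
Qed.

Lemma tcoord_expand t : t = tmk (fun i j => tcoord i j t).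
Proof.
move: t; apply: tensor_ext => [//||m n].
  move=> c s t; rewrite /tmk scaler_sumr -big_split; apply: eq_bigr => i _ /=.
  rewrite scaler_sumr -big_split; apply: eq_bigr => j _ /=.
  by rewrite tcoord_lin scalerDl scalerA.
have [B1 B2] := tens_bilin M N.
rewrite {1}(scoord_expand fullM m) (lin_sum _ (B1 n)); apply: eq_bigr => i _.
rewrite (linZ (B1 n)) {1}(scoord_expand fullN n) (lin_sum _ (B2 _)) scaler_sumr.
by apply: eq_bigr => j _; rewrite (linZ (B2 _)) scalerA tcoord_tens.
Qed.

Lemma tcoord_ext s t : (forall i j, (i <= r)%N -> (j <= r')%N ->
  tcoord i j s = tcoord i j t) -> s = t.
Proof.
move=> E; rewrite (tcoord_expand s) (tcoord_expand t).
apply: eq_bigr => i _; apply: eq_bigr => j _; congr (_ *: _).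
by apply: E; rewrite -ltnS.
Qed.

Lemma tcoord0 i j : tcoord i j 0 = 0.
Proof. exact: lin0 (tcoord_lin i j). Qed.

Lemma tcoord_opg i j g t : tcoord i j (opg D g t) =
  beta g * beta' g * chi g ^- (i + j) * tcoord i j t.
Proof.
move: t; apply: tensor_ext => [||m n].
- exact: (lin_comp (tcoord_lin i j) (opg_lin D T g)).
- by move=> c s t; rewrite tcoord_lin mulrDr scalerAr.
rewrite opg_tens !tcoord_tens (scoord_opg prq l1 SM fullM) (scoord_opg prq l1 SN fullN).
rewrite exprD invfM; ring.
Qed.

Lemma tcoord_opx i j t : (i <= r)%N -> (j <= r')%N -> tcoord i j (opx D t) =
  (if i is i'.+1 then beta' a * q ^- j * tcoord i' j t else 0) +
  (if j is j'.+1 then tcoord i j' t else 0).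
Proof.
move=> ir jr; move: t; apply: tensor_ext => [||m n].
- exact: (lin_comp (tcoord_lin i j) (opx_lin D T)).
- move=> c s t; case: i {ir} => [|i]; case: j {jr} => [|j];
    rewrite ?(addr0, add0r) ?scaler0 ?addr0 ?tcoord_lin //.
    by rewrite mulrDr scalerAr.
  by rewrite mulrDr scalerDr !scalerAr addrACA.
rewrite opx_tens (linD (tcoord_lin i j)) !tcoord_tens.
rewrite (scoord_opx prq l1 SM fullM) // (scoord_opx prq l1 SN fullN) //.
rewrite (scoord_opg prq l1 SN fullN); congr (_ + _).
  by case: i ir => [|i] ir; rewrite ?mul0r // tcoord_tens; ring.
by case: j jr => [|j] jr; rewrite ?mulr0 // tcoord_tens.
Qed.

Lemma tcoord_opxi i j t : tcoord i j (opxi F t) =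
  chi gam * q ^+ i * b' j.+1 * tcoord i j.+1 t + b i.+1 * tcoord i.+1 j t.
Proof.
move: t; apply: tensor_ext => [||m n].
- exact: (lin_comp (tcoord_lin i j) (opxi_lin F T)).
- by move=> c s t; rewrite !tcoord_lin !mulrDr scalerDr !scalerAr addrACA.
rewrite opxi_tens (linD (tcoord_lin i j)) !tcoord_tens.
rewrite (scoord_opxi prq l1 SM fullM) (scoord_opxi prq l1 SN fullN).
rewrite (scoord_oppi prq l1 SM fullM) fr_chi_grp Defs.charM char_expn.
congr (_ + _); ring.
Qed.

Local Notation mn := (minn r r').
Local Notation tc := tcoord.

Let bM_neq0 i : (0 < i <= r)%N -> b i != 0.
Proof. exact: (string_coef_neq0 prq l1 SM). Qed.
Let bN_neq0 i : (0 < i <= r')%N -> b' i != 0.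
Proof. exact: (string_coef_neq0 prq l1 SN). Qed.

Let mu i : chi gam * q ^+ i != 0.
Proof. by rewrite mulf_neq0 ?expf_neq0 // char_neq0. Qed.

(** Degrees, rather than chi-eigenspaces: the eigenvalue knows the degree only
    modulo l, and degrees run up to r + r', which may be l or more. *)
Definition homog (n : nat) (t : T) : Prop :=
  forall i j, (i + j)%N != n -> tc i j t = 0.

Lemma homog_opx n t : homog n t -> homog n.+1 (opx D t).
Proof.
move=> ht i j ijn; case: (leqP i r) => ir; last exact: tcoord_gtl.
case: (leqP j r') => jr; last exact: tcoord_gtr.
rewrite tcoord_opx //.
case: i ir ijn => [|i] ir ijn; case: j jr ijn => [|j] jr ijn;
  rewrite ?ht ?mulr0 ?addr0 //; lia.
Qed.

Lemma homog_opg n t : homog n t -> forall g,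
  opg D g t = (beta g * beta' g * chi g ^- n) *: t.
Proof.
move=> ht g; apply: tcoord_ext => i j ir jr.
rewrite tcoord_opg (linZ (tcoord_lin i j)).
by case: (eqVneq (i + j)%N n) => [<- //|ne]; rewrite ht // mulr0 scaler0.
Qed.

(** If x t = 0, neighbouring coordinates of t of the same degree are
    proportional.  In a degree below r' they are proportional to a coordinate
    (0, j) with j < r', which vanishes because nothing else contributes to
    (0, j + 1); in a degree below r use (i, 0) instead. *)
Lemma opx_injective n t : homog n t -> (n < maxn r r')%N -> opx D t = 0 -> t = 0.
Proof.
move=> ht nm E.
have rel i j : (i <= r)%N -> (j <= r')%N ->
    (if i is i'.+1 then beta' a * q ^- j * tc i' j t else 0) +
    (if j is j'.+1 then tc i j' t else 0) = 0.
  by move=> ir jr; rewrite -tcoord_opx // E tcoord0.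
have c0 j : beta' a * q ^- j != 0.
  by rewrite mulf_neq0 ?invr_neq0 ?expf_neq0 // char_neq0.
apply: tcoord_ext => i j ir jr; rewrite tcoord0.
case: (eqVneq (i + j)%N n) => [ijn|]; last exact: ht.
have : (i + j < maxn r r')%N by rewrite ijn.
rewrite leq_max => /orP[].
- elim: j i ir jr {ijn} => [|j IH] i ir jr lt.
    have := rel i.+1 0%N; rewrite addr0 => /(_ _ isT) /eqP.
    by rewrite mulf_eq0 (negbTE (c0 _)) /= => E0; apply/eqP/E0; lia.
  have ir' : (i < r)%N by lia.
  have := rel i.+1 j.+1 ir' jr; rewrite (IH i.+1) ?addr0 //; try lia.
  by move/eqP; rewrite mulf_eq0 (negbTE (c0 _)) => /eqP.
elim: i j ir jr {ijn} => [|i IH] j ir jr lt.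
  by have := rel 0%N j.+1 isT; rewrite add0r => -> //; lia.
have jr' : (j < r')%N by lia.
by have := rel i.+1 j.+1 ir jr'; rewrite (IH j.+1) ?mulr0 ?add0r //; lia.
Qed.

Section Kernel.
Variable t : T.
Hypothesis xit : opxi F t = 0.

Let rel i j : chi gam * q ^+ i * b' j.+1 * tc i j.+1 t + b i.+1 * tc i.+1 j t = 0.
Proof. by rewrite -tcoord_opxi xit tcoord0. Qed.

Let rel_up i j : (j < r')%N -> tc i.+1 j t = 0 -> tc i j.+1 t = 0.
Proof.
move=> jr E; have := rel i j; rewrite E mulr0 addr0 => /eqP.
by rewrite -mulrA mulf_eq0 (negbTE (mu i)) mulf_eq0 (negbTE (bN_neq0 _)) //= => /eqP.
Qed.

Let rel_down i j : (i < r)%N -> tc i j.+1 t = 0 -> tc i.+1 j t = 0.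
Proof.
move=> ir E; have := rel i j; rewrite E mulr0 add0r => /eqP.
by rewrite mulf_eq0 (negbTE (bM_neq0 _)) //= => /eqP.
Qed.

(** In a degree above r or above r', the recursion leads out of the
    rectangle. *)
Lemma xi_kernel_support i j : (mn < i + j)%N -> tc i j t = 0.
Proof.
rewrite gtn_min => /orP[]; last first.
  elim: i j => [|i IH] j lt; first exact: tcoord_gtr.
  case: (leqP i.+1 r) => ir; last exact: tcoord_gtl.
  by apply: rel_down => //; apply: IH; lia.
elim: j i => [|j IH] i lt; first by apply: tcoord_gtl; lia.
case: (leqP j.+1 r') => jr; last exact: tcoord_gtr.
by apply: rel_up => //; apply: IH; lia.
Qed.

(** By the recursion the column j = 0 determines all coordinates. *)
Lemma xi_kernel_eq0 : (forall n, (n <= mn)%N -> tc n 0 t = 0) -> t = 0.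
Proof.
move=> E; apply: tcoord_ext => i j ir jr; rewrite tcoord0.
elim: j i ir jr => [|j IH] i ir jr.
  case: (leqP i mn) => im; first exact: E.
  by apply: xi_kernel_support; rewrite addn0.
apply: rel_up => //; case: (leqP i.+1 r) => ir'; last exact: tcoord_gtl.
by apply: IH => //; lia.
Qed.

End Kernel.

(** The solution of the recursion expressing xi t = 0 whose coordinate at
    (n, 0) is 1. *)
Fixpoint low_coef (j i : nat) : K :=
  if j is j'.+1 then - (b i.+1 / (chi gam * q ^+ i * b' j)) * low_coef j' i.+1
  else 1.

Definition low (n : nat) : T :=
  tmk (fun i j => if (i + j)%N == n then low_coef j i else 0).

Lemma tcoord_low n i j : (n <= mn)%N ->
  tc i j (low n) = if (i + j)%N == n then low_coef j i else 0.
Proof.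
rewrite leq_min => /andP[nr nr'].
case: (leqP i r) => ir; last by rewrite tcoord_gtl //; case: eqP => //; lia.
case: (leqP j r') => jr; last by rewrite tcoord_gtr //; case: eqP => //; lia.
exact: tcoord_tmk.
Qed.

Lemma homog_low n : (n <= mn)%N -> homog n (low n).
Proof. by move=> nm i j ne; rewrite tcoord_low // (negbTE ne). Qed.

Lemma tcoord_low0 n k : (n <= mn)%N -> tc k 0 (low n) = (k == n)%:R.
Proof. by move=> nm; rewrite tcoord_low // addn0; case: eqP. Qed.

Lemma low_neq0 n : (n <= mn)%N -> low n != 0.
Proof.
move=> nm; apply/eqP => E; have := tcoord_low0 n nm.
by rewrite E tcoord0 eqxx => /esym/eqP; rewrite oner_eq0.
Qed.

Lemma opxi_low n : (n <= mn)%N -> opxi F (low n) = 0.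
Proof.
move=> nm; apply: tcoord_ext => i j ir jr; rewrite tcoord0.
rewrite tcoord_opxi !tcoord_low // addSnnS.
case: eqP => [E|_]; last by rewrite !mulr0 addr0.
have jr' : (0 < j.+1 <= r')%N by move: nm; rewrite leq_min; lia.
have d0 := mulf_neq0 (mu i) (bN_neq0 jr').
by rewrite /= mulrA mulrN mulrCA mulfV // mulr1 mulNr addNr.
Qed.

Lemma xi_kernel_expand t : opxi F t = 0 -> t = \sum_(n < mn.+1) (tc n 0 t : K) *: low n.
Proof.
move=> xit; apply/eqP; rewrite -subr_eq0; apply/eqP.
have LT := tcoord_lin.
apply: xi_kernel_eq0 => [|n nm].
  rewrite -scaleN1r addrC (opxi_lin F T) xit addr0 (lin_sum _ (opxi_lin F T)).
  rewrite big1 ?scaler0 // => k _; rewrite (linZ (opxi_lin F T)) opxi_low ?scaler0 //.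
  by rewrite -ltnS.
rewrite -scaleN1r addrC LT (lin_sum _ (LT _ _)).
rewrite (bigD1 (Ordinal (nm : (n < mn.+1)%N))) //= big1 ?addr0.
  by rewrite (linZ (LT _ _)) tcoord_low0 // eqxx [_ *: 1]mulr1 scaleN1r addNr.
move=> k nk; rewrite (linZ (LT _ _)) tcoord_low0 -1?ltnS //.
case: eqP => [E|_]; last by rewrite scaler0.
by case/eqP: nk; apply: val_inj.
Qed.

Hypothesis abelG : abelian [set: gT].

Lemma tcoord_oppi i j f t : tcoord i j (oppi F f t) =
  f (u (gam * gam' * a ^+ (i + j))%g) * tcoord i j t.
Proof.
move: t; apply: tensor_ext => [||m n].
- exact: (lin_comp (tcoord_lin i j) (oppi_lin F T f)).
- by move=> c s t; rewrite tcoord_lin mulrDr scalerAr.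
rewrite oppi_tens (tlift_push _ _ (tcoord_lin i j)).
have -> : (gam * gam' * a ^+ (i + j) = (a ^+ j * gam') * (a ^+ i * gam))%g.
  rewrite expgD (abel_comm abelG (a ^+ j * gam')%g) (abel_comm abelG (a ^+ i)%g gam).
  rewrite (abel_comm abelG (a ^+ j)%g gam') -!mulgA; congr (_ * _)%g.
  by rewrite !mulgA (abel_comm abelG gam').
rewrite hd_grpM -dual_comulE /pairing.
rewrite [RHS](tlift_push (L := fun z : K^o => z * tcoord i j (tens m n))); last first.
  by move=> c y z; rewrite mulrDl scalerAl.
apply: eq_tlift => f1 f2; rewrite !tcoord_tens.
rewrite (scoord_oppi prq l1 SM fullM) (scoord_oppi prq l1 SN fullN); ring.
Qed.

Lemma homog_oppi n t : homog n t -> forall f,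
  oppi F f t = f (u (gam * gam' * a ^+ n)%g) *: t.
Proof.
move=> ht f; apply: tcoord_ext => i j ir jr.
rewrite tcoord_oppi (linZ (tcoord_lin i j)).
by case: (eqVneq (i + j)%N n) => [<- //|ne]; rewrite ht // mulr0 scaler0.
Qed.

Definition low_char (n : nat) : character K gT := (chi ^- n * beta * beta')%g.
Definition low_grp (n : nat) : gT := (gam * gam' * a ^+ n)%g.
Definition low_len (n : nat) : nat := (r + r' - 2 * n)%N.

Lemma low_charE n g : low_char n g = beta g * beta' g * chi g ^- n.
Proof.
rewrite /low_char char_mulE char_mulE char_invE char_powE.
by rewrite -mulrA mulrC.
Qed.

(** The exponent comes from beta(a) beta'(a) q^-n = chi(gam gam' a^n) q^s with
    s = r + r' - 2n. *)
Lemma singular_low n : (n <= mn)%N ->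
  singular F (low_char n) (low_grp n) (low_len n) (low n).
Proof.
move=> nm; have hn := homog_low nm; split.
- by move=> g; rewrite (homog_opg hn) low_charE.
- exact: opxi_low.
- by move=> f; rewrite (homog_oppi hn).
rewrite low_charE /low_grp !Defs.charM char_expn.
rewrite (sing_s (str_sing SM)) (sing_s (str_sing SN)).
have q0 k : q ^+ k != 0 by rewrite expf_neq0 // char_neq0.
apply: (mulIf (q0 n)); rewrite mulfVK // -!mulrA -!exprD /low_len.
rewrite [q ^+ r * _]mulrCA -exprD; congr (_ * (_ * q ^+ _)).
by move: nm; rewrite leq_min; lia.
Qed.

Lemma homog_xiter n k : (n <= mn)%N -> homog (n + k) (xiter D k (low n)).
Proof.
move=> nm; elim: k => [|k IH]; first by rewrite addn0; apply: homog_low.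
by rewrite addnS; apply: homog_opx.
Qed.

(** This says low_len n < l, in a form without truncated subtraction. *)
Definition simple_low (n : nat) : bool := (r + r' < l + 2 * n)%N.

(** x^(s+1) (low n) lies in ker xi, in the degree r + r' - n + 1, which is
    above min(r, r'). *)
Lemma string_low n : (n <= mn)%N -> simple_low n ->
  string F (low_char n) (low_grp n) (low_len n) (low n).
Proof.
move=> nm good; have S := singular_low nm; split=> //.
- by move: good nm; rewrite /simple_low /low_len leq_min; lia.
- exact: low_neq0.
apply: xi_kernel_eq0 => [|k km].
  rewrite (sing_opxi S).
  have /eqP -> : xi_coef chi a (low_grp n) (low_len n) (low_len n).+1 == 0.
    by rewrite (xi_coef_eq0 prq l1) eqxx orbT.
  by rewrite scale0r.
apply: (homog_xiter (k := (low_len n).+1) nm); move: nm km.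
rewrite !leq_min /low_len; lia.
Qed.

(** With k = s + 1 - l the vector x^k (low n) lies in ker xi since k = s + 1
    modulo l.  Its degree n + k is at most min(r, r') because r and r' are
    smaller than l, so it is a multiple of [low (n + k)]; and x is injective in
    the degrees below n + k. *)
Lemma non_simple_low n : (n <= mn)%N -> ~~ simple_low n ->
  exists k n' (c : K), [/\ (n' <= mn)%N, simple_low n', c != 0 &
    xiter D k (low n) = c *: low n'].
Proof.
move=> nm; rewrite /simple_low -leqNgt => bad.
have rl := str_lt SM; have rl' := str_lt SN.
have [nr nr'] : (n <= r)%N /\ (n <= r')%N by apply/andP; rewrite -leq_min.
(* the smallest k with b_k = 0 *)
pose k := ((low_len n).+1 - l)%N; pose n' := (n + k)%N.
have n'm : (n' <= mn)%N by rewrite leq_min /n' /k /low_len; lia.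
have nz i : (i <= k)%N -> xiter D i (low n) != 0.
  elim: i => [|i IH] ik; first exact: low_neq0.
  apply: contra (IH (ltnW ik)) => /eqP E; apply/eqP.
  apply: opx_injective (homog_xiter (k := i) nm) _ E.
  by rewrite leq_max; move: ik n'm; rewrite /n' leq_min; lia.
have xi0 : opxi F (xiter D k (low n)) = 0.
  rewrite (sing_opxi (singular_low nm)).
  have /eqP -> : xi_coef chi a (low_grp n) (low_len n) k == 0; last by rewrite scale0r.
  rewrite (xi_coef_eq0 prq l1); apply/orP; right.
  have -> : (low_len n).+1 = (k + l)%N by rewrite /k subnK // /low_len; lia.
  by rewrite modnDr.
have hk := homog_xiter (k := k) nm.
have E : xiter D k (low n) = (tc n' 0 (xiter D k (low n)) : K) *: low n'.
  rewrite {1}(xi_kernel_expand xi0) (bigD1 (Ordinal (n'm : (n' < mn.+1)%N))) //=.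
  rewrite big1 ?addr0 // => j nj; rewrite hk ?scale0r // addn0.
  by apply: contra nj => /eqP E; apply/eqP/val_inj.
exists k, n', (tc n' 0 (xiter D k (low n))); split=> //.
  by rewrite /simple_low /n' /k /low_len; lia.
by apply: contra (nz k (leqnn k)) => /eqP c0; rewrite E c0 scale0r.
Qed.

(** Separate the components of a vector of ker xi by their chi-eigenvalues
    chi(gam gam') q^n, which are distinct for n <= min(r, r') < l. *)
Lemma submod_low (W : submodule T) : (W : {vspace T}) != 0%VS ->
  exists n, [/\ (n <= mn)%N, simple_low n & low n \in (W : {vspace T})].
Proof.
move=> W0; have [m [mW m0 xim]] := submod_xi_kernel F prq l1 W0.
have E := xi_kernel_expand xim.
have inW n : (n <= mn)%N -> (tc n 0 m : K) *: low n \in (W : {vspace T}).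
  move=> nm; apply: (eigen_separation (C := @opchi _ _ _ _ _ _ _ F T)
    (lam := fun k => chi (gam * gam')%g * q ^+ k)
    (v := fun k => (tc k 0 m : K) *: low k) (n := mn.+1)) => //.
  - exact: oppi_lin.
  - by move=> w wW; apply: sub_stable.
  - move=> k km; rewrite scalerA mulrC -scalerA.
    transitivity ((tc k 0 m : K) *: oppi F (fr_chi F) (low k)).
      exact: (linZ (oppi_lin F T _)).
    rewrite (homog_oppi (homog_low (km : (k <= mn)%N))) fr_chi_grp.
    by rewrite Defs.charM char_expn.
  - move=> i j im jm /(mulfI (char_neq0 _ _)).
    have rl := str_lt SM.
    by apply: (chi_exp_inj prq); move: im jm; rewrite !ltnS !leq_min; lia.
  - by rewrite -E.
have [n nm cn] : exists2 n, (n <= mn)%N & tc n 0 m != 0.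
  case: (pickP (fun n : 'I_mn.+1 => tc n 0 m != 0)) => [n cn|all0].
    by exists n => //; rewrite -ltnS.
  case/eqP: m0; rewrite E big1 // => n _.
  by have /negbFE/eqP -> := all0 n; rewrite scale0r.
have lW : low n \in (W : {vspace T}).
  by have := memvZ (tc n 0 m : K)^-1 (inW n nm); rewrite scalerA mulVf // scale1r.
case: (boolP (simple_low n)) => [good|bad]; first by exists n.
have [k [n' [c [n'm good c0 Ek]]]] := non_simple_low nm bad.
exists n'; split=> //.
have : xiter D k (low n) \in (W : {vspace T}).
  by elim: (k) => [//|i IH]; apply: submod_opx.
by rewrite Ek => /(memvZ c^-1); rewrite scalerA mulVf // scale1r.
Qed.

End TensorStrings.

(** * Simple submodules and socle of the tensor product *)

Section DoubleModules.
Variables (K : fieldType) (H : hopfAlg K).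

Lemma ddiso_of_bij (M N : ddmod H) (phi : N -> M) : lin phi ->
  (forall d n, phi (dd_act d n) = dd_act d (phi n)) ->
  (forall n, phi n = 0 -> n = 0) -> (forall m, exists n, phi n = m) -> ddiso M N.
Proof.
move=> L phiA phi0 phiS; pose P : 'Hom(N, M) := linfun phi.
have PE : P =1 phi by exact: linfun_lin.
have ker0 : lker P == 0%VS.
  by apply/eqP/vspaceP => n; rewrite memv_ker memv0 PE; apply/eqP/eqP => [/phi0|->] //;
    rewrite (lin0 L).
have imT m : m \in limg P.
  by have [n <-] := phiS m; rewrite -PE memv_img ?memvf.
have VK : cancel (P^-1)%VF P by move=> m; apply: limg_lfunVK.
exists (P^-1)%VF; split.
  by exists P => //; apply: lker0_lfunK.
move=> d m; apply: (can_inj (lker0_lfunK ker0)).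
by rewrite VK [RHS]PE phiA -PE VK.
Qed.

Lemma ddiso_sub_of_inj (M N : ddmod H) (S : submodule M) (phi : N -> M) :
  lin phi -> (forall d n, phi (dd_act d n) = dd_act d (phi n)) ->
  (forall n, phi n = 0 -> n = 0) -> (forall n, phi n \in (S : {vspace M})) ->
  (forall m, m \in (S : {vspace M}) -> exists n, phi n = m) ->
  ddiso (sub_ddmod S) N.
Proof.
move=> L phiA phi0 phiS Sphi; pose psi n : sub_ddmod S := vsproj S (phi n).
have psiE n : vsval (psi n) = phi n by rewrite vsprojK.
apply: (@ddiso_of_bij _ _ psi).
- move=> c m n; apply: val_inj; rewrite [LHS]psiE L [RHS]linearP /= -!psiE //.
- by move=> d n; apply: val_inj; rewrite [LHS]psiE phiA [RHS]sub_actE psiE.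
- by move=> n E; apply: phi0; rewrite -psiE E.
move=> m; have [n E] := Sphi _ (subvsP m).
by exists n; apply: val_inj; rewrite [LHS]psiE.
Qed.

Lemma sum_submod_stable (M : ddmod H) (I : finType) (U : I -> submodule M) d m :
  m \in (\sum_i U i)%VS -> dd_act d m \in (\sum_i U i)%VS.
Proof.
case/memv_sumP => us Uus ->; have [_ B] := dd_bilin M.
rewrite (lin_sum _ (B d)); apply: memv_sumr => i _.
by apply: sub_stable; apply: Uus.
Qed.

Definition sum_submod (M : ddmod H) (I : finType) (U : I -> submodule M) :
  submodule M := Submodule (@sum_submod_stable M I U).

End DoubleModules.

(** The partial sums are m (r + r' + 2 - m). *)
Lemma clebsch_gordan_dim (r r' : nat) :
  (\sum_(0 <= i < (minn r r').+1) (r + r' - 2 * i).+1 = r.+1 * r'.+1)%N.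
Proof.
have sumE m : (m <= (minn r r').+1)%N ->
    (\sum_(0 <= i < m) (r + r' - 2 * i).+1 = m * ((r + r').+2 - m))%N.
  elim: m => [|m IH] le; first by rewrite big_geq.
  rewrite big_nat_recr //= IH ?(ltnW le) //.
  have : (m <= r /\ m <= r')%N by apply/andP; rewrite -leq_min -ltnS.
  by case=> mr mr'; nia.
by rewrite sumE //; case: (leqP r r') => rr; nia.
Qed.

Section TensorDecomposition.
Variables (K : fieldType) (gT : finGroupType) (chi : character K gT) (a : gT).
Variables (l : nat) (H : hopfAlg K) (D : HD_structure chi a l H).
Variable F : hd_frame D.
Local Notation q := (chi a).
Hypotheses (prq : l.-primitive_root q) (l1 : (1 < l)%N).
Hypothesis abelG : abelian [set: gT].
Variables M N : ddmod H.
Local Notation T := (ddtens M N).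
Variables (beta beta' : character K gT) (gam gam' : gT) (r r' : nat) (v : M) (v' : N).
Hypotheses (SM : string F beta gam r v) (SN : string F beta' gam' r' v').
Hypotheses (fullM : string_space D r v = fullv) (fullN : string_space D r' v' = fullv).
Local Notation mn := (minn r r').
Local Notation low := (low D gam gam' r r' v v').
Local Notation low_char := (low_char chi beta beta').
Local Notation low_grp := (low_grp a gam gam').
Local Notation low_len := (low_len r r').
Local Notation simple_low := (simple_low l r r').
Local Notation U j := (string_space D (low_len j) (low j)).
Local Notation tc := (tcoord D r r' v v').

Let stringU j : (j <= mn)%N -> simple_low j ->
  string F (low_char j) (low_grp j) (low_len j) (low j).
Proof. exact: string_low. Qed.

(** Applying xi reduces a vanishing sum to one of multiples of the [low j],
    which the coordinates (j, 0) separate; the induction is on the power of xi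
    that kills all terms. *)
Lemma low_strings_independent (js : seq nat) (us : nat -> T) : uniq js ->
  (forall j, j \in js -> (j <= mn)%N && simple_low j) ->
  (forall j, j \in js -> us j \in U j) -> \sum_(j <- js) us j = 0 ->
  forall j, j \in js -> us j = 0.
Proof.
move=> ujs good; have Lxi := opxi_lin F T.
suff nil k : forall us : nat -> T, (forall j, j \in js -> iter k (opxi F) (us j) = 0) ->
    (forall j, j \in js -> us j \in U j) -> \sum_(j <- js) us j = 0 ->
    forall j, j \in js -> us j = 0.
  by apply: (nil l) => j _; exact: (opxi_nilpotent F prq l1 (us j : T)).
elim: k => [//|k IH] {}us us0 usU sum0.
have xi0 j : j \in js -> opxi F (us j) = 0.
  apply: (IH (fun j => opxi F (us j))) => {j} [j jjs|j jjs|].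
  - by rewrite -iterSr us0.
  - have /andP[jm gj] := good j jjs.
    exact: (string_stable prq l1 (stringU jm gj)) (usU j jjs).
  - have S0 := congr1 (opxi F) sum0; rewrite (lin0 Lxi) in S0; rewrite -[RHS]S0.
    by rewrite (big_morph _ (linD Lxi) (lin0 Lxi)).
move=> j jjs; have /andP[jm gj] := good j jjs.
have usE i : i \in js -> exists c, us i = c *: low i.
  move=> ijs; have /andP[im gi] := good i ijs.
  exact: (string_xi_kernel prq l1 (stringU im gi) (usU i ijs) (xi0 i ijs)).
have Lt := tcoord_lin D r r' v v' j 0.
have := congr1 (tc j 0) sum0.
rewrite (big_morph _ (linD Lt) (lin0 Lt)) (bigD1_seq j) //= big_seq_cond big1.
  have [c ->] := usE j jjs; rewrite addr0 (linZ Lt) (tcoord_low0 prq l1 SM SN) //.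
  by rewrite eqxx (lin0 Lt) => E; rewrite -[c]mulr1 [c * 1]E scale0r.
move=> i /andP[ijs ne]; have [c ->] := usE i ijs.
have /andP[im _] := good i ijs.
by rewrite (linZ Lt) (tcoord_low0 prq l1 SM SN) // eq_sym (negbTE ne) scaler0.
Qed.

Variable B : nat -> ddmod H.
Hypothesis stringB : forall j, (j <= mn)%N -> simple_low j ->
  exists w : B j, string F (low_char j) (low_grp j) (low_len j) w /\
    string_space D (low_len j) w = fullv.

(** The sum of the morphisms onto the strings of the [low j].  A preimage is
    described by its components, and these vanish together with the image of
    n by independence. *)
Lemma ddsum_to_tensor (js : seq nat) : uniq js ->
  (forall j, j \in js -> (j <= mn)%N && simple_low j) ->
  exists phi : \big[@ddsum _ _/@ddzero _ _]_(j <- js) B j -> T,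
  [/\ lin phi, forall d n, phi (dd_act d n) = dd_act d (phi n),
    forall n, exists us : nat -> T, [/\ forall j, j \in js -> us j \in U j,
      phi n = \sum_(j <- js) us j & (forall j, j \in js -> us j = 0) -> n = 0] &
    forall j (t : T), j \in js -> t \in U j -> exists n, phi n = t].
Proof.
elim: js => [|j js IH] /=.
  move=> _ _; rewrite big_nil; exists (fun=> 0); split=> //.
  - by move=> c m n; rewrite scaler0 addr0.
  - by move=> d n; exact: esym (lin0 (proj2 (dd_bilin T) d)).
  - by move=> n; exists (fun=> 0); split=> //; [rewrite big_nil | rewrite [n]thinmx0].
case/andP=> jjs ujs good.
have /andP[jm gj] := good j (mem_head _ _).
have [|phi [Lphi phiA phiE phiS]] := IH ujs.
  by move=> i ijs; apply: good; rewrite inE ijs orbT.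
have [w [Sw fullw]] := stringB jm gj.
pose h := string_hom D (low_len j) w (low j).
have Lh : lin h by apply: string_hom_lin.
have hA := string_hom_act prq l1 Sw fullw (stringU jm gj).
rewrite big_cons.
exists (fun p : ddsum (B j) _ => h p.1 + phi p.2); split.
- by move=> c m n; rewrite Lh Lphi scalerDr addrACA.
- move=> d n; apply: etrans (esym (linD (proj2 (dd_bilin T) d) _ _)).
  by rewrite -phiA; congr (_ + _); apply: hA.
- move=> n; have [us [usU E E0]] := phiE n.2.
  exists (fun i => if i == j then h n.1 else us i); split.
  + move=> i; rewrite inE; case: (eqVneq i j) => [-> _|_ /usU //].
    exact: (string_hom_in D (low_len j) w (low j) n.1).
  + rewrite big_cons eqxx E; congr (_ + _); apply: eq_big_seq => i ijs.
    by case: eqP => [ij|//]; rewrite -ij ijs in jjs.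
  + move=> us0; rewrite [n]surjective_pairing; congr (_, _).
      apply: (string_hom_inj prq l1 fullw (stringU jm gj)).
      by have := us0 j (mem_head _ _); rewrite eqxx.
    apply: E0 => i ijs; have := us0 i; rewrite inE ijs orbT => /(_ isT).
    by case: eqP => [ij|//]; rewrite -ij ijs in jjs.
move=> i t; rewrite inE => /orP[/eqP ->|ijs] tU.
  have [m E] := string_hom_surj (N := T) prq l1 Sw fullw tU.
  by exists (m, 0); rewrite /= (lin0 Lphi) addr0.
have [n E] := phiS i t ijs tU.
by exists (0, n); rewrite /= (lin0 Lh) add0r.
Qed.

Variable lo : nat.
Hypothesis loE : forall j, simple_low j = (lo <= j)%N.
Local Notation js := (index_iota lo mn.+1).

Let index_good j : j \in js -> (j <= mn)%N && simple_low j.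
Proof. by rewrite mem_index_iota ltnS loE andbC. Qed.

Let shift_good (i : 'I_(mn.+1 - lo)) : (i + lo \in js)%N.
Proof. by rewrite mem_index_iota leq_addl /=; have := ltn_ord i; lia. Qed.

Definition tensor_simple (i : 'I_(mn.+1 - lo)) : submodule T :=
  string_submod prq l1
    (stringU (proj1 (andP (index_good (shift_good i))))
             (proj2 (andP (index_good (shift_good i))))).

Lemma tensor_simpleP i : ddsimple (tensor_simple i).
Proof. exact: string_simple. Qed.

(** A simple submodule contains some [low j] that generates a string, so it is
    that string. *)
Lemma simple_sub_tensor_simple (W : submodule T) : ddsimple W ->
  (W <= \sum_i tensor_simple i)%VS.
Proof.
case=> W0 Wmin.
have [j [jm gj jW]] := submod_low prq l1 SM SN fullM fullN abelG W0.
have UW := string_sub D (low_len j) jW.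
have [E|E] := Wmin (string_submod prq l1 (stringU jm gj)) UW.
  by have [] := string_simple prq l1 (stringU jm gj); rewrite E eqxx.
have lj : (lo <= j)%N by rewrite -loE.
rewrite -E /=.
have ij : (j - lo < mn.+1 - lo)%N by lia.
apply: (sumv_sup (Ordinal ij)) => //=.
by rewrite subnK.
Qed.

Definition tensor_socle : submodule T := sum_submod tensor_simple.

Lemma tensor_socleP : is_socle tensor_socle.
Proof.
move=> m; split=> [mS|[n [W [simW mW]]]].
  by exists _, tensor_simple; split; first exact: tensor_simpleP.
apply: subvP mW; apply/subv_sumP => i _; exact: simple_sub_tensor_simple.
Qed.

Lemma tensor_simple_directv : directv (\sum_i tensor_simple i)%VS.
Proof.
apply/directv_sum_independent => us Uus sum0 i _.
(* reindexes the family by the degrees lo, ..., min(r, r') *)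
pose us' j := if (lo <= j)%N then
  (if insub (j - lo)%N is Some i then us (i : 'I_(mn.+1 - lo)) else 0) else 0.
have us'E (k : 'I_(mn.+1 - lo)) : us' (k + lo)%N = us k.
  rewrite /us' leq_addl addnK (insubT (fun k => k < mn.+1 - lo)%N (ltn_ord k)).
  by congr us; apply: val_inj.
rewrite -us'E; apply: (low_strings_independent (js := js)) (shift_good i).
- exact: iota_uniq.
- exact: index_good.
- move=> j; rewrite mem_index_iota => /andP[lj jm].
  have ij : (j - lo < mn.+1 - lo)%N by lia.
  rewrite -(subnK lj) -[X in X \in _]/(us' (Ordinal ij + lo)%N) us'E.
  exact: Uus.
rewrite -{1}[lo]add0n big_addn big_mkord -[RHS]sum0.
by apply: eq_bigr => k _; rewrite us'E.
Qed.

Lemma ddsum_to_socle : exists phi : \big[@ddsum _ _/@ddzero _ _]_(j <- js) B j -> T,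
  [/\ lin phi, forall d n, phi (dd_act d n) = dd_act d (phi n),
    forall n, phi n = 0 -> n = 0, forall n, phi n \in (tensor_socle : {vspace T}) &
    forall m, m \in (tensor_socle : {vspace T}) -> exists n, phi n = m].
Proof.
have [phi [Lphi phiA phiE phiS]] := ddsum_to_tensor (iota_uniq _ _) index_good.
exists phi; split=> //.
- move=> n E; have [us [usU E' E0]] := phiE n; apply: E0.
  apply: (low_strings_independent (iota_uniq _ _) index_good usU).
  by rewrite -E' E.
- move=> n; have [us [usU -> _]] := phiE n.
  rewrite -{1}[lo]add0n big_addn big_mkord; apply: memv_sumr => i _.
  exact: usU (shift_good i).
move=> m /memv_sumP [us Uus ->].
have ex i : exists n, phi n = us i by apply: phiS (shift_good i) (Uus i isT).
apply: (big_ind (fun m => exists n, phi n = m)) => [|m1 m2 [n1 <-] [n2 <-]|i _].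
- by exists 0; apply: lin0.
- by exists (n1 + n2); apply: linD.
exact: ex.
Qed.

Lemma tensor_socle_iso :
  ddiso (sub_ddmod tensor_socle) (\big[@ddsum _ _/@ddzero _ _]_(j <- js) B j).
Proof.
by have [phi [L phiA phi0 phiS Sphi]] := ddsum_to_socle; apply: ddiso_sub_of_inj Sphi.
Qed.

Lemma dim_full_string (M1 : ddmod H) beta1 gam1 s (w : M1) :
  string F beta1 gam1 s w -> string_space D s w = fullv -> \dim {:M1} = s.+1.
Proof. by move=> S <-; exact: (dim_string prq l1 S). Qed.

Lemma tensor_socle_full : lo = 0%N -> (tensor_socle : {vspace T}) = fullv.
Proof.
move=> lo0; apply/eqP; rewrite eqEdim subvf /=.
have /directvP /= -> := tensor_simple_directv.
rewrite dimvf /dim /= (dim_full_string SM fullM) (dim_full_string SN fullN).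
rewrite (eq_bigr (fun i : 'I_(mn.+1 - lo) => (low_len (i + lo)).+1)); last first.
  move=> i _; have /andP[im gi] := index_good (shift_good i).
  exact: (dim_string prq l1 (stringU im gi)).
rewrite -(big_mkord xpredT (fun i => (low_len (i + lo)).+1)) lo0 subn0.
rewrite -clebsch_gordan_dim; apply: eq_leq; apply: eq_bigr => i _.
by rewrite addn0.
Qed.

(** All the strings lie in degrees at least lo. *)
Lemma tensor_socle_proper : (0 < lo)%N -> (tensor_socle : {vspace T}) != fullv.
Proof.
move=> lo0; apply/eqP => E.
have Lt := tcoord_lin D r r' v v' 0 0.
have tU t : t \in (tensor_socle : {vspace T}) -> tc 0 0 t = 0.
  case/memv_sumP => us Uus ->; rewrite (lin_sum _ Lt) big1 // => i _.
  have /string_spaceP [c ->] := Uus i isT.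
  rewrite (lin_sum _ Lt) big1 // => k _; rewrite (linZ Lt).
  have /andP[im _] := index_good (shift_good i).
  rewrite (homog_xiter prq l1 SM SN fullM fullN (k := k) im) ?scaler0 //; lia.
have := tU (low 0) ; rewrite E memvf => /(_ isT).
by rewrite (tcoord_low0 prq l1 SM SN) // eqxx => /eqP; rewrite oner_eq0.
Qed.

Lemma completely_reducible_iff : completely_reducible T <-> lo = 0%N.
Proof.
split=> [[n [W [simW sumW _]]]|lo0].
  apply/eqP; rewrite eqn0Ngt; apply/negP => /tensor_socle_proper /eqP; apply.
  apply/eqP; rewrite eqEsubv subvf /= -sumW.
  by apply/subv_sumP => i _; apply: simple_sub_tensor_simple.
exists (mn.+1 - lo)%N, tensor_simple; split.
- exact: tensor_simpleP.
- exact: tensor_socle_full.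
- exact: tensor_simple_directv.
Qed.

Lemma tensor_iso : lo = 0%N ->
  ddiso T (\big[@ddsum _ _/@ddzero _ _]_(j <- js) B j).
Proof.
move=> lo0; have [phi [L phiA phi0 _ Sphi]] := ddsum_to_socle.
apply: ddiso_of_bij L phiA phi0 _ => m; apply: Sphi.
by rewrite tensor_socle_full // memvf.
Qed.

End TensorDecomposition.

(** * Classes modulo the kernel of the evaluation *)

Section Classes.
Variables (K : fieldType) (gT : finGroupType) (chi : character K gT) (a : gT).
Local Notation q := (chi a).
Implicit Type p : gT * character K gT.

Lemma evM p p' : ev chi a (p * p')%g = ev chi a p * ev chi a p'.
Proof.
rewrite -[LHS]/((chi^-1)%g (p.1 * p'.1)%g * (p.2 * p'.2)%g a).
by rewrite Defs.charM char_mulE mulrACA.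
Qed.

Lemma ev1 : ev chi a 1%g = 1.
Proof.
rewrite -[LHS]/((chi^-1)%g 1%g * (1%g : character K gT) a).
by rewrite Defs.char1 mul1r ffunE.
Qed.

Lemma ev_neq0 p : ev chi a p != 0.
Proof. by rewrite mulf_neq0 // char_neq0. Qed.

Lemma evV p : ev chi a (p^-1)%g = (ev chi a p)^-1.
Proof.
apply: (mulIf (ev_neq0 p)); rewrite mulVf ?ev_neq0 // -evM mulVg.
exact: ev1.
Qed.

Lemma evX p n : ev chi a (p ^+ n)%g = ev chi a p ^+ n.
Proof.
elim: n => [|n IH]; last by rewrite expgS evM IH exprS.
by rewrite expg0 expr0 ev1.
Qed.

Lemma ev_zpowg p c : ev chi a (zpowg p c) = ev chi a p ^ c.
Proof. by case: c => n /=; rewrite ?evV evX. Qed.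

(** ev takes the value q^2 on (a^-1, chi), and 2c is rc l c modulo l. *)
Lemma same_class_ev l (g : gT) (beta : character K gT) (c : int) :
  l.-primitive_root q -> (0 < l)%N ->
  same_class chi a (g, beta) (zpowg ((a^-1)%g, chi) c) ->
  beta a = chi g * q ^+ rc l c.
Proof.
move=> prq l0; rewrite /same_class evM evV ev_zpowg => E.
have {}E : ev chi a (g, beta) = ev chi a ((a^-1)%g, chi) ^ c.
  by rewrite -[RHS](mulVKf (ev_neq0 (g, beta))) E mulr1.
have q0 : q != 0 := char_neq0 chi a.
have qu : q \is a GRing.unit by rewrite unitfE.
have base : ev chi a ((a^-1)%g, chi) = q ^ 2.
  by rewrite /ev /= char_invE char_inv_grp invrK.
have pw : q ^ (2 * c) = q ^+ rc l c.
  rewrite {1}(divz_eq (2 * c) l%:Z) expfzDr // [(_ * l%:Z)%R]mulrC -exprz_exp.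
  rewrite -exprnP prim_expr_order // exp1rz mul1r /rc [RHS]exprnP gez0_abs //.
  by rewrite modz_ge0 // eqz_nat -lt0n.
rewrite base exprz_exp pw in E; rewrite -E /ev /= char_invE mulVKf //.
exact: char_neq0.
Qed.

Lemma rc_lt l c : (0 < l)%N -> (rc l c < l)%N.
Proof.
move=> l0; rewrite -ltz_nat /rc gez0_abs ?ltz_pmod // modz_ge0 //.
by rewrite eqz_nat -lt0n.
Qed.

End Classes.

Theorem theorem3p18 (K : closedFieldType) (charK0 : [pchar K] =i pred0)
    (gT : finGroupType) (abelG : abelian [set: gT])
    (chi : character K gT) (a : gT) (l M N : nat)
    (ord_chia : l.-primitive_root (chi a)) (l_ge2 : (2 <= l)%N)
    (ord_chi : has_order chi M) (ord_a : has_order a N)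
    (lM : l = M) (MN : M = N) (odd_l : odd l)
    (H : hopfAlg K) (D : HD_structure chi a l H)
    (ext : character K gT -> 'AHom(H, K^o)) (extP : is_extension D ext)
    (g g' : gT) (beta beta' : character K gT) (c c' : int)
    (cP : same_class chi a (g, beta)
            (zpowg ((a^-1)%g, chi) c))
    (cP' : same_class chi a (g', beta')
            (zpowg ((a^-1)%g, chi) c')) :
  let r := rc l c in
  let r' := rc l c' in
  let Hb (gamma : character K gT) (y : gT) : ddmod H :=
    bullet_module (ext gamma) (hd_grouplike D y) in
  let T := ddtens (Hb beta g) (Hb beta' g') in
  let g_ (j : nat) := (g * g' * a ^+ j)%g in
  let beta_ (j : nat) := (chi ^- j * beta * beta')%g in
  let t := (r + r' - l + 1)%N in
  [/\ completely_reducible T <-> (r + r' < l)%N,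
      (r + r' < l)%N ->
        ddiso T (\ddsum_(0 <= j < (minn r r').+1) Hb (beta_ j) (g_ j)) &
      (l <= r + r')%N ->
        exists S : submodule T, is_socle S /\
          ddiso (sub_ddmod S)
            (\ddsum_((t + 1) %/ 2 <= j < (minn r r').+1) Hb (beta_ j) (g_ j))].
Proof.
move=> r r' Hb T g_ beta_ t.
have l0 : (0 < l)%N by apply: ltnW.
have [F] := hd_frame_exists D l_ge2.
have zE := same_class_ev ord_chia l0 cP; have zE' := same_class_ev ord_chia l0 cP'.
have rl := rc_lt c l0; have rl' := rc_lt c' l0.
have SM := bullet_string F abelG extP zE rl.
have SN := bullet_string F abelG extP zE' rl'.
have fM := bullet_full F abelG extP zE rl; have fN := bullet_full F abelG extP zE' rl'.
have stringB j : (j <= minn r r')%N -> simple_low l r r' j ->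
    exists w : Hb (beta_ j) (g_ j), string F (beta_ j) (g_ j) (low_len r r' j) w /\
      string_space D (low_len r r' j) w = fullv.
  move=> jm gj; have S := string_low ord_chia l_ge2 SM SN fM fN abelG jm gj.
  have zj := sing_s (str_sing S); have lj := str_lt S.
  by exists (bullet_gen D ext (beta_ j) (g_ j)); split;
    [apply: bullet_string zj lj | apply: bullet_full zj lj].
pose lo := if (r + r' < l)%N then 0%N else ((t + 1) %/ 2)%N.
have loE j : simple_low l r r' j = (lo <= j)%N.
  rewrite /simple_low /lo /t; case: ifP => lt; apply/idP/idP; lia.
have lo0 : lo = 0%N <-> (r + r' < l)%N.
  by rewrite /lo /t; case: ifP => lt; split=> //; lia.
have iff := completely_reducible_iff ord_chia l_ge2 abelG SM SN fM fN loE.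
split=> [|lt|ge]; first exact: iff_trans iff lo0.
  have := tensor_iso ord_chia l_ge2 abelG SM SN fM fN stringB loE (proj2 lo0 lt).
  by rewrite /lo lt.
exists (tensor_socle ord_chia l_ge2 abelG SM SN fM fN loE); split.
  exact: tensor_socleP.
have -> : ((t + 1) %/ 2)%N = lo by rewrite /lo ltnNge ge.
exact: (tensor_socle_iso ord_chia l_ge2 abelG SM SN fM fN stringB loE).
Qed.
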